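(* There is a constant $C\ge0$ depending only on $d$ such that the following holds. Let $d\ge2$ and $M\in\mathbb{N}$, and let $g$ be a real-valued function, invariant under weighted isomorphisms, that takes as input finite simplicial complexes with weights on their $d$-simplices. Define the function $f$ on weighted $d$-complexes $\mathbb{X}$ in $\mathcal{K}_n$ by \[ f(\mathbb{X})=\sum_{\sigma\in F_{d-1}(\mathcal{K}_n)}g((\mathbb{X},\sigma)_M), \] and assume that $f$ is $H$-Lipschitz with $J_n<\infty$. Let $\mathbb{X}_n$ be the randomly weighted $d$-complex with parameters $p_n\in(0,1)$ and weight distribution $D_n$. Then, for every $k\in\mathbb{N}$ with $2M\le k\le n$, \begin{align*} &d_K\Bigl(\mathcal{L}\Bigl(\frac{f(\mathbb{X}_n)-\mathbb{E}[f(\mathbb{X}_n)]}{\sigma_n}\Bigr),\mathcal{N}(0,1)\Bigr)\\ &\le CJ_n^{1/6}(1\vee\lambda_n)^{1/2}\Bigl(\frac{n^d}{\sigma_n^2}\Bigr)^{1/2}\Bigl(\frac{k^5(1\vee d\lambda_n)^{2k}}{n}\Bigr)^{1/12}+\Bigl(\frac{n^d}{\sigma_n^2}\Bigr)^{3/4}\frac{J_n^{1/4}\lambda_n^{1/2}}{n^{d/4}}. \end{align*}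
   Context: Let $[n]=\{1,\dots,n\}$ and let $\mathcal{K}_n=2^{[n]}$ be the complete simplicial complex on $[n]$. A $k$-simplex is a set with $k+1$ elements; $F_k(X)$ is the set of $k$-simplices of a simplicial complex $X$; $\mathcal{K}_n^{(k)}$ is the $k$-skeleton. A $d$-complex in $\mathcal{K}_n$ is a simplicial complex $X$ with $\mathcal{K}_n^{(d-1)}\subset X\subset\mathcal{K}_n^{(d)}$. A weighted $d$-complex in $\mathcal{K}_n$ is a $d$-complex $X$ with a family $\{w_\tau:\tau\in F_d(X)\}$ of nonnegative weights. For $B=\{b_\tau\}$, $W=\{w_\tau\}$ indexed by $\tau\in F_d(\mathcal{K}_n)$, with $b_\tau\in\{0,1\}$ and $w_\tau\in[0,\infty)$, $\mathbb{X}_{(B,W)}$ is the weighted $d$-complex consisting of $\mathcal{K}_n^{(d-1)}$ and those $d$-simplices $\tau$ with $b_\tau=1$, each with weight $w_\tau$. Invariance under weighted isomorphisms means that the value is unchanged under bijective relabelling of vertices that carries simplices to simplices and preserves the weights. For a measurable $H:[0,\infty)^2\to[0,\infty)$, $f$ is $H$-Lipschitz if for all $B,W,B',W'$, \[|f(\mathbb{X}_{(B,W)})-f(\mathbb{X}_{(B',W')})|\le\sum_{\tau:\ b_\tau\vee b'_\tau=1,\ (b_\tau,w_\tau)\ne(b'_\tau,w'_\tau)}H(w_\tau,w'_\tau).\] Functions may depend on $n$; $a\vee b=\max\{a,b\}$. For a $d$-complex $X$ in $\mathcal{K}_n$, a sequence $(\sigma_0,\dots,\sigma_k)$ of $(d-1)$-simplices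 is a path in $X$ of length $k$ if $\sigma_{i-1}\cup\sigma_i$ ($i=1,\dots,k$) are distinct $d$-simplices in $X$. For $\sigma\in F_{d-1}(\mathcal{K}_n)$, $(X,\sigma)_M$ is the simplicial complex generated by $\sigma$ and all the $d$-simplices $\tau$ in $X$ for which there is a path $(\sigma_0,\dots,\sigma_i)$ in $X$ of length at most $M$ with $\sigma_0=\sigma$ and $\sigma_{i-1}\cup\sigma_i=\tau$. For a weighted $d$-complex $\mathbb{X}$, $(\mathbb{X},\sigma)_M$ carries the inherited weights on its $d$-simplices. Random model: $p_n\in(0,1)$, $D_n$ is a probability measure on $[0,\infty)$; $B_n=\{b_{n,\tau}\}$, $W_n=\{w_{n,\tau}\}$ ($\tau\in F_d(\mathcal{K}_n)$) are mutually independent with $b_{n,\tau}\sim\mathrm{Bernoulli}(p_n)$, $w_{n,\tau}\sim D_n$; $\mathbb{X}_n=\mathbb{X}_{(B_n,W_n)}$. $\lambda_n=np_n$, $\sigma_n=\sqrt{\operatorname{Var}(f(\mathbb{X}_n))}$, $J_n=1\vee\mathbb{E}[H(w,w')^6]$ with $w,w'$ independent with law $D_n$. $\mathcal{L}(\cdot)$ denotes the law and $d_K(\mu,\nu)=\sup_{t\in\mathbb{R}}|\mu((-\infty,t])-\nu((-\infty,t])|$ is the Kolmogorov distance. It is understood that $f$ is measurable, $n\ge 2d+2$ and $\sigma_n>0$. *)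

(* Defs.v *)
From HB Require Import structures.
From mathcomp Require Import all_boot all_order all_algebra.
From mathcomp Require Import all_classical all_reals all_analysis.

Set Implicit Arguments.
Unset Strict Implicit.
Unset Printing Implicit Defensive.

Import Order.TTheory GRing.Theory Num.Theory.
Import numFieldNormedType.Exports.

Local Open Scope classical_set_scope.
Local Open Scope ring_scope.

(* [0, +oo[ with the trace of the Borel sigma-algebra of R. *)
Definition weight (R : realType) : Type := {nonneg R}.

Definition wval (R : realType) (x : weight R) : R := x%:num.

HB.instance Definition _ (R : realType) := Choice.on (weight R).
HB.instance Definition _ (R : realType) :=
  isPointed.Build (weight R) (0%:nng : {nonneg R}).

Fact weight_display : measure_display.
Proof. exact: default_measure_display. Qed.

Section weight_measurable.
Variable R : realType.

Definition weight_measurable : set (set (weight R)) :=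
  preimage_set_system [set: weight R] (@wval R) measurable.

Let weight_salgebra : sigma_algebra [set: weight R] weight_measurable.
Proof.
exact: (@sigma_algebra_preimage _ _ _ _ _ (sigma_algebra_measurable R)).
Qed.

Let wm0 : weight_measurable set0.
Proof. by case: weight_salgebra. Qed.

Let wmC A : weight_measurable A -> weight_measurable (~` A).
Proof. by case: weight_salgebra => _ + _ => /[apply]; rewrite setTD. Qed.

Let wmU (F : (set (weight R))^nat) :
  (forall i, weight_measurable (F i)) -> weight_measurable (\bigcup_i F i).
Proof. by case: weight_salgebra => _ _; exact. Qed.

HB.instance Definition _ := isMeasurable.Build weight_display (weight R) wm0 wmC wmU.

End weight_measurable.

(* The vertices of a complex on T are the v such that {v} is a face; T itself
   may be larger. The empty set is allowed as a face, as in 2^[n]. Only the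
   values of [wt] on faces of the relevant dimension are meaningful: see
   [weighted_iso] and [iso_invariant]. *)
Record wcomplex (R : realType) (T : finType) := WComplex {
  faces : {set {set T}};
  wt : {set T} -> weight R;
  faces_closed : forall s t : {set T},
    t \in faces -> s \subset t -> s \in faces }.

Definition is_simplex (T : finType) (k : nat) (s : {set T}) : bool :=
  #|s| == k.+1.

Definition simplices (R : realType) (T : finType) (k : nat)
    (X : wcomplex R T) : {set {set T}} :=
  [set s in faces X | is_simplex k s]%SET.

Definition vertices (R : realType) (T : finType) (X : wcomplex R T) : {set T} :=
  [set v | [set v] \in faces X]%SET.

Definition weighted_iso (R : realType) (d : nat) (T T' : finType)
    (X : wcomplex R T) (Y : wcomplex R T') (phi : T -> T') : Prop :=
  [/\ {in vertices X &, injective phi},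
      faces Y = [set phi @: s | s : {set T} in faces X]%SET &
      forall t, t \in simplices d X -> wt Y (phi @: t)%SET = wt X t].

Definition iso_invariant (R : realType) (d : nat)
    (g : forall T : finType, wcomplex R T -> R) : Prop :=
  forall (T T' : finType) (X : wcomplex R T) (Y : wcomplex R T') (phi : T -> T'),
    weighted_iso d X Y phi -> g T X = g T' Y.

(* F_k(K_n), with 'I_n in the role of [n]. *)
Definition simplex (n k : nat) : finType :=
  {s : {set 'I_n} | is_simplex k s}.

Section complexes.
Variables (R : realType) (n d : nat).

Definition BW_faces (B : simplex n d -> bool) : {set {set 'I_n}} :=
  [set s : {set 'I_n} |
    (#|s| <= d)%N || [exists t : simplex n d, B t && (val t == s)]]%SET.

Lemma BW_closed (B : simplex n d -> bool) (s t : {set 'I_n}) :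
  t \in BW_faces B -> s \subset t -> s \in BW_faces B.
Proof.
rewrite !inE => /orP[td st|]; first by rewrite (leq_trans (subset_leq_card st)).
case/existsP => u /andP[Bu /eqP ut] st.
have [->|nst] := eqVneq s t.
  by apply/orP; right; apply/existsP; exists u; rewrite Bu ut eqxx.
apply/orP; left; rewrite -ltnS.
have <- : #|t| = d.+1 by rewrite -ut; apply/eqP; exact: (valP u).
by apply: proper_card; rewrite finset.properEneq nst.
Qed.

Definition BW_complex (B : simplex n d -> bool) (W : simplex n d -> weight R) :
    wcomplex R 'I_n :=
  {| faces := BW_faces B;
     wt := fun s => oapp W (0%:nng : {nonneg R}) (insub s);
     faces_closed := @BW_closed B |}.

(* (s0 :: p) is a path in X; its length is [size p]. *)
Definition is_path (T : finType) (X : wcomplex R T) (s0 : {set T})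
    (p : seq {set T}) : bool :=
  let steps := pairmap (fun s t => s :|: t)%SET s0 p in
  [&& all (is_simplex d.-1) (s0 :: p),
      all (fun t => t \in simplices d X) steps & uniq steps].

(* t is the last step of a path of length at most M from s0. *)
Definition reachable (T : finType) (X : wcomplex R T) (s0 : {set T}) (M : nat)
    (t : {set T}) : Prop :=
  exists (q : seq {set T}) (s : {set T}),
    [/\ is_path X s0 (rcons q s), (size (rcons q s) <= M)%N &
        (last s0 q :|: s)%SET = t].

Definition local_faces (T : finType) (X : wcomplex R T) (s0 : {set T}) (M : nat) :
    {set {set T}} :=
  [set s : {set T} |
    (s \subset s0) ||
    [exists t : {set T}, `[< reachable X s0 M t >] && (s \subset t)]]%SET.

Lemma local_closed (T : finType) (X : wcomplex R T) (s0 : {set T}) (M : nat)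
    (s t : {set T}) :
  t \in local_faces X s0 M -> s \subset t -> s \in local_faces X s0 M.
Proof.
rewrite !inE => /orP[ts st|]; first by rewrite (fintype.subset_trans st).
case/existsP => u /andP[ru tu] st; apply/orP; right; apply/existsP.
by exists u; rewrite ru (fintype.subset_trans st).
Qed.

Definition local_complex (T : finType) (X : wcomplex R T) (s0 : {set T})
    (M : nat) : wcomplex R T :=
  {| faces := local_faces X s0 M; wt := wt X;
     faces_closed := @local_closed T X s0 M |}.

Definition local_sum (g : forall T : finType, wcomplex R T -> R) (M : nat)
    (X : wcomplex R 'I_n) : R :=
  \sum_(s : simplex n d.-1) g _ (local_complex X (val s) M).

Definition H_lipschitz (H : weight R * weight R -> weight R)
    (f : wcomplex R 'I_n -> R) : Prop :=
  forall (B B' : simplex n d -> bool) (W W' : simplex n d -> weight R),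
    `|f (BW_complex B W) - f (BW_complex B' W')| <=
    \sum_(t : simplex n d | (B t || B' t) && ((B t, W t) != (B' t, W' t)))
      wval (H (W t, W' t)).

End complexes.

(* Generators of the product sigma-algebra on I -> T. *)
Definition cylinders (I : Type) (dT : measure_display) (T : measurableType dT) :
    set (set (I -> T)) :=
  \bigcup_i preimage_set_system [set: I -> T] (fun x => x i) measurable.

Definition BW_measurable (R : realType) (n d : nat)
    (f : wcomplex R 'I_n -> R) : Prop :=
  measurable_fun
    [set: g_sigma_algebraType (@cylinders (simplex n d) _ bool) *
          g_sigma_algebraType (@cylinders (simplex n d) _ (weight R))]
    (fun x => f (BW_complex x.1 x.2)).

Section probability.
Context {R : realType} {dO : measure_display} {Omega : measurableType dO}.
Variable P : probability Omega R.

Definition mutually_independent (I : finType) (E : I -> set (set Omega)) : Prop :=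
  forall (J : {set I}) (A : I -> set Omega),
    (forall i, i \in J -> E i (A i)) ->
    P (\bigcap_(i in [set` J]) A i) = (\prod_(i in J) P (A i))%E.

Definition BW_events (I : Type) (b : I -> {RV P >-> bool})
    (w : I -> {RV P >-> weight R}) (i : I + I) : set (set Omega) :=
  match i with
  | inl t => preimage_set_system [set: Omega] (b t) measurable
  | inr t => preimage_set_system [set: Omega] (w t) measurable
  end.

Definition random_BW (I : finType) (p : R) (D : probability (weight R) R)
    (b : I -> {RV P >-> bool}) (w : I -> {RV P >-> weight R}) : Prop :=
  [/\ forall t A, measurable A -> distribution P (b t) A = bernoulli_prob p A,
      forall t A, measurable A -> distribution P (w t) A = D A &
      mutually_independent (BW_events b w)].

End probability.

Definition J_const (R : realType) (D : probability (weight R) R)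
    (H : weight R * weight R -> weight R) : \bar R :=
  maxe 1%E (\int[(D \x D)%E]_z (wval (H z) ^+ 6)%:E)%E.

Definition kolmogorov_dist (R : realType) (mu nu : set R -> \bar R) : \bar R :=
  ereal_sup (range (fun t : R => `|mu `]-oo, t]%classic - nu `]-oo, t]%classic|%E)).

(* Main.v *)
(** Give every pair (b, w) four independent copies, indexed by two bits. Exchanging the copies
    along the first bit, one simplex at a time, expresses the covariance of two functions of the
    field as a sum over simplices of products of increments; applied to Z and phi(Z) this is
    Stein's method: E[Z phi(Z)] = E[T phi'(Z)] / sigma^2 up to third moments of the increments,
    with T half the sum of the increment products Y_i and E[T] = sigma^2. The same formula along
    the second bit bounds Cov(Y_i, Y_j). An exchange at l changes Y_i only if i and l are joined
    by a walk of adjacent d-simplices, of length at most 2M - 1, whose intermediate steps are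
    open. Two such walks ending at l can be made edge-disjoint, so that the probabilities that
    their steps are open multiply, and counting the vertices of the walks gives a covariance of
    order 1/n for vertex-disjoint i and j. With smoothing at the scale eta of the first term of
    the bound, all errors are at most a multiple of eta. *)

Require Import Defs.
From HB Require Import structures.
From mathcomp Require Import all_boot all_order all_algebra.
From mathcomp Require Import zify ring lra.

Set Implicit Arguments.
Unset Strict Implicit.
Unset Printing Implicit Defensive.

(** * Walks of adjacent simplices *)

Section Walks.
Variables (T : finType) (d : nat).
Implicit Types (s t i l x y : {set T}) (p q : seq {set T}) (O : pred {set T}).

(* A walk [s :: p] runs through (d-1)-simplices; its steps are the d-simplices spanned by
   consecutive ones, and [O] is the set of open d-simplices. *)
Definition steps s p := pairmap (fun s t => s :|: t)%SET s p.

Definition facet : pred {set T} := fun s => #|s| == d.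

Definition walk O s p :=
  all facet (s :: p) && all (fun t => (#|t| == d.+1) && O t) (steps s p).

(* Only the steps strictly between [i] and [l] have to be open. *)
Definition link O i l s p :=
  [&& s \subset i, walk predT s p, uniq (i :: steps s p),
      last i (steps s p) == l & all O (behead (belast i (steps s p)))].

Lemma size_steps s p : size (steps s p) = size p.
Proof. exact: size_pairmap. Qed.

Lemma steps_cat s p q : steps s (p ++ q) = steps s p ++ steps (last s p) q.
Proof. exact: pairmap_cat. Qed.

Lemma walk_cat O s p q : walk O s (p ++ q) = walk O s p && walk O (last s p) q.
Proof.
rewrite /walk steps_cat !all_cat /= all_cat.
have [h|h] := boolP (facet s && all facet p); last first.
  by move: h; case: (facet s) => //= /negbTE ->.
have -> : facet (last s p).
  by move: h => /= h; apply: (allP (h : all facet (s :: p))); exact: mem_last.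
case/andP: h => -> ->.
by rewrite /= !andbA andbC !andbA; do !case: (all _ _).
Qed.

Lemma walk_cons O s x p : walk O s (x :: p) =
  [&& facet s, #|s :|: x| == d.+1, O (s :|: x) & walk O x p].
Proof.
rewrite /walk /=; case: (facet s) => //=; case: (facet x) => //=; last by rewrite !andbF.
by rewrite -andbA; do !case: (all _ _); rewrite ?andbT ?andbF.
Qed.

Lemma walk0 O s : walk O s [::] = facet s.
Proof. by rewrite /walk /= !andbT. Qed.

Lemma sub_walk O O' s p : {subset O <= O'} -> walk O s p -> walk O' s p.
Proof.
move=> OO /andP[h1 h2]; rewrite /walk h1/=; apply: sub_all h2 => t /andP[->].
exact: OO.
Qed.

Lemma last_rev_belast s p : last (last s p) (rev (belast s p)) = s.
Proof. by case: p => [|x p] //=; rewrite rev_cons last_rcons. Qed.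

Lemma walk_rev O s p : walk O s p -> walk O (last s p) (rev (belast s p)).
Proof.
elim: p s => [|x p IH] s //; rewrite walk_cons => /and4P[fs c o w].
rewrite /= rev_cons -cats1 walk_cat IH//= last_rev_belast walk_cons walk0 fs setUC c o.
by case/andP: w => /andP[->].
Qed.

Lemma mem_stepsP t s p : t \in steps s p ->
  exists p1 x p2, p = p1 ++ x :: p2 /\ last s p1 :|: x = t.
Proof.
elim: p s => [|x p IH] s //=; rewrite inE => /orP[/eqP->|/IH[p1 [y [p2 [-> <-]]]]].
  by exists [::], x, p.
by exists (x :: p1), y, p2.
Qed.

Lemma steps_dup s p : ~~ uniq (steps s p) ->
  exists p1 x p2, p = p1 ++ x :: p2 /\ last s p1 :|: x \in steps x p2.
Proof.
elim: p s => [|x p IH] s //=; rewrite negb_and negbK => /orP[h|/IH[p1 [y [p2 [-> h]]]]].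
  by exists [::], x, p.
by exists (x :: p1), y, p2.
Qed.

Lemma facetsU s y t : s \subset t -> y \subset t -> #|t| = d.+1 ->
  facet s -> facet y -> s != y -> s :|: y = t.
Proof.
move=> st yt ct /eqP cs /eqP cy sy; apply/eqP.
rewrite eqEcard subUset st yt ct /= -cs.
have : #|s| < #|s :|: y|.
  apply: proper_card; rewrite properEneq subsetUl andbT.
  apply: contra sy => /eqP E; apply/eqP/esym/eqP.
  by rewrite eqEcard E subsetUr/= -E cs cy.
by [].
Qed.

Lemma minimal_link O i l s p k : #|i| = d.+1 -> s \subset i ->
  walk (predU O (pred2 i l)) s p -> last i (steps s p) = l -> size p <= k ->
  exists s' p', link O i l s' p' /\ size p' <= k.
Proof.
move=> ci; have [m] := ubnP (size p); elim: m s p => // m IH s p.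
rewrite ltnS => pm si wp lp pk.
have [/mem_stepsP[p1 [x [p2 [Ep Ei]]]]|ni] := boolP (i \in steps s p).
  apply: (IH x p2); move: pm wp lp pk; rewrite Ep !size_cat /= ?addnS => pm.
  - by move=> *; lia.
  - by move=> *; rewrite -Ei subsetUr.
  - by rewrite walk_cat walk_cons => /andP[_ /and4P[]].
  - by rewrite steps_cat last_cat /= Ei.
  - by move=> *; lia.
have [up|/steps_dup[p1 [x [p2 [Ep /mem_stepsP[p3 [y [p4 [Ep2 Ey]]]]]]]]] := boolP (uniq (steps s p)).
  exists s, p; split => //.
  rewrite /link si lp eqxx /= ni up /=; apply/andP; split.
    by apply: sub_walk wp.
  case/andP: wp => _ /allP wO.
  move: ni up lp wO; case/lastP: (steps s p) => [|q z] //=.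
  rewrite mem_rcons inE negb_or => /andP[iz iq]; rewrite rcons_uniq => /andP[zq uq].
  rewrite last_rcons => zl wO; rewrite belast_rcons /=; apply/allP => t tq.
  have /wO/andP[_] : t \in rcons q z by rewrite mem_rcons inE tq orbT.
  rewrite /= => /orP[//|/orP[/eqP ti|/eqP tl]].
    by move: iq; rewrite -ti tq.
  by move: zq; rewrite zl -tl tq.
subst p2; subst p.
move: (wp); rewrite walk_cat walk_cons => /andP[w1 /and4P[fs c1 o1]].
rewrite walk_cat walk_cons => /andP[w3 /and4P[fx c2 o2 w4]].
have fy : facet y by case/andP: w4 => /andP[].
set t := last s p1 :|: x in c1 o1 Ey *.
clear ni.
case: p4 => [|z p4] in w4 wp lp pk pm *.
  apply: (IH s (rcons p1 x)) => //; rewrite ?size_rcons.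
  - by move: pm; clear; rewrite !size_cat /= !size_cat /=; lia.
  - by rewrite -cats1 walk_cat w1 walk_cons fs c1 o1 walk0; case/andP: w3 => /andP[].
  - by rewrite -cats1 steps_cat last_cat /= -/t -lp !steps_cat !last_cat /= steps_cat last_cat /= Ey.
  - by move: pk; clear; rewrite !size_cat /= !size_cat /=; lia.
have lp' : last i (steps y (z :: p4)) = l.
  by rewrite -lp !steps_cat !last_cat /= steps_cat last_cat /=.
have [sy|sy] := eqVneq (last s p1) y.
  apply: (IH s (p1 ++ z :: p4)) => //.
  - by move: pm; clear; rewrite !size_cat /= !size_cat /=; lia.
  - by rewrite walk_cat w1 sy w4.
  - by rewrite steps_cat last_cat sy -lp' /=.
  - by move: pk; clear; rewrite !size_cat /= !size_cat /=; lia.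
have sU : last s p1 :|: y = t.
  apply: facetsU => //; [exact: subsetUl|by rewrite -Ey subsetUr|exact/eqP].
apply: (IH s (p1 ++ y :: z :: p4)) => //.
- by move: pm; clear; rewrite !size_cat /= !size_cat /=; lia.
- by rewrite walk_cat w1 walk_cons fs sU c1 o1 w4.
- by rewrite steps_cat last_cat -lp' /=.
- by move: pk; clear; rewrite !size_cat /= !size_cat /=; lia.
Qed.

End Walks.

Section Links.
Variables (T : finType) (d : nat).
Implicit Types (s t i j l x y : {set T}) (p q : seq {set T}) (O : pred {set T}).
Local Notation walk := (@walk T d).
Local Notation link := (@link T d).

Lemma walk_facet O s p : walk O s p -> facet d s.
Proof. by move=> /andP[/= /andP[]]. Qed.

Lemma join_walks O s q x q' x' : walk O s (rcons q x) -> walk O s (rcons q' x') ->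
  let p := rev (belast s q) ++ rcons q' x' in
  [/\ walk O (last s q) p,
      forall i, last i (steps (last s q) p) = last s q' :|: x' &
      size p = (size q + size q').+1].
Proof.
rewrite -!cats1 => w1 w2 p.
have w1' : walk O s q by move: w1; rewrite walk_cat => /andP[].
split.
- by rewrite walk_cat walk_rev// last_rev_belast.
- by move=> i; rewrite steps_cat last_cat last_rev_belast steps_cat last_cat.
- by rewrite /p size_cat size_rev size_belast size_cat addn1 addnS.
Qed.

Lemma link_open O i l s p t : link O i l s p -> t \in steps s p -> t = l \/ O t.
Proof.
case/and5P => _ _ _ /eqP ll /allP h; case/lastP: (steps s p) ll h => // q z.
rewrite last_rcons belast_rcons /= => -> h; rewrite mem_rcons inE => /orP[/eqP|/h]; by [left|right].
Qed.

Lemma last_sub_step i s p : s \subset i -> last s p \subset last i (steps s p).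
Proof.
by case/lastP: p => // p x _; rewrite -cats1 steps_cat last_cat /= last_cat /= subsetUr.
Qed.

Lemma first_step (a : pred {set T}) s p : has a (steps s p) ->
  exists p1 x p2, [/\ p = p1 ++ x :: p2, a (last s p1 :|: x) & ~~ has a (steps s p1)].
Proof.
elim: p s => //= x p IH s; have [ax _|nax /=] := boolP (a (s :|: x)).
  by exists [::], x, p.
move=> /IH[p1 [y [p2 [-> h1 h2]]]]; exists (x :: p1), y, p2; split => //=.
by rewrite negb_or nax.
Qed.

(* If the first walk runs through [j], it is split there, and [b] is true; otherwise the second
   walk stops where it first meets the first one. *)
Lemma disjoint_links O O' i j l s p s' p' : 0 < d -> i != j ->
  link O i l s p -> link O' j l s' p' ->
  exists s1 p1 s2 p2 (b : bool),
    [/\ [/\ s1 \subset i, walk predT s1 p1, s2 \subset j & walk predT s2 p2],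
        uniq [:: i, j & steps s1 p1 ++ steps s2 p2],
        size p1 <= maxn (size p) (size p') /\ size p2 <= maxn (size p) (size p'),
        {in steps s1 p1, forall t, t = l \/ O t} /\
        {in steps s2 p2, forall t, t = l \/ (if b then O t else O' t)} &
        (l = last i (steps s1 p1) \/ l = last j (steps s2 p2)) /\
        exists2 v, has (fun t => v \in t) (i :: steps s1 p1) &
                   has (fun t => v \in t) (j :: steps s2 p2)].
Proof.
move=> d0 ij L L'; have := L; have := L'.
case/and5P => sj w' u' /eqP l' _; case/and5P => si w u /eqP ll _.
have [/mem_stepsP[p1 [x [p2 [Ep Ej]]]]|nj] := boolP (j \in steps s p).
  have Es : steps s p = steps s p1 ++ j :: steps x p2 by rewrite Ep steps_cat /= Ej.
  move: (w); rewrite Ep walk_cat walk_cons => /andP[w1 /and4P[fs c1 o1 w2]].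
  exists s, p1, x, p2, true; split => //.
  - by split => //; rewrite -Ej subsetUr.
  - rewrite -(perm_uniq (s1 := i :: steps s p)) // Es perm_cons.
    by rewrite -(cat1s j) perm_catCA.
  - by rewrite !size_cat /= !leq_max leq_addr -addSnnS leq_addl.
  - by split => t tp; apply: (link_open L); rewrite Es mem_cat ?tp// inE tp !orbT.
  split; first by right; rewrite -ll Es last_cat.
  have /card_gt0P[v vs] : 0 < #|last s p1| by rewrite (eqP fs).
  exists v; last by rewrite /= -Ej inE vs.
  have := subsetP (last_sub_step p1 si) _ vs => h; apply/hasP; exists (last i (steps s p1)) => //.
  exact: mem_last.
have lin : l \in i :: steps s p by rewrite -ll mem_last.
have lj : l != j by apply: contra nj => /eqP E; move: lin; rewrite E inE eq_sym (negbTE ij).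
have hl : has [in i :: steps s p] (steps s' p').
  apply/hasP; exists l => //.
  have := mem_last j (steps s' p'); rewrite l' inE => /orP[/eqP E|//].
  by rewrite E eqxx in lj.
have [p1 [x [p2 [Ep hx hn]]]] := first_step hl.
have Es : steps s' p' = steps s' p1 ++ (last s' p1 :|: x) :: steps x p2 by rewrite Ep steps_cat.
move: (w'); rewrite Ep walk_cat walk_cons => /andP[w1 /and4P[fs c1 o1 w2]].
exists s, p, s', p1, false; split => //.
- move: u'; rewrite Es /= mem_cat negb_or cat_uniq => /andP[/andP[jn _] /andP[u1 _]].
  move: u => /= /andP[iN us]; move: hn => /hasPn hn.
  rewrite cat_uniq us u1 !inE !mem_cat !negb_or ij iN nj jn /= !andbT.
  apply/andP; split; first by apply/negP => /hn; rewrite inE eqxx.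
  by apply/hasPn => t /hn; rewrite inE negb_or => /andP[].
- by rewrite size_cat /= !leq_max leqnn leq_addr orbT.
- by split => t tp; [apply: (link_open L)|apply: (link_open L'); rewrite Es mem_cat tp].
split; first by left.
have /card_gt0P[v vs] : 0 < #|last s' p1| by rewrite (eqP fs).
exists v; first by apply/hasP; exists (last s' p1 :|: x) => //; rewrite inE vs.
have := subsetP (last_sub_step p1 sj) _ vs => h; apply/hasP; exists (last j (steps s' p1)) => //.
exact: mem_last.
Qed.

End Links.

(** * Counting pairs of walks *)

Lemma sum_tuple_cons (A : finType) r (F : r.+1.-tuple A -> nat) :
  \sum_p F p = \sum_(x : A) \sum_(q : r.-tuple A) F [tuple of x :: q].
Proof.
rewrite pair_big /=.
rewrite (reindex (fun z : A * r.-tuple A => [tuple of z.1 :: z.2])) //=.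
exists (fun p => (thead p, [tuple of behead p])) => [[x q]|p] _ /=.
  by rewrite theadE; congr (_, _); apply: val_inj.
by rewrite [p in RHS]tuple_eta; apply: val_inj.
Qed.

Lemma sum_bool_card (A : finType) (P : pred A) : \sum_x P x = #|[set x | P x]|.
Proof. by rewrite -sum1dep_card [RHS]big_mkcond; apply: eq_bigr => x _; case: (P x). Qed.

Section Counting.
Variables (T : finType) (d : nat).
Implicit Types (s x i j : {set T}) (v : T).
Local Notation n := #|T|.

Let adj s x := [&& facet d s, facet d x & #|s :|: x| == d.+1].

Let adj_decomp s x : adj s x -> exists v u,
  [/\ v \in x, v \notin s, u \in s & x = (v |: s) :\ u].
Proof.
case/and3P => /eqP fs /eqP fx /eqP c.
have cI := cardsUI s x; rewrite c fs fx in cI.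
have c1 : #|x :\: s| == 1 by have := cardsID s x; rewrite setIC; lia.
have c2 : #|s :\: x| == 1 by have := cardsID x s; lia.
case/cards1P: c1 => v /setP Ev; case/cards1P: c2 => u /setP Eu.
exists v, u; have := Ev v; have := Eu u; rewrite !inE !eqxx => /andP[ux us] /andP[vs vx].
split => //; apply/setP => z; have := Ev z; have := Eu z; rewrite !inE => <- <-.
by case: (z \in s); case: (z \in x).
Qed.

Let adj_count s : \sum_x adj s x <= n * d.
Proof.
have [fs|nfs] := boolP (facet d s); last first.
  by rewrite big1 // => x _; rewrite /adj (negbTE nfs).
rewrite sum_bool_card -[in X in _ <= X](eqP fs) -cardsT -cardsX.
apply: leq_trans (leq_imset_card (fun z => (z.1 |: s) :\ z.2) _).
apply: subset_leq_card; apply/subsetP => x; rewrite inE => /adj_decomp[v [u [vx vs us ->]]].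
by apply/imsetP; exists (v, u) => //; rewrite !inE.
Qed.

Let adj_count_in s v : v \notin s -> \sum_x (adj s x && (v \in s :|: x)) <= d.
Proof.
move=> vs.
have [fs|nfs] := boolP (facet d s); last first.
  by rewrite big1 // => x _; rewrite /adj (negbTE nfs).
rewrite sum_bool_card -[X in _ <= X](eqP fs).
apply: leq_trans (leq_imset_card (fun u => (v |: s) :\ u) _).
apply: subset_leq_card; apply/subsetP => x.
rewrite !inE (negbTE vs) /= => /andP[/adj_decomp[v' [u [vx vs' us ->]]]].
rewrite !inE (negbTE vs) orbF => /andP[_ /eqP ->].
by apply/imsetP; exists u.
Qed.

Let walkS s x (p : seq {set T}) : walk d predT s (x :: p) = adj s x && walk d predT x p.
Proof.
rewrite walk_cons /adj /=; case: (boolP (walk d predT x p)) => [/walk_facet ->|_].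
  by rewrite !andbT.
by rewrite !andbF.
Qed.

Lemma walk_count r s : \sum_(p : r.-tuple {set T}) walk d predT s p <= (n * d) ^ r.
Proof.
elim: r s => [|r IH] s.
  rewrite expn0; apply: leq_trans (_ : \sum_(p : 0.-tuple {set T}) 1 <= 1).
    by apply: leq_sum => p _; case: (walk _ _ _ _).
  by rewrite sum1_card card_tuple expn0.
rewrite sum_tuple_cons expnS.
apply: (@leq_trans (\sum_x adj s x * (n * d) ^ r)).
  apply: leq_sum => x _; under eq_bigr do rewrite /= walkS -mulnb.
  by rewrite -big_distrr leq_mul2l IH orbT.
by rewrite -big_distrl leq_mul2r adj_count orbT.
Qed.

Lemma walk_count_in r s v : v \notin s ->
  n * (\sum_(p : r.-tuple {set T})
    (walk d predT s p && has (fun t : {set T} => v \in t) (steps s p))) <= r * (n * d) ^ r.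
Proof.
elim: r s => [|r IH] s vs.
  by rewrite big1 ?muln0// => p _; rewrite [p]tuple0 /= andbF.
rewrite sum_tuple_cons.
apply: (@leq_trans (n * (\sum_x (adj s x && (v \in s :|: x)) * (n * d) ^ r) +
   \sum_x adj s x * (r * (n * d) ^ r))).
  rewrite !big_distrr /= -big_split /=; apply: leq_sum => x _.
  have [vx|vx] := boolP (v \in s :|: x).
    rewrite andbT; apply: leq_trans (leq_addr _ _); rewrite leq_mul2l; apply/orP; right.
    apply: leq_trans (_ : \sum_(p : r.-tuple {set T}) adj s x * walk d predT x p <= _).
      by apply: leq_sum => p _; rewrite /= walkS andbT mulnb.
    by rewrite -big_distrr leq_mul2l walk_count orbT.
  rewrite andbF mul0n muln0 add0n.
  under eq_bigr do rewrite /= walkS /= -andbA -mulnb.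
  rewrite -big_distrr /= mulnCA leq_mul2l IH ?orbT//.
  by apply: contra vx => h; rewrite inE h orbT.
rewrite -!big_distrl /= mulSn leq_add//.
  by rewrite expnS -mulnA leq_mul2l leq_mul2r adj_count_in ?orbT.
by rewrite expnS (mulnCA r) leq_mul2r adj_count orbT.
Qed.

Definition walks r i : {set {set T} * r.-tuple {set T}} :=
  [set q : {set T} * r.-tuple {set T} | ((q.1 : {set T}) \subset i) && walk d predT q.1 q.2].

Definition hits v i (q : {set T} * seq {set T}) : bool :=
  has (fun t : {set T} => v \in t) (i :: steps q.1 q.2).

Lemma facets_count i : #|i| = d.+1 -> \sum_(s : {set T}) ((s \subset i) && facet d s) = d.+1.
Proof.
move=> ci; rewrite sum_bool_card.
have := cards_draws i d; rewrite ci binSn => <-; apply: eq_card => s.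
by rewrite !inE.
Qed.

Lemma walks_count r i : #|i| = d.+1 -> #|walks r i| <= d.+1 * (n * d) ^ r.
Proof.
move=> ci; rewrite -sum_bool_card.
rewrite -(pair_big predT predT (fun (s : {set T}) (p : r.-tuple {set T}) => ((s \subset i) && walk d predT s p) : nat)) /=.
rewrite -(facets_count ci) big_distrl /=; apply: leq_sum => s _.
have [fs|nfs] := boolP (facet d s); last first.
  rewrite andbF mul0n leqn0; apply/eqP; apply: big1 => p _.
  by case: (boolP (walk d predT s p)) => [/walk_facet fs|_]; [rewrite fs in nfs|rewrite andbF].
rewrite andbT; under eq_bigr do rewrite -mulnb.
by rewrite -big_distrr leq_mul2l walk_count orbT.
Qed.

Lemma walks_count_in r i v : #|i| = d.+1 -> v \notin i ->
  n * #|[set q in walks r i | hits v i (q.1, val q.2)]| <= r * d.+1 * (n * d) ^ r.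
Proof.
move=> ci vi; rewrite -sum_bool_card.
rewrite (eq_bigr (fun z : {set T} * r.-tuple {set T} => (((z.1 : {set T}) \subset i) && (walk d predT z.1 z.2 &&
   has (fun t : {set T} => v \in t) (steps z.1 z.2))) : nat)); last first.
  by move=> q _; rewrite !inE /hits /= (negbTE vi) /= andbA.
rewrite -(pair_big predT predT (fun (s : {set T}) (p : r.-tuple {set T}) => ((s \subset i) && (walk d predT s p &&
   has (fun t : {set T} => v \in t) (steps s p))) : nat)) /=.
rewrite -(facets_count ci) mulnAC big_distrr [X in _ <= X]mulnC big_distrl /=.
apply: leq_sum => s _; rewrite mulnC.
have [/andP[si fs]|nfs] := boolP ((s \subset i) && facet d s); last first.
  rewrite mulnC mul0n leqn0 muln_eq0; apply/orP; right; apply/eqP; apply: big1 => p _.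
  move: nfs; case: (boolP (s \subset i)) => //= _ nfs.
  by case: (boolP (walk d predT s p)) => [/walk_facet fs|] //; rewrite fs in nfs.
rewrite mul1n mulnC si /=; apply: walk_count_in.
by apply: contra vi; apply/subsetP.
Qed.

Lemma hits_count r j (q : {set T} * r.-tuple {set T}) : #|j| = d.+1 -> q \in walks r j ->
  \sum_v hits v j (q.1, val q.2) <= d.+1 * r.+1.
Proof.
move=> cj; rewrite inE => /andP[_ w].
pose ss := j :: steps q.1 (val q.2).
have h : all (fun t : {set T} => #|t| == d.+1) ss.
  rewrite /= cj eqxx /=; case/andP: w => _; apply: sub_all => t.
  by case/andP.
have -> : r.+1 = size ss by rewrite /= size_steps size_tuple.
apply: (@leq_trans (\sum_v has (fun t : {set T} => v \in t) ss)) => //.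
move: ss h => {q w} s.
elim: s => [|t s IH] /=; first by rewrite big1.
move=> /andP[/eqP ct /IH h].
apply: (@leq_trans (\sum_v ((v \in t) + has (fun t : {set T} => v \in t) s))).
  by apply: leq_sum => v _; case: (v \in t); case: (has _ _).
by rewrite big_split /= mulnS leq_add// sum_bool_card -ct cardsE.
Qed.

Definition meet a b i j : {set ({set T} * a.-tuple {set T}) * ({set T} * b.-tuple {set T})} :=
  [set z | [&& z.1 \in walks a i, z.2 \in walks b j &
     [exists v, hits v i (z.1.1, val z.1.2) && hits v j (z.2.1, val z.2.2)]]].

Lemma meet_count a b i j : #|i| = d.+1 -> #|j| = d.+1 -> [disjoint i & j] ->
  n * #|meet a b i j| <= d.+1 ^ 3 * (a.+1 * b.+1) * (n * d) ^ (a + b).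
Proof.
move=> ci cj dij.
pose A v := #|[set q in walks a i | hits v i (q.1, val q.2)]|.
pose B v := #|[set q in walks b j | hits v j (q.1, val q.2)]|.
have meetAB : #|meet a b i j| <= \sum_v A v * B v.
  rewrite -sum_bool_card.
  apply: (@leq_trans (\sum_z \sum_v (((z.1 \in walks a i) && hits v i (z.1.1, val z.1.2)) *
      ((z.2 \in walks b j) && hits v j (z.2.1, val z.2.2))))).
    apply: leq_sum => z _; case: (z.1 \in walks a i); case: (z.2 \in walks b j) => //=.
    case: existsP => // -[v /andP[h1 h2]].
    by rewrite (bigD1 v) //= h1 h2.
  rewrite exchange_big /=; apply: leq_sum => v _.
  rewrite /A /B -!sum_bool_card big_distrl /=.
  rewrite -(pair_big predT predT (fun (x : {set T} * a.-tuple {set T}) (y : {set T} * b.-tuple {set T}) =>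
    ((x \in walks a i) && hits v i (x.1, val x.2)) * ((y \in walks b j) && hits v j (y.1, val y.2)))) /=.
  by apply: leq_sum => x _; rewrite big_distrr.
have Ale v : A v <= d.+1 * (n * d) ^ a.
  apply: leq_trans (walks_count a ci); apply: subset_leq_card; apply/subsetP => q.
  by rewrite inE => /andP[].
have Bsum : \sum_v B v <= d.+1 * (n * d) ^ b * (d.+1 * b.+1).
  under eq_bigr do rewrite /B -sum_bool_card.
  rewrite exchange_big /=.
  apply: (@leq_trans (\sum_(q : {set T} * b.-tuple {set T}) (q \in walks b j) * (d.+1 * b.+1))).
    apply: leq_sum => q _; case: (boolP (q \in walks b j)) => [qw|_]; last by rewrite big1.
    by rewrite mul1n /=; exact: hits_count.
  rewrite -big_distrl leq_mul2r; apply/orP; right.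
  by rewrite sum_bool_card cardsE; exact: walks_count.
apply: leq_trans (_ : n * (\sum_v A v * B v) <= _); first by rewrite leq_mul2l meetAB orbT.
rewrite (bigID [in i]) /= mulnDr.
apply: (@leq_trans (d.+1 * (d.+1 * (n * d) ^ a * (b * d.+1 * (n * d) ^ b)) +
   a * d.+1 * (n * d) ^ a * (d.+1 * (n * d) ^ b * (d.+1 * b.+1)))).
  apply: leq_add.
    have Ei : d.+1 = \sum_(v in i) 1 by rewrite sum1_card ci.
    rewrite [X in _ <= X * _]Ei big_distrl big_distrr /=; apply: leq_sum => v vi.
    rewrite mul1n mulnCA; apply: leq_mul; first exact: Ale.
    by apply: walks_count_in => //; rewrite (disjointFr dij vi).
  apply: leq_trans (_ : \sum_(v | v \notin i) (a * d.+1 * (n * d) ^ a) * B v <= _).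
    rewrite big_distrr /=; apply: leq_sum => v vi.
    by rewrite mulnA leq_mul2r walks_count_in ?orbT.
  rewrite -big_distrr leq_mul2l; apply/orP; right; apply: leq_trans Bsum.
  by rewrite [X in _ <= X](bigID [in i]) /= leq_addl.
rewrite expnD !expnS expn0.
set N := (n * d) ^ a; set N' := (n * d) ^ b; set D := d.+1; clear.
apply: (@leq_trans (D * (D * (D * 1)) * (b + a * b.+1) * (N * N'))).
  by apply: eq_leq; ring.
by rewrite leq_mul2r leq_mul2l; apply/orP; right; apply/orP; right; lia.
Qed.

End Counting.

From mathcomp Require Import all_classical all_reals all_analysis.
From mathcomp Require Import measurable_realfun.

Import Order.TTheory GRing.Theory Num.Theory.
Import numFieldNormedType.Exports.

Local Open Scope classical_set_scope.
Local Open Scope ring_scope.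

(** * Stein's equation *)

Section Stein.
Context {R : realType}.
Implicit Types (x w t K : R) (v r u : R -> R).

Local Notation gauss := (normal_pdf (0 : R) 1).

Lemma gauss_gt0 x : 0 < gauss x.
Proof.
by rewrite normal_pdfE ?oner_eq0// mulr_gt0 ?expR_gt0 ?normal_peak_gt0 ?oner_eq0.
Qed.

Lemma is_derive_gauss x : is_derive x 1 gauss (- x * gauss x).
Proof.
rewrite normal_pdfE ?oner_eq0// /normal_fun.
apply: is_derive_eq.
rewrite /GRing.scale /=; lra.
Qed.

Lemma mills_bound v r K : (forall x, is_derive x 1 v (r x * gauss x)) ->
  (forall x, `|r x| <= K) -> v x @[x --> +oo] --> 0 ->
  forall w, 0 < w -> w * v w <= K * gauss w.
Proof.
move=> dv rK v0 w w0.
have K0 : 0 <= K by rewrite (le_trans _ (rK 0)).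
pose q x := v x - K * (gauss x * x^-1).
have dq x : 0 < x -> is_derive x 1 q ((r x + K * (1 + x ^- 2)) * gauss x).
  move=> x0; have := dv x; have := is_derive_gauss x => dg dvx.
  have xn0 : x != 0 by rewrite gt_eqF.
  have dV : is_derive x 1 (fun y : R => y^-1) (- x ^- 2).
    have := @is_deriveV R id x 1 1 xn0 (is_derive_id _ _).
    by rewrite /GRing.scale /= mulr1.
  rewrite /q; apply: is_derive_eq.
  by rewrite /GRing.scale /=; field.
have qmono x : w <= x -> q w <= q x.
  move=> wx; have [->//|wltx] := eqVneq w x.
  have wx' : w < x by rewrite lt_neqAle wltx.
  have dq' y : w <= y -> is_derive y 1 q ((r y + K * (1 + y ^- 2)) * gauss y).
    by move=> wy; apply: dq; rewrite (lt_le_trans w0).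
  have dqi y : y \in `]w, x[ -> is_derive y 1 q ((r y + K * (1 + y ^- 2)) * gauss y).
    by rewrite in_itv/= => /andP[/ltW wy _]; exact: dq'.
  have [|c + ] := MVT wx' dqi.
  - apply: continuous_in_subspaceT => y; rewrite inE/= in_itv/= => /andP[wy _].
    by apply: differentiable_continuous; apply/derivable1_diffP; have [] := dq' _ wy.
  rewrite in_itv/= => /andP[/ltW wc _] E; rewrite -subr_ge0 E.
  apply: mulr_ge0; last by rewrite subr_ge0.
  apply: mulr_ge0; last exact/ltW/gauss_gt0.
  have := rK c; rewrite ler_norml => /andP[h1 _].
  have : 0 <= K * c ^- 2.
    by rewrite mulr_ge0 ?invr_ge0 ?exprn_ge0 ?(ltW (lt_le_trans w0 wc)).
  move=> h2;
  rewrite mulrDr mulr1; lra.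
have vge : \forall x \near +oo, q w <= v x.
  near=> x; have wx : w <= x by near: x; apply: nbhs_pinfty_ge; rewrite num_real.
  rewrite (le_trans (qmono _ wx))// /q gerBl// mulr_ge0// divr_ge0 ?normal_pdf_ge0//.
have : q w <= 0 by exact: cvgr_to_ge v0 vge.
rewrite /q subr_le0 -(ler_pM2l w0) => h; apply: (le_trans h).
rewrite le_eqVlt; apply/orP; left; apply/eqP; field.
by rewrite gt_eqF.
Unshelve. all: end_near. Qed.

Lemma gaussN x : gauss (- x) = gauss x.
Proof. by rewrite !normal_pdfE ?oner_eq0// /normal_fun !subr0 sqrrN. Qed.

Lemma stein_bound u r K :
  (forall x, is_derive x 1 u (x * u x + r x)) -> (forall x, `|r x| <= K) ->
  u x * gauss x @[x --> +oo] --> 0 -> u (- x) * gauss x @[x --> +oo] --> 0 ->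
  forall w, `|w * u w| <= K /\ `|u w| <= 3 * K.
Proof.
move=> du rK up un.
have K0 : 0 <= K by rewrite (le_trans _ (rK 0)).
have key (u0 r0 : R -> R) : (forall x, is_derive x 1 u0 (x * u0 x + r0 x)) ->
    (forall x, `|r0 x| <= K) -> u0 x * gauss x @[x --> +oo] --> 0 ->
    forall w, 0 < w -> w * u0 w <= K.
  move=> du0 r0K u0p w w0.
  have := @mills_bound (fun x => u0 x * gauss x) r0 K _ r0K u0p w w0.
  rewrite mulrA ler_pM2r ?gauss_gt0//; apply => x.
  have dx := du0 x; have dg := is_derive_gauss x.
  by apply: is_derive_eq; rewrite /GRing.scale /=; ring.
have duN x : is_derive x 1 (fun y => - u y) (x * - u x + - r x).
  by have dx := du x; apply: is_derive_eq; ring.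
have dux x : is_derive x 1 (fun y => u (- y)) (x * u (- x) + - r (- x)).
  have dx := du (- x).
  have := @is_derive1_comp _ u (fun y : R => - y) x _ _ dx (is_deriveN (is_derive_id _ _)).
  by move=> dd; apply: (is_derive_eq dd); rewrite /GRing.scale /=; ring.
have duxN x : is_derive x 1 (fun y => - u (- y)) (x * - u (- x) + r (- x)).
  by have dx := dux x; apply: is_derive_eq; ring.
have cN (f : R -> R) : f x * gauss x @[x --> +oo] --> 0 -> - f x * gauss x @[x --> +oo] --> 0.
  move=> h; rewrite (_ : (fun x => _) = - (fun x => f x * gauss x)); last first.
    by apply/funext => x; rewrite mulNr.
  by rewrite -[X in _ --> X]oppr0; exact: cvgN.
have H w : 0 < w -> `|w * u w| <= K /\ `|w * u (- w)| <= K.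
  move=> w0; split; rewrite ler_norml; apply/andP; split.
  - rewrite lerNl -mulrN; apply: (key _ (fun x => - r x) duN _ _ _ w0).
      by move=> x; rewrite normrN; exact: rK.
    exact: cN.
  - exact: (key _ _ du rK up).
  - rewrite lerNl -mulrN; apply: (key _ (fun x => r (- x)) duxN _ _ _ w0).
      by move=> x; exact: rK.
    exact: cN.
  - apply: (key _ (fun x => - r (- x)) dux _ un _ w0).
    by move=> x; rewrite normrN; exact: rK.
have H1 w : `|w * u w| <= K.
  have [w0|w0|->] := ltgtP w 0; last by rewrite mul0r normr0.
    have /H[_] : 0 < - w by rewrite oppr_gt0.
    by rewrite opprK mulNr normrN.
  by have [] := H _ w0.
have lip a b : a <= b -> `|u b - u a| <= 2 * K * (b - a).
  move=> ab.
  have [|c _ E] := MVT_segment ab (fun x _ => du x).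
    apply: continuous_subspaceT => y.
    by apply: differentiable_continuous; apply/derivable1_diffP; have [] := du y.
  rewrite E normrM (ger0_norm (x := b - a)) ?subr_ge0//.
  rewrite ler_wpM2r ?subr_ge0// (le_trans (ler_normD _ _))//.
  have := H1 c; have := rK c; lra.
move=> w; split; first exact: H1.
have big x : 1 <= `|x| -> `|u x| <= K.
  move=> x1; have := H1 x; rewrite normrM.
  by apply: le_trans; rewrite ler_peMl.
have [w1|w1] := leP 1 `|w|.
  by rewrite (le_trans (big _ w1))// ler_peMl// ler1n.
move: w1; rewrite ltr_norml => /andP[w1 w2].
have [w0|w0] := leP 0 w.
  have := lip w 1 (ltW w2).
  have := big 1; rewrite normr1 lexx => /(_ isT) h1 h2.
  have : `|u w| <= `|u 1| + `|u 1 - u w| by rewrite distrC -{1}(subrKC (u 1) (u w)) ler_normD.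
  by nra.
have := lip (-1) w (ltW w1).
have := big (- 1); rewrite normrN1 lexx => /(_ isT) h1 h2.
have : `|u w| <= `|u (-1)| + `|u w - u (-1)| by rewrite -{1}(subrKC (u (-1)) (u w)) ler_normD.
by nra.
Qed.
End Stein.

Section SteinSolution.
Context {R : realType}.
Local Notation mu := (@lebesgue_measure R).
Local Notation gauss := (normal_pdf (0 : R) 1).

Lemma gauss_cvg0 : gauss x @[x --> +oo] --> 0.
Proof.
have P0 := @normal_peak_ge0 R 1.
apply/cvgr0Pnorm_le => e e0.
near=> x.
have x0 : 0 < x by near: x; apply: nbhs_pinfty_gt; rewrite num_real.
rewrite ger0_norm ?normal_pdf_ge0// normal_pdfE ?oner_eq0// /normal_fun subr0 expr1n mulNr expRN.
have xe : normal_peak 1 / e * 2 <= x by near: x; apply: nbhs_pinfty_ge; rewrite num_real.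
have x1 : 1 <= x by near: x; apply: nbhs_pinfty_ge; rewrite num_real.
have h := expR_ge1Dx (x ^+ 2 / 2%:R).
have hx : x / 2 <= expR (x ^+ 2 / 2%:R).
  by apply: le_trans h; nra.
rewrite ler_pdivrMr ?expR_gt0//.
apply: (@le_trans _ _ (e * (x / 2))); last first.
  by rewrite ler_pM2l.
have -> : normal_peak 1 = e * ((normal_peak 1 / e * 2) / 2) by field; rewrite gt_eqF.
by rewrite ler_pM2l// ler_pM2r.
Unshelve. all: end_near. Qed.

Variables (h : R -> R) (L : R).
Hypothesis h01 : forall x, 0 <= h x <= 1.
Hypothesis hL : forall x y, `|h x - h y| <= L * `|x - y|.

Lemma lipschitz_continuous : continuous h.
Proof.
move=> x; apply/cvgrPdist_le => e e0.
have L0 : 0 <= L by have := hL 1 0; rewrite subr0 normr1 mulr1; apply: le_trans.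
near=> y; rewrite (le_trans (hL _ _))//.
have : `|x - y| <= e / (L + 1).
  near: y; apply: cvgr_dist_le; first exact: cvg_id.
  by rewrite divr_gt0// ltr_wpDl.
rewrite ler_pdivlMr ?ltr_wpDl// => hh.
by have := normr_ge0 (x - y); nra.
Unshelve. all: end_near. Qed.

Let m : R := \int[mu]_x (h x * gauss x).
Let k x : R := (h x - m) * gauss x.
Let v (w : R) : R := \int[mu]_(x in `]-oo, w]) k x.

Let cg : continuous gauss.
Proof. by apply: continuous_normal_pdf; rewrite oner_eq0. Qed.

Let ig : mu.-integrable setT (EFin \o gauss).
Proof. exact: integrable_normal_pdf. Qed.

Let mh : measurable_fun setT h.
Proof. by apply: continuous_measurable_fun; exact: lipschitz_continuous. Qed.

Let mg : measurable_fun setT gauss.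
Proof. exact: measurable_normal_pdf. Qed.

Let ihg : mu.-integrable setT (EFin \o (fun x => h x * gauss x)).
Proof.
apply: le_integrable ig => //.
  by apply/measurable_EFinP; exact: measurable_funM.
move=> x _; rewrite !lee_fin normrM ler_piMl//.
by have /andP[a b] := h01 x; rewrite ger0_norm.
Qed.

Let ik : mu.-integrable setT (EFin \o k).
Proof.
rewrite (_ : EFin \o k = ((EFin \o (fun x => (h x * gauss x)%R)) \- (fun x => m%:E * (EFin \o gauss) x))%E); last first.
  by apply/funext => x /=; rewrite /k mulrBl EFinB (EFinM m).
by apply: integrableB => //; exact: integrableZl.
Qed.

Let intg1 : \int[mu]_x gauss x = 1.
Proof. by rewrite /Rintegral integral_normal_pdf. Qed.

Let m01 : 0 <= m <= 1.
Proof.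
apply/andP; split.
  apply: Rintegral_ge0 => x _; rewrite mulr_ge0 ?normal_pdf_ge0//.
  by have /andP[] := h01 x.
rewrite -intg1; apply: le_Rintegral => // x _.
by rewrite ler_piMl ?normal_pdf_ge0//; have /andP[] := h01 x.
Qed.

Let hm x : `|h x - m| <= 1.
Proof. by have := h01 x; have := m01; rewrite ler_norml; lra. Qed.

Let int_k : \int[mu]_x k x = 0.
Proof.
rewrite (_ : k = (fun x => h x * gauss x - m * gauss x)); last first.
  by apply/funext => x; rewrite /k mulrBl.
rewrite RintegralB//; last exact: (integrableZl _ _ ig).
by rewrite RintegralZl// intg1 mulr1 subrr.
Qed.

Let dv (x : R) : is_derive x 1 v ((h x - m) * gauss x).
Proof.
have [||||d1 d2] := @continuous_FTC1 R k -oo%O x (x + 1).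
- by rewrite ltrDl.
- exact: integrableS ik.
- exact: ltNyr.
- apply: cvgM; last exact: cg.
  by apply: cvgB; [exact: lipschitz_continuous|exact: cvg_cst].
by apply: DeriveDef; [exact: d1|rewrite -derive1E; exact: d2].
Qed.

Let nP (A : set R) : measurable A -> `|\int[mu]_(x in A) k x| <= fine (normal_prob 0 1 A).
Proof.
move=> mA; apply: (le_trans (le_normr_Rintegral _ _)) => //.
  exact: integrableS ik.
apply: fine_le.
- apply: integrable_fin_num => //.
  by apply: (@integrableS _ _ _ _ setT) => //; exact: (integrable_norm ik).
- exact: fin_num_measure.
apply: ge0_le_integral => //=.
- by apply/measurable_EFinP; apply: measurableT_comp => //;
    have /integrableP[/measurable_EFinP+ _] := ik; exact: measurable_funS.
- by apply/measurable_EFinP; exact: measurable_funS mg.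
move=> x _; rewrite lee_fin /k normrM; apply: le_trans (ler_piMl _ (hm x)) _ => //.
by rewrite ger0_norm ?normal_pdf_ge0.
Qed.

Let idR : measurableTypeR R -> R := idfun.
#[local] HB.instance Definition _ :=
  @isMeasurableFun.Build _ _ _ _ idR (@measurable_id _ _ setT).
Let N : probability _ R := normal_prob (0 : R) 1.
Let X := idR : {RV N >-> R}.

Let tailNy : fine (N `]-oo, (- x)%R]%classic) @[x --> +oo] --> 0.
Proof.
have /fine_cvg := @cvg_cdfNy0 _ _ _ N X.
by move=> /cvgNy_compNP.
Qed.

Let taily : fine (N `]x, +oo[%classic) @[x --> +oo] --> 0.
Proof. by have /fine_cvg := @cvg_ccdfy0 _ _ _ N X. Qed.

Let v_y w : `|v w| <= fine (N `]w, +oo[%classic).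
Proof.
have := @Rintegral_itvB _ k -oo%O +oo%O w.
rewrite set_itvE => /(_ ik isT isT); rewrite int_k sub0r => E.
by rewrite /v -normrN E; exact: nP.
Qed.

Let v_Ny w : `|v w| <= fine (N `]-oo, w]%classic).
Proof. exact: nP. Qed.

Let vy : v x @[x --> +oo] --> 0.
Proof.
apply/norm_cvg0P; apply: (squeeze_cvgr _ (cvg_cst 0) taily).
by near=> x; rewrite v_y normr_ge0.
Unshelve. all: end_near. Qed.

Let vNy : v (- x) @[x --> +oo] --> 0.
Proof.
apply/norm_cvg0P; apply: (squeeze_cvgr _ (cvg_cst 0) tailNy).
by near=> x; rewrite v_Ny normr_ge0.
Unshelve. all: end_near. Qed.

Lemma stein_solution : exists phi : R -> R,
  [/\ forall x : R, is_derive x 1 phi (x * phi x + (h x - m)),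
      forall x, `|phi x| <= 3, forall x, `|x * phi x| <= 1 &
      forall x y, `|(x * phi x + (h x - m)) - (y * phi y + (h y - m))|
        <= 2 * (3 + L) * `|x - y| ].
Proof.
pose phi w := v w / gauss w.
have gn0 x : gauss x != 0 by rewrite gt_eqF// gauss_gt0.
have dphi (x : R) : is_derive x 1 phi (x * phi x + (h x - m)).
  have dg : is_derive x 1 (fun y : R => (gauss y)^-1) (x / gauss x).
    have dg0 := is_derive_gauss x.
    apply: (is_derive_eq (is_deriveV (gn0 x) dg0)).
    by rewrite /GRing.scale /=; field.
  have dvx := dv x.
  by rewrite /phi; apply: is_derive_eq; rewrite /GRing.scale /=; field.
have vg : (fun x => phi x * gauss x) = v by apply/funext => x; rewrite /phi divfK.
have vgN : (fun x => phi (- x) * gauss x) = (fun x => v (- x)).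
  by apply/funext => x; rewrite /phi gaussN divfK.
have phi_b := @stein_bound R phi (fun x => h x - m) 1 dphi hm.
rewrite vg vgN in phi_b; have {}phi_b := phi_b vy vNy.
exists phi; split => //.
- by move=> x; have [_] := phi_b x; rewrite mulr1.
- by move=> x; have [] := phi_b x.
have L0 : 0 <= L by have := hL 1 0; rewrite subr0 normr1 mulr1; apply: le_trans.
have phi3 x : `|phi x| <= 3 by have [_] := phi_b x; rewrite mulr1.
have gb (f : R -> R) : (forall x, `|f x| <= 6) -> f x * gauss x @[x --> +oo] --> 0.
  move=> fb; apply/norm_cvg0P.
  have c6 : 6 * gauss x @[x --> +oo] --> 0.
    by rewrite -[X in _ --> X](mulr0 6); apply: cvgM; [exact: cvg_cst|exact: gauss_cvg0].
  apply: (squeeze_cvgr _ (cvg_cst 0) c6); near=> x.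
  by rewrite normr_ge0/= normrM (ger0_norm (normal_pdf_ge0 _ _ _)) ler_wpM2r ?normal_pdf_ge0.
suff H x y : x <= y -> `|(x * phi x + (h x - m)) - (y * phi y + (h y - m))|
        <= 2 * (3 + L) * `|x - y|.
  move=> x y; have [/H//|/ltW/H] := leP x y.
  by rewrite distrC (distrC y).
move=> xy; pose e := y - x; have e0 : 0 <= e by rewrite subr_ge0.
pose u w := phi (w + e) - phi w.
pose r w := e * phi (w + e) + (h (w + e) - h w).
have du (w : R) : is_derive w 1 u (w * u w + r w).
  have d1 := dphi w; have d2 := dphi (w + e).
  have d3 : is_derive w 1 (fun z => phi (z + e)) ((w + e) * phi (w + e) + (h (w + e) - m)).
    have ds : is_derive w 1 (fun z : R => z + e) 1 by apply: is_derive_eq; rewrite addr0.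
    by apply: (is_derive_eq (@is_derive1_comp _ phi _ w _ _ d2 ds)); rewrite /GRing.scale /=; ring.
  by rewrite /u; apply: is_derive_eq; rewrite /u /r; ring.
have rb w : `|r w| <= (3 + L) * e.
  rewrite /r (le_trans (ler_normD _ _))// [leRHS]mulrDl lerD//.
    by rewrite normrM (ger0_norm e0) mulrC ler_wpM2r.
  by rewrite (le_trans (hL _ _))// addrAC subrr add0r (ger0_norm e0).
have ub w : `|u w| <= 6.
  rewrite (le_trans (ler_normB _ _))//; have := phi3 (w + e); have := phi3 w; lra.
have := stein_bound du rb (gb _ ub) (gb (fun w => u (- w)) (fun w => ub _)) x => -[h1 _].
have -> : x * phi x + (h x - m) - (y * phi y + (h y - m)) = - (x * u x + r x).
  by rewrite /u /r /e (_ : x + (y - x) = y); ring.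
rewrite normrN distrC (ger0_norm e0) (le_trans (ler_normD _ _))//.
have := rb x; rewrite -/e; lra.
Unshelve. all: end_near. Qed.

End SteinSolution.

Section Smoothing.
Context {R : realType}.
Local Notation mu := (@lebesgue_measure R).
Local Notation gauss := (normal_pdf (0 : R) 1).

Definition ramp (t e x : R) : R := Num.min 1 (Num.max 0 ((t + e - x) / e)).

Lemma ramp01 t e x : 0 <= ramp t e x <= 1.
Proof. by rewrite /ramp le_min ge_min le_max !lexx ler01 ?orbT. Qed.

Lemma ramp_lipschitz t e x y : 0 < e ->
  `|ramp t e x - ramp t e y| <= e^-1 * `|x - y|.
Proof.
move=> e0; have ei : 0 < e^-1 by rewrite invr_gt0.
have -> : e^-1 * `|x - y| = `|(t + e - x) / e - (t + e - y) / e|.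
  rewrite -mulrBl normrM (gtr0_norm ei) mulrC; congr (_ * _).
  by rewrite -normrN; congr `|_|; ring.
have nb (a b : R) : a - b <= `|a - b| /\ b - a <= `|a - b|.
  by split; [exact: ler_norm|rewrite distrC ler_norm].
have mx (a b : R) : `|Num.max 0 a - Num.max 0 b| <= `|a - b|.
  have [n1 n2] := nb a b; rewrite ler_norml.
  by have [h1|h1] := leP 0 a; have [h2|h2] := leP 0 b; apply/andP; split; lra.
have mn (a b : R) : `|Num.min 1 a - Num.min 1 b| <= `|a - b|.
  have [n1 n2] := nb a b; rewrite ler_norml.
  by have [h1|h1] := leP 1 a; have [h2|h2] := leP 1 b; apply/andP; split; lra.
exact: le_trans (mn _ _) (mx _ _).
Qed.

Lemma ramp_ge t e x : 0 < e -> x <= t -> ramp t e x = 1.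
Proof.
move=> e0 xt; rewrite /ramp; apply/min_idPl; rewrite le_max; apply/orP; right.
by rewrite ler_pdivlMr//; lra.
Qed.

Lemma ramp_le t e x : 0 < e -> t + e < x -> ramp t e x = 0.
Proof.
move=> e0 xt; rewrite /ramp max_l; first by rewrite min_r.
by rewrite ler_pdivrMr// mul0r; lra.
Qed.

Lemma normal_peak_le1 : normal_peak (1 : R) <= 1.
Proof.
rewrite /normal_peak invf_le1; last first.
  by rewrite sqrtr_gt0 expr1n mul1r mulrn_wgt0// pi_gt0.
rewrite -[leLHS]sqrtr1 ler_wsqrtr// expr1n mul1r.
have := pi_ge2 R; rewrite -mulr_natr; lra.
Qed.

Let ig : mu.-integrable setT (EFin \o gauss).
Proof. exact: integrable_normal_pdf. Qed.

Lemma normal_prob_itv (t e : R) : 0 <= e ->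
  fine (normal_prob 0 1 `]-oo, (t + e)%R]%classic) <=
  fine (normal_prob 0 1 `]-oo, t]%classic) + e.
Proof.
move=> e0.
have := @Rintegral_itvB R gauss -oo%O (BRight (t + e)) t.
have i1 (A : set R) : measurable A -> mu.-integrable A (EFin \o gauss).
  by move=> mA; apply: (@integrableS _ _ _ _ setT).
move=> /(_ (i1 _ (measurable_itv _)) isT); rewrite bnd_simp lerDl => /(_ e0) E.
rewrite -lerBlDl; apply: le_trans; first by rewrite le_eqVlt; apply/orP; left; apply/eqP; exact: E.
apply: (@le_trans _ _ (\int[mu]_(x in `]t, (t + e)%R]) (cst 1 x))).
  apply: le_Rintegral => //; first exact: i1.
    by apply/integrableP; split; [by apply/measurable_EFinP|rewrite (@eq_integral _ _ _ _ _ (cst 1%E)) => [|x _]; [|by rewrite /= normr1]; by rewrite integral_cst//= mul1e lebesgue_measure_itv/=; case: ifP; rewrite ?ltry].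
  move=> x _; rewrite /=; apply: le_trans normal_peak_le1.
  by apply: normal_pdf_ub; rewrite oner_eq0.
rewrite Rintegral_cst ?mul1r; last exact: measurable_itv.
have := @lebesgue_measure_itv R `]t, (t + e)%R].
rewrite /= lte_fin => ->; case: ifP => _ //=; lra.
Qed.

Lemma kolmogorov_le d (T : measurableType d) (P : probability T R) (Z : T -> R)
    (e del : R) :
  measurable_fun setT Z -> 0 < e ->
  (forall phi dphi : R -> R,
    (forall x : R, is_derive x 1 phi (dphi x)) ->
    (forall x, `|phi x| <= 3) -> (forall x, `|dphi x| <= 2) ->
    (forall x y, `|dphi x - dphi y| <= 2 * (3 + e^-1) * `|x - y|) ->
    `|\int[P]_x (dphi (Z x) - Z x * phi (Z x))| <= del) ->
  (kolmogorov_dist (pushforward P Z) (normal_prob 0 1) <= (e + del)%:E)%E.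
Proof.
move=> mZ e0 H.
have irg t : mu.-integrable setT (EFin \o (fun x => ramp t e x * gauss x)).
  apply: le_integrable ig => //.
    apply/measurable_EFinP; apply: measurable_funM; last exact: measurable_normal_pdf.
    apply: continuous_measurable_fun; apply: (@lipschitz_continuous _ _ e^-1).
    by move=> x y; exact: ramp_lipschitz.
  move=> x _; rewrite !lee_fin normrM ler_piMl//.
  by have /andP[a b] := ramp01 t e x; rewrite ger0_norm.
have irZ t : P.-integrable setT (EFin \o (fun x => ramp t e (Z x))).
  apply: (@le_integrable _ _ _ _ _ _ _ (EFin \o cst 1)) => //.
  - apply/measurable_EFinP; apply: (measurableT_comp _ mZ).
    apply: continuous_measurable_fun; apply: (@lipschitz_continuous _ _ e^-1).
    by move=> x y; exact: ramp_lipschitz.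
  - by move=> x _; rewrite lee_fin /= normr1; have /andP[a b] := ramp01 t e (Z x); rewrite ger0_norm.
  - exact: finite_measure_integrable_cst.
have key t : `|\int[P]_x (ramp t e (Z x)) - \int[mu]_x (ramp t e x * gauss x)| <= del.
  have [phi [dphi phi3 xphi lphi]] :=
    @stein_solution R (ramp t e) e^-1 (ramp01 t e) (fun x y => ramp_lipschitz t x y e0).
  set m := \int[mu]_x _ in dphi lphi *.
  have i2 : P.-integrable setT (EFin \o cst m) by exact: finite_measure_integrable_cst.
  have E : \int[P]_x (ramp t e (Z x)) - m = \int[P]_x (ramp t e (Z x) - cst m x).
    have PT : fine (P setT) = 1 by rewrite probability_setT.
    by rewrite RintegralB// Rintegral_cst// -[X in _ - X]mulr1 -PT.
  rewrite E; have := H phi (fun x => x * phi x + (ramp t e x - m)) dphi phi3 _ lphi.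
  rewrite (_ : (fun x => _ - _) = (fun x => ramp t e (Z x) - cst m x)); last first.
    by apply/funext => x /=; ring.
  apply => x; rewrite (le_trans (ler_normD _ _))// (_ : 2 = 1 + 1)// lerD//.
  have m01 : 0 <= m <= 1.
    apply/andP; split.
      apply: Rintegral_ge0 => y _; rewrite mulr_ge0 ?normal_pdf_ge0//.
      by have /andP[] := ramp01 t e y.
    have -> : 1 = \int[mu]_y gauss y by rewrite /Rintegral integral_normal_pdf.
    rewrite /m; apply: le_Rintegral => //.
    by move=> y _; rewrite ler_piMl ?normal_pdf_ge0//; have /andP[] := ramp01 t e y.
  by have := ramp01 t e x; rewrite ler_norml; lra.
have Find t : fine (P (Z @^-1` `]-oo, t]%classic)) = \int[P]_x \1_`]-oo, t] (Z x).
  have mA : measurable (Z @^-1` `]-oo, t]%classic).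
    by rewrite -[X in measurable X]setTI; exact: mZ.
  rewrite /Rintegral; congr fine.
  transitivity (\int[P]_x (\1_(Z @^-1` `]-oo, t]%classic) x)%:E)%E.
    by rewrite integral_indic// setIT.
  by apply: eq_integral => x _; rewrite !indicE; congr (_%:R%:E); apply/idP/idP; rewrite !inE.
have iFind t : P.-integrable setT (EFin \o (fun x => \1_`]-oo, t] (Z x) : R)).
  apply: (@le_integrable _ _ _ _ _ _ _ (EFin \o cst 1)) => //.
  - by apply/measurable_EFinP; apply: (measurableT_comp _ mZ); exact: measurable_indic.
  - move=> x _; rewrite lee_fin /= normr1 indicE.
    by case: (_ \in _); rewrite ?normr1 ?normr0.
  - exact: finite_measure_integrable_cst.
have Gind t : fine (normal_prob 0 1 `]-oo, t]%classic) = \int[mu]_x (\1_`]-oo, t] x * gauss x).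
  transitivity (\int[mu]_(x in `]-oo, t]) gauss x); first by [].
  rewrite Rintegral_mkcond; apply: eq_Rintegral => x _.
  by rewrite patchE indicE; case: ifP => _; rewrite ?mul1r ?mul0r.
have iGind t : mu.-integrable setT (EFin \o (fun x => \1_`]-oo, t] x * gauss x)).
  apply: le_integrable ig => //.
    apply/measurable_EFinP; apply: measurable_funM; last exact: measurable_normal_pdf.
    exact: measurable_indic.
  move=> x _; rewrite !lee_fin normrM ler_piMl// indicE.
  by case: (_ \in _); rewrite ?normr1 ?normr0.
have ramp_ind_ge t x : \1_`]-oo, t] x <= ramp t e x.
  rewrite indicE; case: (boolP (x \in _)) => xt.
    by rewrite ramp_ge//; move: xt; rewrite inE/= in_itv.
  by have /andP[] := ramp01 t e x.
have ramp_ind_le t x : ramp t e x <= \1_`]-oo, (t + e)%R] x.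
  rewrite indicE; case: (boolP (x \in _)) => xt.
    by have /andP[] := ramp01 t e x.
  rewrite ramp_le//; move: xt; rewrite notin_setE/= in_itv/= => /negP.
  by rewrite -ltNge.
apply: ge_ereal_sup => _ [t _ <-].
have mA : measurable (Z @^-1` `]-oo, t]%classic).
  by rewrite -[X in measurable X]setTI; exact: mZ.
rewrite /pushforward -(fineK (fin_num_measure P _ mA)).
rewrite -(fineK (fin_num_measure (normal_prob (0 : R) 1) `]-oo, t]%classic _)); last exact: measurable_itv.
rewrite -EFinB lee_fin.
have k1 := key t; have k2 := key (t - e).
have n1 := normal_prob_itv t (ltW e0); have n2 := normal_prob_itv (t - e) (ltW e0).
rewrite subrK in n2.
have f1 : fine (P (Z @^-1` `]-oo, t]%classic)) <= \int[P]_x ramp t e (Z x).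
  by rewrite Find; apply: le_Rintegral.
have f2 : \int[P]_x ramp (t - e) e (Z x) <= fine (P (Z @^-1` `]-oo, t]%classic)).
  rewrite Find; apply: le_Rintegral => // x _.
  by have := ramp_ind_le (t - e) (Z x); rewrite subrK.
have g1 : \int[mu]_x (ramp t e x * gauss x) <= fine (normal_prob 0 1 `]-oo, (t + e)%R]%classic).
  by rewrite Gind; apply: le_Rintegral => // x _; rewrite ler_wpM2r ?normal_pdf_ge0.
have g2 : fine (normal_prob 0 1 `]-oo, (t - e)%R]%classic) <= \int[mu]_x (ramp (t - e) e x * gauss x).
  by rewrite Gind; apply: le_Rintegral => // x _; rewrite ler_wpM2r ?normal_pdf_ge0.
have [a1 a2] : - del <= \int[P]_x ramp t e (Z x) - \int[mu]_x (ramp t e x * gauss x) /\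
    \int[P]_x ramp t e (Z x) - \int[mu]_x (ramp t e x * gauss x) <= del.
  by apply/andP; rewrite -ler_norml.
have [b1 b2] : - del <= \int[P]_x ramp (t - e) e (Z x) - \int[mu]_x (ramp (t - e) e x * gauss x) /\
    \int[P]_x ramp (t - e) e (Z x) - \int[mu]_x (ramp (t - e) e x * gauss x) <= del.
  by apply/andP; rewrite -ler_norml.
rewrite ler_norml; move: a1 a2 b1 b2 f1 f2 g1 g2 n1 n2.
move: (\int[P]_x ramp t e (Z x)) (\int[P]_x ramp (t - e) e (Z x)).
move: (\int[mu]_x (ramp t e x * gauss x)) (\int[mu]_x (ramp (t - e) e x * gauss x)).
move: (fine (P _)) (fine (normal_prob 0 1 `]-oo, t]%classic)).
move: (fine (normal_prob 0 1 `]-oo, (t - e)%R]%classic)) (fine (normal_prob 0 1 `]-oo, (t + e)%R]%classic)).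
clear => x1 x2 x3 x4 x5 x6 x7 x8 a1 a2 b1 b2 f1 f2 g1 g2 n1 n2.
by apply/andP; split; lra.
Qed.

End Smoothing.

(** * Independent fields *)

Section EqualLaws.
Context {R : realType} d1 d2 d3 (O1 : measurableType d1) (O2 : measurableType d2)
  (S : measurableType d3) (P1 : probability O1 R) (P2 : probability O2 R)
  (X : O1 -> S) (Y : O2 -> S).
Hypotheses (mX : measurable_fun setT X) (mY : measurable_fun setT Y).
Hypothesis XY : forall B, measurable B -> P1 (X @^-1` B) = P2 (Y @^-1` B).

Lemma eq_law_ge0_integral (G : S -> \bar R) : measurable_fun setT G ->
  (forall x, (0 <= G x)%E) -> (\int[P1]_x G (X x) = \int[P2]_x G (Y x))%E.
Proof.
move=> mG G0.
have h1 := @ge0_integral_pushforward _ _ _ _ R X mX P1 setT G measurableT mG (fun y _ => G0 y).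
have h2 := @ge0_integral_pushforward _ _ _ _ R Y mY P2 setT G measurableT mG (fun y _ => G0 y).
rewrite preimage_setT in h1; rewrite preimage_setT in h2.
rewrite -[LHS]h1 -[RHS]h2; apply: eq_measure_integral => B mB _; exact: XY.
Qed.

Lemma eq_law_integrable (G : S -> R) : measurable_fun setT G ->
  P1.-integrable setT (EFin \o (G \o X)) -> P2.-integrable setT (EFin \o (G \o Y)).
Proof.
move=> mG /integrableP[_ h]; apply/integrableP; split.
  by apply/measurable_EFinP; exact: measurableT_comp.
rewrite -(eq_law_ge0_integral (G := fun x => `|(G x)%:E|%E))//.
by apply: measurableT_comp => //; exact/measurable_EFinP.
Qed.

Lemma eq_law_Rintegral (G : S -> R) : measurable_fun setT G ->
  P1.-integrable setT (EFin \o (G \o X)) ->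
  \int[P1]_x G (X x) = \int[P2]_x G (Y x).
Proof.
move=> mG iG; have iG2 := eq_law_integrable mG iG.
have mG' : measurable_fun setT (EFin \o G) by exact/measurable_EFinP.
have h1 := @integral_pushforward _ _ _ _ R X mX P1 setT (EFin \o G) mG' iG measurableT.
have h2 := @integral_pushforward _ _ _ _ R Y mY P2 setT (EFin \o G) mG' iG2 measurableT.
rewrite preimage_setT in h1; rewrite preimage_setT in h2.
rewrite /Rintegral; congr fine; rewrite -[LHS]h1 -[RHS]h2.
by apply: eq_measure_integral => B mB _; exact: XY.
Qed.

End EqualLaws.

Notation field J T := (g_sigma_algebraType (@cylinders J _ T)).

Section Fields.
Context {R : realType} {dT : measure_display} {T : measurableType dT}.

Definition box (J : Type) (A : J -> set T) : set (J -> T) :=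
  [set x | forall j, A j (x j)].

Lemma measurable_coord (J : Type) (j : J) :
  measurable_fun setT (fun x : field J T => x j).
Proof.
move=> _ B mB; rewrite setTI; apply: sub_sigma_algebra; exists j => //.
by exists B => //; rewrite setTI.
Qed.

Lemma measurable_to_field (J : Type) d (O : measurableType d) (f : O -> J -> T) :
  (forall j, measurable_fun setT (fun o => f o j)) ->
  measurable_fun setT (f : O -> field J T).
Proof.
move=> mf; apply: (@measurability _ _ _ (field J T) _ _ (@cylinders J _ T)) => //.
move=> _ [_ [j _ [B mB <-]] <-]; rewrite !setTI.
by have := mf j measurableT B mB; rewrite setTI.
Qed.

Lemma measurable_reindex (J J' : Type) (c : J' -> J) :
  measurable_fun setT ((fun x => x \o c) : field J T -> field J' T).
Proof. by apply: measurable_to_field => j; exact: measurable_coord. Qed.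

Lemma measurable_box (J : finType) (A : J -> set T) :
  (forall j, measurable (A j)) -> measurable (box A : set (field J T)).
Proof.
move=> mA.
have -> : box A = \bigcap_(j in [set: J]) ((fun x => x j) @^-1` A j).
  by apply/seteqP; split => x h j; [by move=> _; exact: h|exact: h j I].
apply: fin_bigcap_measurable => [|j _]; first exact: finite_finset.
by rewrite -[X in measurable X]setTI; exact: measurable_coord.
Qed.

Lemma field_measure_unique (J : finType) (G : set (set T))
    (m1 m2 : probability (field J T) R) :
  @measurable _ T = <<s G >> -> setI_closed G -> G setT ->
  (forall A : J -> set T, (forall j, G (A j)) -> m1 (box A) = m2 (box A)) ->
  forall B, measurable B -> m1 B = m2 B.
Proof.
move=> sG IG GT m12.
have Gm A : G A -> measurable A by move=> GA; rewrite sG; exact: sub_sigma_algebra.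
pose GG : set (set (J -> T)) := [set B | exists2 A, (forall j, G (A j)) & B = box A].
have cyl : <<s @cylinders J _ T >> `<=` <<s GG >>.
  apply: smallest_sub; first exact: smallest_sigma_algebra.
  move=> _ [j _ [B mB <-]].
  suff : measurable_fun setT (fun x : g_sigma_algebraType GG => x j) by move=> /(_ measurableT B mB).
  apply: (@measurability _ _ (g_sigma_algebraType GG) T _ _ G sG) => _ [A GA <-]; rewrite setTI.
  apply: sub_sigma_algebra; exists (fun i => if i == j then A else setT).
    by move=> i; case: ifP.
  apply/seteqP; split => x /= h; first by move=> i; case: eqP => [->|].
  by have := h j; rewrite eqxx.
have GGm : GG `<=` @measurable _ (field J T).
  by move=> _ [A GA ->]; apply: measurable_box => j; exact: Gm.
move=> B /cyl.
apply: (@g_sigma_algebra_measure_unique _ R (field J T) GG GGm (fun=> setT)).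
- by move=> _; exists (fun=> setT) => //; apply/seteqP; split.
- by apply/seteqP; split => // x _; exists 0%N.
- move=> _ _ [A1 GA1 ->] [A2 GA2 ->]; exists (fun j => A1 j `&` A2 j).
    by move=> j; exact: IG.
  apply/seteqP; split => x /=; first by move=> [h1 h2] j; split; [exact: h1|exact: h2].
  by move=> h; split => j; have [] := h j.
- by move=> _ [A GA ->]; exact: m12.
- by move=> _; apply: le_lt_trans (probability_le1 _ _) _; rewrite ?ltry.
Qed.

Definition iid (J : finType) (nu : probability T R) (Q : probability (field J T) R) :=
  forall A : J -> set T, (forall j, measurable (A j)) ->
    Q (box A) = (\prod_j nu (A j))%E.

Lemma iid_exists_ord (nu : probability T R) m :
  exists Q : probability (field 'I_m T) R, iid nu Q.
Proof.
elim: m => [|m [Q iQ]].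
  exists (\d_(point : field 'I_0 T)) => A mA.
  by rewrite big_ord0 /= diracE mem_set// => -[].
pose f (z : T * field 'I_m T) : field 'I_m.+1 T :=
  fun i => oapp z.2 z.1 (unlift ord0 i).
have mf : measurable_fun setT f.
  apply: measurable_to_field => j; rewrite /f.
  case: unliftP => [k|] _ /=; last exact: measurable_fst.
  by apply: (measurableT_comp (measurable_coord k)); exact: measurable_snd.
pose fmix := isMeasurableFun.Build _ _ _ _ _ mf.
pose fm : {mfun _ >-> _} := HB.pack f fmix.
exists (distribution (nu \x Q)%E fm) => A mA.
transitivity ((nu \x Q)%E (f @^-1` box A)) => //.
have -> : f @^-1` box A = A ord0 `*` box (fun i => A (lift ord0 i)).
  apply/seteqP; split => -[s x] /=.
    move=> h; split => [|i] /=; first by have := h ord0; rewrite /= /f unlift_none.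
    by have := h (lift ord0 i); rewrite /= /f liftK.
  move=> [h1 h2] j; rewrite /= /f; case: unliftP => [k ->|->] //=.
rewrite product_measure1E//; last exact: measurable_box.
rewrite big_ord_recl; congr (_ * _)%E.
exact: (iQ (fun i => A (lift ord0 i))).
Qed.

Lemma iid_exists (nu : probability T R) (J : finType) :
  exists Q : probability (field J T) R, iid nu Q.
Proof.
have [Q iQ] := iid_exists_ord nu #|J|.
pose f (x : field 'I_#|J| T) : field J T := x \o enum_rank.
have mf : measurable_fun setT f by exact: measurable_reindex.
pose fmix := isMeasurableFun.Build _ _ _ _ _ mf.
pose fm : {mfun _ >-> _} := HB.pack f fmix.
exists (distribution Q fm) => A mA.
transitivity (Q (f @^-1` box A)) => //.
have -> : f @^-1` box A = box (fun i => A (enum_val i)).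
  apply/seteqP; split => x /= h j.
    by have := h (enum_val j); rewrite /= /f /= enum_valK.
  by have := h (enum_rank j); rewrite enum_rankK.
rewrite iQ// (reindex (@enum_rank J)); last exact/onW_bij/enum_rank_bij.
by apply: eq_bigr => j _; rewrite enum_rankK.
Qed.

End Fields.

Section Iid.
Context {R : realType} {dT : measure_display} {T : measurableType dT}.
Variable nu : probability T R.

Lemma iid_unique (J : finType) (Q1 Q2 : probability (field J T) R) :
  iid nu Q1 -> iid nu Q2 -> forall B, measurable B -> Q1 B = Q2 B.
Proof.
move=> i1 i2; apply: (@field_measure_unique R _ _ _ (@measurable _ T)).
- by rewrite sigma_algebra_id//; exact: sigma_algebra_measurable.
- exact: measurableI.
- exact: measurableT.
- by move=> A mA; rewrite i1// i2.
Qed.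

Lemma iid_reindex (J J' : finType) (c : J' -> J) (Q : probability (field J T) R)
    (Q' : probability (field J' T) R) : injective c -> iid nu Q -> iid nu Q' ->
  forall B, measurable B -> Q ((fun x : field J T => (x \o c : field J' T)) @^-1` B) = Q' B.
Proof.
move=> ic iQ iQ'.
pose f (x : field J T) : field J' T := x \o c.
have mf : measurable_fun setT f by exact: measurable_reindex.
pose fmix := isMeasurableFun.Build _ _ _ _ _ mf.
pose fm : {mfun _ >-> _} := HB.pack f fmix.
apply: (@iid_unique _ (distribution Q fm) Q') => // A mA.
transitivity (Q (f @^-1` box A)) => //.
pose A' j := oapp A setT [pick j' | c j' == j].
have -> : f @^-1` box A = box A'.
  apply/seteqP; split => x /= h j.
    rewrite /A'; case: pickP => //= j' /eqP <-; exact: h.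
  have := h (c j); rewrite /A'; case: pickP => [j' /eqP/ic ->//|/(_ j)].
  by rewrite eqxx.
rewrite iQ; last by move=> j; rewrite /A'; case: pickP => [j1 _|_] /=.
rewrite (bigID (mem [set c j | j in [set: J']]%SET))/= [X in (_ * X)%E]big1 ?mule1; last first.
  move=> j jn; rewrite /A'; case: pickP => [j' /eqP E|_]; last exact: probability_setT.
  by move: jn; rewrite -E imset_f.
rewrite big_imset/=; last by move=> x y _ _ /ic.
apply: eq_big => [j|j _]; first by rewrite inE.
rewrite /A'; case: pickP => [j' /eqP/ic ->//|/(_ j)].
by rewrite eqxx.
Qed.

Section OneField.
Variables (J : finType) (Q : probability (field J T) R).
Hypothesis iQ : iid nu Q.

Definition merge (a : pred J) (x y : J -> T) : J -> T :=
  fun j => if a j then x j else y j.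

Let mergef (a : pred J) (z : field J T * field J T) : field J T :=
  merge a z.1 z.2.

Let measurable_merge (a : pred J) : measurable_fun setT (mergef a).
Proof.
apply: measurable_to_field => j; rewrite /mergef /merge; case: (a j).
  by apply: (measurableT_comp (measurable_coord j)); exact: measurable_fst.
by apply: (measurableT_comp (measurable_coord j)); exact: measurable_snd.
Qed.

Lemma iid_merge (a : pred J) (B : set (field J T)) : measurable B ->
  (Q \x Q)%E (mergef a @^-1` B) = Q B.
Proof.
move: B; pose f (z : field J T * field J T) : field J T := merge a z.1 z.2.
have mf : measurable_fun setT f by exact: measurable_merge.
pose fmix := isMeasurableFun.Build _ _ _ _ _ mf.
pose fm : {mfun _ >-> _} := HB.pack f fmix.
apply: (@iid_unique _ (distribution (Q \x Q)%E fm) Q) => // A mA.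
transitivity ((Q \x Q)%E (f @^-1` box A)) => //.
pose A1 j := if a j then A j else setT; pose A2 j := if a j then setT else A j.
have -> : f @^-1` box A = box A1 `*` box A2.
  apply/seteqP; split => -[x y] /=.
    move=> h; split => j; have := h j; rewrite /= /f /merge /A1 /A2 /=; by case: (a j).
  move=> [h1 h2] j; have := h1 j; have := h2 j; rewrite /= /f /merge /A1 /A2 /=.
  by case: (a j).
have mA1 j : measurable (A1 j) by rewrite /A1; case: (a j).
have mA2 j : measurable (A2 j) by rewrite /A2; case: (a j).
transitivity (Q (box A1) * Q (box A2))%E.
  by apply: product_measure1E; exact: measurable_box.
rewrite !iQ// -big_split; apply: eq_bigr => j _; rewrite /A1 /A2 /=.
by case: (a j); rewrite probability_setT ?mule1 ?mul1e.
Qed.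

Definition depends_on (U : Type) (a : pred J) (G : (J -> T) -> U) :=
  forall x y : J -> T, (forall j, a j -> x j = y j) -> G x = G y.

Lemma depends_on_mergel U a (G : (J -> T) -> U) x y :
  depends_on a G -> G (merge a x y) = G x.
Proof. by apply => j aj; rewrite /merge aj. Qed.

Lemma depends_on_merger U a (G : (J -> T) -> U) x y :
  depends_on (predC a) G -> G (merge a x y) = G y.
Proof. by apply => j /negbTE aj; rewrite /merge aj. Qed.

Lemma indep_ge0 (a : pred J) (G1 G2 : field J T -> \bar R) :
  measurable_fun setT G1 -> measurable_fun setT G2 ->
  (forall x, (0 <= G1 x)%E) -> (forall x, (0 <= G2 x)%E) ->
  depends_on a G1 -> depends_on (predC a) G2 ->
  (\int[Q]_x (G1 x * G2 x) = \int[Q]_x G1 x * \int[Q]_x G2 x)%E.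
Proof.
move=> m1 m2 p1 p2 D1 D2.
have mG : measurable_fun setT (fun x => G1 x * G2 x)%E by exact: emeasurable_funM.
have mG' : measurable_fun setT (fun z : field J T * field J T => G1 z.1 * G2 z.2)%E.
  by apply: emeasurable_funM; [exact: (measurableT_comp m1 measurable_fst)|exact: (measurableT_comp m2 measurable_snd)].
rewrite -(@eq_law_ge0_integral R _ _ _ _ _ _ (Q \x Q)%E Q (mergef a) id _ _ (@iid_merge a) (fun x => G1 x * G2 x)%E)//; last first.
- by move=> x; exact: mule_ge0.
under eq_integral do rewrite /mergef depends_on_mergel// depends_on_merger//.
rewrite fubini_tonelli1//=; last by move=> z; exact: mule_ge0.
rewrite (eq_integral (fun x => (G1 x * \int[Q]_y G2 y)%E)); last first.
  by move=> x _; rewrite /fubini_F /= ge0_integralZl.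
rewrite ge0_integralZr//; exact: integral_ge0.
Qed.

Lemma indep_integrable (a : pred J) (G1 G2 : field J T -> R) :
  Q.-integrable setT (EFin \o G1) -> Q.-integrable setT (EFin \o G2) ->
  depends_on a G1 -> depends_on (predC a) G2 ->
  Q.-integrable setT (EFin \o (fun x => G1 x * G2 x)).
Proof.
move=> i1 i2 D1 D2.
have /integrableP[/measurable_EFinP m1 l1] := i1.
have /integrableP[/measurable_EFinP m2 l2] := i2.
apply/integrableP; split; first by apply/measurable_EFinP; exact: measurable_funM.
under eq_integral do rewrite /= normrM EFinM.
rewrite (@indep_ge0 a)//.
- by apply: lte_mul_pinfty => //; [exact: integral_ge0|rewrite ge0_fin_numE//; exact: integral_ge0].
- by apply/measurable_EFinP; exact: measurableT_comp.
- by apply/measurable_EFinP; exact: measurableT_comp.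
- by move=> x y xy; rewrite (D1 x y).
- by move=> x y xy; rewrite (D2 x y).
Qed.

Lemma indep_Rintegral (a : pred J) (G1 G2 : field J T -> R) :
  Q.-integrable setT (EFin \o G1) -> Q.-integrable setT (EFin \o G2) ->
  depends_on a G1 -> depends_on (predC a) G2 ->
  \int[Q]_x (G1 x * G2 x) = \int[Q]_x G1 x * \int[Q]_x G2 x.
Proof.
move=> i1 i2 D1 D2.
have /integrableP[/measurable_EFinP m1 l1] := i1.
have /integrableP[/measurable_EFinP m2 l2] := i2.
have i12 := indep_integrable i1 i2 D1 D2.
have mG : measurable_fun setT (fun x : field J T => G1 x * G2 x) by exact: measurable_funM.
have EQ := fun B mB => esym (@iid_merge a B mB).
have E : (fun z : field J T * field J T => G1 z.1 * G2 z.2) = (fun z => G1 (mergef a z) * G2 (mergef a z)).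
  by apply/funext => z; rewrite /mergef depends_on_mergel// depends_on_merger.
have i3 : (Q \x Q)%E.-integrable setT (EFin \o (fun z : field J T * field J T => G1 z.1 * G2 z.2)).
  rewrite E; exact: (@eq_law_integrable R _ _ _ _ _ _ Q (Q \x Q)%E id (mergef a) (@measurable_id _ _ _) (measurable_merge a) EQ (fun x => G1 x * G2 x) mG i12).
transitivity (\int[(Q \x Q)%E]_z (G1 z.1 * G2 z.2)).
  rewrite E; exact: (@eq_law_Rintegral R _ _ _ _ _ _ Q (Q \x Q)%E id (mergef a) (@measurable_id _ _ _) (measurable_merge a) EQ (fun x => G1 x * G2 x) mG i12).
transitivity (fine (\int[Q]_x \int[Q]_y ((G1 x * G2 y)%:E))%E).
  by rewrite /Rintegral; congr fine; rewrite -integral12_prod_meas1.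
transitivity (fine (\int[Q]_x ((G1 x * \int[Q]_y G2 y)%:E))%E).
  congr fine; apply: eq_integral => x _.
  rewrite -RintegralZl//; rewrite /Rintegral fineK//.
  apply: integrable_fin_num => //.
  by have := @integrableZl _ _ _ Q setT measurableT (G1 x) _ i2.
by rewrite -/(Rintegral _ _ _) RintegralZr.
Qed.

Lemma iid_pair (j1 j2 : J) : j1 != j2 -> forall B : set (T * T), measurable B ->
  Q ((fun x => (x j1, x j2)) @^-1` B) = (nu \x nu)%E B.
Proof.
move=> j12 B mB.
pose f (x : field J T) : T * T := (x j1, x j2).
have mf : measurable_fun setT f.
  by apply: measurable_fun_pair; exact: measurable_coord.
pose fmix := isMeasurableFun.Build _ _ _ _ _ mf.
pose fm : {mfun _ >-> _} := HB.pack f fmix.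
transitivity (distribution Q fm B) => //.
apply/esym; apply: product_measure_unique => // A1 A2 mA1 mA2.
transitivity (Q (f @^-1` (A1 `*` A2))) => //.
pose A j := if j == j1 then A1 else if j == j2 then A2 else setT.
have -> : f @^-1` (A1 `*` A2) = box A.
  apply/seteqP; split => x /=.
    by move=> [h1 h2] j; rewrite /A; case: eqP => [->|_] //; case: eqP => [->|_].
  move=> h; split; first by have := h j1; rewrite /A eqxx.
  by have := h j2; rewrite /A eq_sym (negbTE j12) eqxx.
rewrite iQ; last by move=> j; rewrite /A; case: ifP => // _; case: ifP.
rewrite (bigD1 j1)//= (bigD1 j2)/=; last by rewrite eq_sym j12.
rewrite big1 ?mule1.
  by rewrite /A eqxx eq_sym (negbTE j12) eqxx.
move=> j /andP[/negbTE h1 /negbTE h2]; rewrite /A h1 h2; exact: probability_setT.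
Qed.

Lemma iid_one (j : J) : forall B : set T, measurable B ->
  Q ((fun x => x j) @^-1` B) = nu B.
Proof.
move=> B mB; pose A i := if i == j then B else setT.
have -> : (fun x : field J T => x j) @^-1` B = box A.
  apply/seteqP; split => x /=.
    by move=> h i; rewrite /A; case: eqP => [->|_].
  by move=> h; have := h j; rewrite /A eqxx.
rewrite iQ; last by move=> i; rewrite /A; case: ifP.
rewrite (bigD1 j)//= big1 ?mule1 ?/A ?eqxx// => i /negbTE ->; exact: probability_setT.
Qed.

End OneField.
End Iid.

Section Calculus.
Context {R : realType} d (O : measurableType d) (P : probability O R).

Implicit Types f g : O -> R.

Let sqrn (x : R) : `|x| ^+ 2 = x ^+ 2.
Proof. by rewrite real_normK ?num_real. Qed.

Definition L1 (f : O -> R) := P.-integrable setT (EFin \o f).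
Definition L2 (f : O -> R) :=
  measurable_fun setT f /\ L1 (fun x => f x ^+ 2).

Lemma L1_eq f g : f =1 g -> L1 f -> L1 g.
Proof. by move=> /funext ->. Qed.

Lemma L1_measurable f : L1 f -> measurable_fun setT f.
Proof. by move=> /integrableP[/measurable_EFinP]. Qed.

Lemma L1_le f g : measurable_fun setT f -> L1 g ->
  (forall x, `|f x| <= g x) -> L1 f.
Proof.
move=> mf ig fg; apply: le_integrable ig => //; first exact/measurable_EFinP.
by move=> x _; rewrite lee_fin (le_trans (fg x))// ler_norm.
Qed.

Lemma L1D f g : L1 f -> L1 g -> L1 (fun x => f x + g x).
Proof. by move=> f1 g1; exact: (integrableD measurableT f1 g1). Qed.

Lemma L1B f g : L1 f -> L1 g -> L1 (fun x => f x - g x).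
Proof. by move=> f1 g1; exact: (integrableB measurableT f1 g1). Qed.

Lemma L1Z k f : L1 f -> L1 (fun x => k * f x).
Proof. by move=> f1; exact: (integrableZl measurableT k f1). Qed.

Lemma L1_cst k : L1 (fun=> k).
Proof. exact: finite_measure_integrable_cst. Qed.

Lemma L1_sum (I : Type) (s : seq I) (p : pred I) (F : I -> O -> R) :
  (forall i, L1 (F i)) -> L1 (fun x => \sum_(i <- s | p i) F i x).
Proof.
move=> F1; elim: s => [|i s IH].
  by under eq_fun do rewrite big_nil; exact: L1_cst.
under eq_fun do rewrite big_cons.
by case: (p i) => //; exact: L1D.
Qed.

Lemma ExD f g : L1 f -> L1 g ->
  \int[P]_x (f x + g x) = \int[P]_x f x + \int[P]_x g x.
Proof. by move=> f1 g1; rewrite RintegralD. Qed.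

Lemma ExB f g : L1 f -> L1 g ->
  \int[P]_x (f x - g x) = \int[P]_x f x - \int[P]_x g x.
Proof. by move=> f1 g1; rewrite RintegralB. Qed.

Lemma ExZ k f : L1 f -> \int[P]_x (k * f x) = k * \int[P]_x f x.
Proof. by move=> f1; rewrite RintegralZl. Qed.

Lemma Ex_cst k : \int[P]_x k = k.
Proof.
have PT : fine (P setT) = 1 by rewrite probability_setT.
by rewrite -[RHS]mulr1 -[in RHS]PT; exact: (Rintegral_cst P measurableT k).
Qed.

Lemma Ex_sum (I : Type) (s : seq I) (p : pred I) (F : I -> O -> R) :
  (forall i, L1 (F i)) ->
  \int[P]_x (\sum_(i <- s | p i) F i x) = \sum_(i <- s | p i) \int[P]_x F i x.
Proof.
move=> F1; elim: s => [|i s IH].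
  by under eq_Rintegral do rewrite big_nil; rewrite Ex_cst big_nil.
rewrite big_cons -IH; under eq_Rintegral do rewrite big_cons.
case: (p i) => //; rewrite ExD//; exact: L1_sum.
Qed.

Lemma Ex_le f g : L1 f -> L1 g -> (forall x, f x <= g x) ->
  \int[P]_x f x <= \int[P]_x g x.
Proof. by move=> f1 g1 fg; apply: le_Rintegral. Qed.

Lemma Ex_ge0 f : (forall x, 0 <= f x) -> 0 <= \int[P]_x f x.
Proof. by move=> f0; apply: Rintegral_ge0. Qed.

Lemma Ex_abs f : L1 f -> `|\int[P]_x f x| <= \int[P]_x `|f x|.
Proof. by move=> f1; apply: le_normr_Rintegral. Qed.

Lemma L1_abs f : L1 f -> L1 (fun x => `|f x|).
Proof. by move=> f1; exact: integrable_norm. Qed.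

Lemma Ex_abs_le f g : L1 f -> L1 g -> (forall x, `|f x| <= g x) ->
  `|\int[P]_x f x| <= \int[P]_x g x.
Proof.
by move=> f1 g1 fg; rewrite (le_trans (Ex_abs f1))// Ex_le//; exact: L1_abs.
Qed.

Lemma L2_M f g : L2 f -> L2 g -> L1 (fun x => f x * g x).
Proof.
move=> [mf f2] [mg g2]; apply: (L1_le _ (L1D f2 g2)); first exact: measurable_funM.
move=> x; rewrite normrM -(sqrn (f x)) -(sqrn (g x)).
by have := normr_ge0 (f x); have := normr_ge0 (g x); nra.
Qed.

Lemma L2_L1 f : L2 f -> L1 f.
Proof.
move=> [mf f2]; apply: (L1_le _ (L1D (L1_cst 1) f2)) => // x.
rewrite -(sqrn (f x)); have := normr_ge0 (f x); nra.
Qed.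

Lemma L2_le f g : measurable_fun setT f -> L2 g ->
  (forall x, `|f x| <= `|g x|) -> L2 f.
Proof.
move=> mf [mg g2] fg; split => //; apply: (L1_le _ g2); first exact: measurable_funX.
by move=> x; rewrite normrX -(sqrn (g x)) lerXn2r// nnegrE.
Qed.

Lemma L2_cst k : L2 (fun=> k).
Proof. by split => //; exact: L1_cst. Qed.

Lemma L2D f g : L2 f -> L2 g -> L2 (fun x => f x + g x).
Proof.
move=> [mf f2] [mg g2]; split; first exact: measurable_funD.
apply: (L1_le _ (L1Z 2 (L1D f2 g2))).
  by apply: measurable_funX; exact: measurable_funD.
by move=> x; rewrite ger0_norm ?sqr_ge0//; have := sqr_ge0 (f x - g x); nra.
Qed.

Lemma L2Z k f : L2 f -> L2 (fun x => k * f x).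
Proof.
move=> [mf f2]; split; first exact: measurable_funM.
by under eq_fun do rewrite exprMn; exact: L1Z.
Qed.

Lemma L2N f : L2 f -> L2 (fun x => - f x).
Proof. by move=> /(L2Z (-1)); under eq_fun do rewrite mulN1r. Qed.

Lemma L2B f g : L2 f -> L2 g -> L2 (fun x => f x - g x).
Proof. by move=> f2 g2; apply: L2D => //; exact: L2N. Qed.

Lemma L2_sum (I : Type) (s : seq I) (p : pred I) (F : I -> O -> R) :
  (forall i, L2 (F i)) -> L2 (fun x => \sum_(i <- s | p i) F i x).
Proof.
move=> F1; elim: s => [|i s IH].
  by under eq_fun do rewrite big_nil; exact: L2_cst.
under eq_fun do rewrite big_cons.
by case: (p i) => //; exact: L2D.
Qed.

Lemma Ex_abs_L2 f : L2 f -> \int[P]_x `|f x| <= Num.sqrt (\int[P]_x (f x ^+ 2)).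
Proof.
move=> f2; have [mf f2'] := f2.
have i1 := L1_abs (L2_L1 f2); set m := \int[P]_x `|f x|.
have m0 : 0 <= m by exact: Ex_ge0.
have V0 : 0 <= \int[P]_x (f x ^+ 2) by apply: Ex_ge0 => x; exact: sqr_ge0.
suff : m ^+ 2 <= \int[P]_x (f x ^+ 2).
  by move=> /ler_wsqrtr; rewrite sqrtr_sqr ger0_norm.
have : 0 <= \int[P]_x ((f x ^+ 2 - 2 * m * `|f x|) + m ^+ 2).
  apply: Ex_ge0 => x; have := sqr_ge0 (`|f x| - m).
  by rewrite -(sqrn (f x)); nra.
rewrite ExD; [|by apply: L1B => //; exact: L1Z|exact: L1_cst].
by rewrite ExB//; [|exact: L1Z]; rewrite ExZ// Ex_cst -/m; nra.
Qed.

End Calculus.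

Section Telescope.
Context {R : realType} {dT : measure_display} {T : measurableType dT}.
Variable nu : probability T R.

Section Perm.
Variables (J : finType) (Q : probability (field J T) R).
Hypothesis iQ : iid nu Q.
Implicit Type F : field J T -> R.

Lemma measurable_comp_reindex d (S : measurableType d) (J' : finType)
    (G : field J' T -> S) (c : J' -> J) :
  measurable_fun setT G -> measurable_fun setT (fun x : field J T => G (x \o c)).
Proof. by move=> mG; exact: (measurableT_comp mG (measurable_reindex c)). Qed.

Let perm_law (c : J -> J) (ic : injective c) (B : set (field J T)) :
  measurable B -> Q (id @^-1` B) = Q ((fun x : field J T => (x \o c : field J T)) @^-1` B).
Proof. by move=> mB; rewrite (@iid_reindex _ _ _ nu _ _ c Q Q). Qed.

Lemma L1_perm F (c : J -> J) : injective c -> L1 Q F -> L1 Q (fun x => F (x \o c)).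
Proof.
move=> ic F1.
exact: (@eq_law_integrable R _ _ _ _ _ _ Q Q id _ (@measurable_id _ _ _)
  (measurable_reindex c) (perm_law ic) F (L1_measurable F1) F1).
Qed.

Lemma Ex_perm F (c : J -> J) : injective c -> L1 Q F ->
  \int[Q]_x F (x \o c) = \int[Q]_x F x.
Proof.
move=> ic F1; apply/esym.
exact: (@eq_law_Rintegral R _ _ _ _ _ _ Q Q id _ (@measurable_id _ _ _)
  (measurable_reindex c) (perm_law ic) F (L1_measurable F1) F1).
Qed.

Lemma L2_perm F (c : J -> J) : injective c -> L2 Q F -> L2 Q (fun x => F (x \o c)).
Proof.
move=> ic [mF F2]; split; first exact: measurable_comp_reindex.
exact: (L1_perm ic F2).
Qed.

End Perm.

Variables (I : finType).
Notation J := ((bool * bool) * I)%type.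
Variable Q : probability (field J T) R.
Hypothesis iQ : iid nu Q.

Definition copy_bit (h : bool) (j : J) : bool := if h then j.1.2 else j.1.1.

Definition swap (h : bool) (S : pred I) (j : J) : J :=
  if h then ((j.1.1, j.1.2 (+) S j.2), j.2) else ((j.1.1 (+) S j.2, j.1.2), j.2).

Lemma swapK h S : involutive (swap h S).
Proof.
by move=> [[a b] i]; rewrite /swap; case: h => /=; rewrite -addbA addbb addbF.
Qed.

Lemma swap_inj h S : injective (swap h S).
Proof. exact: inv_inj (swapK h S). Qed.

Lemma swap_comp h S S' j : swap h S (swap h S' j) = swap h (fun i => S i (+) S' i) j.
Proof.
by case: j => [[a b] i]; rewrite /swap; case: h => /=; rewrite -addbA (addbC (S' i)).
Qed.

Definition before (m : nat) : pred I := fun i => (enum_rank i < m)%N.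

Lemma before_succ (l : I) i : before (enum_rank l).+1 i = before (enum_rank l) i (+) (i == l).
Proof.
rewrite /before ltnS leq_eqVlt; have [->|nil] := eqVneq i l.
  by rewrite eqxx ltnn.
by rewrite addbF (inj_eq (@ord_inj _)) (inj_eq enum_rank_inj) (negbTE nil).
Qed.

(* [B] is turned into its independent copy by exchanging one index at a time; the exchange at [l]
   alone negates the [l]-th increment of [B], which gives the antisymmetrization and the 1/2. *)
Lemma cov_telescope (h : bool) (A B : field J T -> R) :
  L2 Q A -> L2 Q B ->
  depends_on (fun j => ~~ copy_bit h j) A -> depends_on (fun j => ~~ copy_bit h j) B ->
  \int[Q]_x (A x * B x) - \int[Q]_x A x * \int[Q]_x B x =
  2^-1 * \sum_(l : I) \int[Q]_x ((A x - A (x \o swap h (pred1 l))) *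
    (B (x \o swap h (before (enum_rank l))) - B (x \o swap h (before (enum_rank l).+1)))).
Proof.
move=> A2 B2 DA DB.
pose Bm m x := B (x \o swap h (before m)).
have Bm2 m : L2 Q (Bm m) by apply: L2_perm B2 => //; exact: swap_inj.
have B0 x : Bm 0%N x = B x.
  congr B; apply/funext => -[[a b] i]; rewrite /= /swap /=.
  by case: h {DA DB Bm Bm2} => /=; rewrite addbF.
have BN x : Bm #|I| x = B (x \o swap h predT).
  by congr B; apply/funext => -[[a b] i]; rewrite /= /swap /before /= ltn_ord.
have AB : \int[Q]_x (A x * Bm #|I| x) = \int[Q]_x A x * \int[Q]_x B x.
  rewrite -(@Ex_perm _ _ iQ B (swap h predT)); [|exact: swap_inj|exact: L2_L1].
  under eq_Rintegral do rewrite BN.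
  apply: (indep_Rintegral iQ) DA _.
  - exact: L2_L1.
  - by apply: L2_L1; apply: L2_perm B2 => //; exact: swap_inj.
  - move=> x y xy; apply: DB => -[[a b] i] /=.
    rewrite /copy_bit /swap /=; case: h {Bm Bm2 B0 BN} xy => xy /= h; apply: xy;
    by rewrite /= /copy_bit /= addbT negbK.
have BB l x : Bm (enum_rank l) (x \o swap h (pred1 l)) = Bm (enum_rank l).+1 x.
  congr B; apply/funext => j /=; congr x; rewrite swap_comp; congr (swap h _ j).
  by apply/funext => i; rewrite before_succ addbC.
have BB' l x : Bm (enum_rank l).+1 (x \o swap h (pred1 l)) = Bm (enum_rank l) x.
  congr B; apply/funext => j /=; congr x; rewrite swap_comp; congr (swap h _ j).
  by apply/funext => i; rewrite before_succ addbC -addbA addbb addbF.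
rewrite -AB -ExB; [|exact: L2_M|exact: L2_M].
have -> : \int[Q]_x (A x * B x - A x * Bm #|I| x) =
    \sum_(l : I) \int[Q]_x (A x * (Bm (enum_rank l) x - Bm (enum_rank l).+1 x)).
  rewrite -Ex_sum; last by move=> l; apply: L2_M => //; exact: L2B.
  apply: eq_Rintegral => x _; rewrite -mulrBr -mulr_sumr; congr (_ * _).
  rewrite -[B x]B0 (reindex (@enum_val I predT)) /=; last exact/onW_bij/enum_val_bij.
  under eq_bigr do rewrite enum_valK.
  rewrite -(big_mkord predT (fun m => Bm m x - Bm m.+1 x)) cardE.
  under eq_bigr do rewrite -opprB.
  by rewrite sumrN telescope_sumr// opprB.
rewrite mulr_sumr; apply: eq_bigr => l _.
set X := \int[Q]_x (A x * _).
have X' : X = \int[Q]_x (A (x \o swap h (pred1 l)) * (Bm (enum_rank l).+1 x - Bm (enum_rank l) x)).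
  rewrite /X -(@Ex_perm _ _ iQ _ (swap h (pred1 l))); [|exact: swap_inj|by apply: L2_M => //; exact: L2B].
  by apply: eq_Rintegral => x _; rewrite BB BB'.
have E : \int[Q]_x ((A x - A (x \o swap h (pred1 l))) * (Bm (enum_rank l) x - Bm (enum_rank l).+1 x)) = X + X.
  rewrite {2}X' /X -ExD; last 2 first.
  - by apply: L2_M => //; exact: L2B.
  - by apply: L2_M; [apply: L2_perm A2 => //; exact: swap_inj|exact: L2B].
  by apply: eq_Rintegral => x _; ring.
by rewrite E; field.
Qed.

End Telescope.

Section Columns.
Context {R : realType} {dT : measure_display} {T : measurableType dT}.
Variables (nu : probability T R) (K I : finType).
Variable Q : probability (field (K * I)%type T) R.
Hypothesis iQ : iid nu Q.

Definition column (t : I) : pred (K * I)%type := fun j => j.2 == t.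

Lemma Ex_prod_columns (G : I -> field (K * I)%type T -> R) (s : seq I) :
  uniq s -> (forall t, L1 Q (G t)) -> (forall t, depends_on (column t) (G t)) ->
  L1 Q (fun x => \prod_(t <- s) G t x) /\
  \int[Q]_x (\prod_(t <- s) G t x) = \prod_(t <- s) \int[Q]_x G t x.
Proof.
move=> us G1 DG; elim: s us => [_|t s IH /= /andP[ts us]].
  split; last by under eq_Rintegral do rewrite big_nil; rewrite Ex_cst big_nil.
  by apply: (L1_eq _ (L1_cst Q 1)) => x; rewrite big_nil.
have [i1 E1] := IH us.
have DP : depends_on (predC (column t)) (fun x => \prod_(t <- s) G t x).
  move=> x y xy; apply: eq_big_seq => u us'; apply: DG => j /eqP ju; apply: xy.
  by rewrite /= /column ju; apply: contra ts => /eqP <-.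
have D1 := DG t.
have i2 := indep_integrable iQ (G1 t) i1 D1 DP.
have E2 := indep_Rintegral iQ (G1 t) i1 D1 DP.
split.
  by apply: (L1_eq _ i2) => x; rewrite big_cons.
rewrite big_cons -E1 -E2; apply: eq_Rintegral => x _; by rewrite big_cons.
Qed.

End Columns.

Section Locality.
Variables (R : realType) (n d M : nat) (g : forall T : finType, wcomplex R T -> R).
Hypotheses (d0 : (0 < d)%N) (ginv : iso_invariant d g).
Local Notation I := (simplex n d).
Local Notation state := (bool * weight R)%type.
Implicit Types (x y : I -> state) (i l t : I) (B : I -> bool) (s : {set 'I_n}).

Definition opened B : pred {set 'I_n} := fun s => [exists t : I, B t && (val t == s)].

Definition config_complex x : wcomplex R 'I_n := BW_complex (fun t => (x t).1) (fun t => (x t).2).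

Lemma card_simplex i : #|val i| = d.+1.
Proof. exact/eqP/(valP i). Qed.

Lemma opened_val B i : opened B (val i) = B i.
Proof.
apply/existsP/idP => [[t /andP[Bt /eqP/val_inj <-]]//|Bi].
by exists i; rewrite Bi eqxx.
Qed.

Lemma opened_card B s : opened B s -> #|s| = d.+1.
Proof. by case/existsP => t /andP[_ /eqP <-]; exact: card_simplex. Qed.

Lemma simplices_BW B (W : I -> weight R) s : (s \in simplices d (BW_complex B W)) = opened B s.
Proof.
rewrite !inE; apply/andP/idP => [[/orP[sd|//] /eqP ss]|os].
  by rewrite ss ltnn in sd.
by split; [apply/orP; right|apply/eqP; exact: opened_card os].
Qed.

Lemma is_path_BW B (W : I -> weight R) s p :
  is_path d (BW_complex B W) s p = walk d (opened B) s p && uniq (steps s p).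
Proof.
rewrite /is_path /walk -/(steps s p) -andbA; congr [&& _, _ & _].
  by apply: eq_all => t; rewrite /is_simplex /facet prednK.
apply: eq_all => t; rewrite simplices_BW; case: (boolP (opened B t)) => [/opened_card->|_].
  by rewrite eqxx.
by rewrite andbF.
Qed.

Lemma reachable_mono B B' (W W' : I -> weight R) i s : facet d s ->
  (forall t, t != i -> B t = B' t) ->
  ~ reachable d (BW_complex (fun t => B t || (t == i)) W) s M (val i) ->
  forall t : {set 'I_n}, reachable d (BW_complex B W) s M t -> t <> val i /\ reachable d (BW_complex B' W') s M t.
Proof.
move=> fs BB' nr t [q [z [qp qM qt]]].
have wq := qp; rewrite is_path_BW in wq; case/andP: wq => wq uq.
have [/mem_stepsP[p1 [x [p2 [Ep Ex]]]]|ni] := boolP (val i \in steps s (rcons q z)).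
  exfalso; apply: nr; exists p1, x; rewrite is_path_BW; split => //.
    rewrite -cats1; apply/andP; split.
      apply: (@sub_walk _ _ (opened B)).
        move=> u /existsP[t' /andP[Bt' /eqP E]]; apply/existsP; exists t'.
        by rewrite Bt' E eqxx.
      by move: wq; rewrite Ep -cat_rcons -cats1 walk_cat => /andP[].
    by move: uq; rewrite Ep -cat_rcons -cats1 steps_cat cat_uniq => /andP[].
  by move: qM; rewrite Ep size_rcons size_cat /=; apply: leq_trans; rewrite addnS ltnS leq_addr.
split.
  move=> ti; move: ni; rewrite -ti -qt -cats1 steps_cat mem_cat /= inE eqxx orbT //.
exists q, z; split => //; rewrite is_path_BW uq andbT.
move: wq; rewrite /walk => /andP[-> /= /allP h]; apply/allP => u us.
have /andP[cu /existsP[v /andP[Bv /eqP vu]]] := h _ us.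
rewrite cu /=; apply/existsP; exists v; rewrite -BB' ?Bv ?vu ?eqxx//.
by apply: contra ni => /eqP E; rewrite -E vu.
Qed.

Lemma local_faces_sub B (W : I -> weight R) s (t : {set 'I_n}) :
  facet d s -> #|t| = d.+1 -> t \in local_faces d (BW_complex B W) s M ->
  reachable d (BW_complex B W) s M t.
Proof.
move=> /eqP fs ct; rewrite inE => /orP[/subset_leq_card|].
  by rewrite ct fs ltnn.
move=> /existsP[u /andP[/asboolP ru tu]].
suff -> : t = u by [].
apply/eqP; rewrite eqEcard tu ct /=.
case: ru => q [z [qp _ qu]].
move: qp; rewrite is_path_BW -cats1 walk_cat walk_cons => /andP[/andP[_ /and4P[_ /eqP c _ _]] _].
by rewrite -qu c.
Qed.

Lemma local_eq x y i s : facet d s ->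
  (forall t, t != i -> x t = y t) ->
  ~ reachable d (BW_complex (fun t => (x t).1 || (t == i)) (fun t => (x t).2)) s M (val i) ->
  g (local_complex d (config_complex x) s M) = g (local_complex d (config_complex y) s M).
Proof.
move=> fs xy nr.
have bxy t : t != i -> (x t).1 = (y t).1 by move=> /xy ->.
have nr' : ~ reachable d (BW_complex (fun t => (y t).1 || (t == i)) (fun t => (y t).2)) s M (val i).
  move=> [q [z [qp qM qi]]]; apply: nr; exists q, z; split; [|exact: qM|exact: qi].
  move: qp; rewrite !is_path_BW => /andP[w ->]; rewrite andbT; apply: sub_walk w.
  move=> u /existsP[v /andP[Bv /eqP <-]]; apply/existsP; exists v; rewrite eqxx andbT.
  have [->|vi] := eqVneq v i; first by rewrite orbT.
  by rewrite bxy//; move: Bv; rewrite (negbTE vi) orbF => ->.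
have h1 := @reachable_mono _ (fun t => (y t).1) _ (fun t => (y t).2) _ _ fs bxy nr.
have h2 := @reachable_mono _ (fun t => (x t).1) _ (fun t => (x t).2) _ _ fs (fun t ti => esym (bxy t ti)) nr'.
have ef : local_faces d (config_complex x) s M = local_faces d (config_complex y) s M.
  apply/setP => u; rewrite !inE; congr (_ || _); apply: eq_existsb => v; congr (_ && _).
  by apply/asboolP/asboolP => [/h1[]|/h2[]].
apply: (ginv (phi := id)); split => //=.
  by rewrite ef; apply/setP => u; apply/idP/imsetP => [uf|[v vf ->]];
    [exists u => //|]; rewrite imset_id.
move=> t; rewrite inE /= => /andP[tf /eqP ct].
rewrite imset_id.
have := local_faces_sub fs ct tf => rt; have [ti _] := h1 _ rt.
case: insubP => [u _ ut|]; last by rewrite /is_simplex ct eqxx.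
by rewrite /= xy//; apply/eqP => E; apply: ti; rewrite -ut E.
Qed.

Definition update x i (v : state) : I -> state := fun t => if t == i then v else x t.

(* By invariance of [g], switching [i] has no effect on the local complexes that [i] does not
   reach, so that [g] has a non-zero mixed difference only where both [i] and [l] are reached. *)
Lemma mixed_difference x i l (v w : state) : i != l ->
  let F x := local_sum d g M (config_complex x) in
  F x - F (update x i v) != F (update x l w) - F (update (update x l w) i v) ->
  exists s p, link d (opened (fun t => (x t).1)) (val i) (val l) s p /\ (size p < 2 * M)%N.
Proof.
move=> il F; apply: contra_neqP => nl; rewrite /F /local_sum -!sumrB.
apply: eq_bigr => sg _; set s := val sg.
have fs : facet d s.
  have /eqP : #|s| == d.-1.+1 by exact: (valP sg).
  by rewrite /facet => ->; rewrite prednK.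
pose big t := (x t).1 || (t == i) || (t == l).
have opb : {subset opened big <= predU (opened (fun t => (x t).1)) (pred2 (val i) (val l))}.
  move=> u /existsP[t /andP[]]; rewrite /big -!topredE /= => /orP[/orP[xt|/eqP->]|/eqP->] /eqP <-.
  - by rewrite opened_val xt.
  - by rewrite eqxx orbT.
  - by rewrite eqxx !orbT.
have mono y i' : (forall t, t != i' -> (y t).1 -> big t) -> big i' ->
    ~ reachable d (BW_complex big (fun t => (x t).2)) s M (val i') ->
    ~ reachable d (BW_complex (fun t => (y t).1 || (t == i')) (fun t => (y t).2)) s M (val i').
  move=> yb bi nr [q [z [qp qM qi]]]; apply: nr; exists q, z; split; [|exact: qM|exact: qi].
  move: qp; rewrite !is_path_BW => /andP[wq ->]; rewrite andbT; apply: sub_walk wq.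
  move=> u /existsP[t /andP[Bt /eqP <-]]; rewrite -topredE /= opened_val.
  have [->//|ti] := eqVneq t i'; apply: yb => //.
  by move: Bt; rewrite (negbTE ti) orbF.
have bi : big i by rewrite /big eqxx orbT.
have bl : big l by rewrite /big eqxx !orbT.
have [ri|nri] := pselect (reachable d (BW_complex big (fun t => (x t).2)) s M (val i)); last first.
  have e1 : g (local_complex d (config_complex x) s M) = g (local_complex d (config_complex (update x i v)) s M).
    apply: (@local_eq _ _ i s fs); first by move=> t ti; rewrite /update (negbTE ti).
    by apply: mono => [t ti xt||]; [rewrite /big xt|exact: bi|exact: nri].
  have e2 : g (local_complex d (config_complex (update x l w)) s M) = g (local_complex d (config_complex (update (update x l w) i v)) s M).
    apply: (@local_eq _ _ i s fs); first by move=> t ti; rewrite /update (negbTE ti).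
    apply: mono; [move=> t ti; rewrite /update /big; case: eqP => [_|_ ->//]; by rewrite orbT|exact: bi|exact: nri].
  by rewrite e1 e2 !subrr.
have [rl|nrl] := pselect (reachable d (BW_complex big (fun t => (x t).2)) s M (val l)); last first.
  have e1 : g (local_complex d (config_complex x) s M) = g (local_complex d (config_complex (update x l w)) s M).
    apply: (@local_eq _ _ l s fs); first by move=> t tl; rewrite /update (negbTE tl).
    by apply: mono => [t ti xt||]; [rewrite /big xt|exact: bl|exact: nrl].
  have e2 : g (local_complex d (config_complex (update x i v)) s M) = g (local_complex d (config_complex (update (update x l w) i v)) s M).
    apply: (@local_eq _ _ l s fs); first by move=> t tl; rewrite /update (negbTE tl).
    apply: mono; [move=> t ti; rewrite /update /big; case: eqP => [_|_ ->//]; by rewrite orbT|exact: bl|exact: nrl].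
  by rewrite e1 e2.
exfalso; apply: nl.
case: ri => q [z [qp qM qi]]; case: rl => q' [z' [qp' qM' ql]].
move: qp qp'; rewrite !is_path_BW => /andP[w1 _] /andP[w2 _].
have [w3 lst sz] := join_walks w1 w2.
have si : last s q \subset val i by rewrite -qi finset.subsetUl.
have [s' [p' [lk sp]]] := minimal_link (card_simplex i) si (sub_walk opb w3) (etrans (lst _) ql) (eq_leq sz).
exists s', p'; split; first exact: lk.
move: sp qM qM'; rewrite !size_rcons; move: (size q) (size q') (size p').
clear => a b c; lia.
Qed.

End Locality.

Section Entries.
Variables (R : realType) (p : R) (D : probability (weight R) R).
Hypothesis p01 : 0 < p < 1.
Notation state := (bool * weight R)%type.

Definition entry_law : probability state R := (bernoulli_prob p \x D)%E.

Let p01' : 0 <= p <= 1.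
Proof. by have /andP[a b] := p01; rewrite !ltW. Qed.

Let q0 : 0 <= 1 - p.
Proof. by have /andP[a b] := p01; rewrite subr_ge0 ltW. Qed.

Lemma entry_integral (G : state -> \bar R) : measurable_fun setT G ->
  (forall s, (0 <= G s)%E) ->
  (\int[entry_law]_s G s =
   p%:E * \int[D]_w G (true, w) + (1 - p)%:E * \int[D]_w G (false, w))%E.
Proof.
move=> mG G0; rewrite /entry_law fubini_tonelli1//.
rewrite /fubini_F integral_bernoulli_prob// => b.
exact: integral_ge0.
Qed.

Lemma entry_integral_or (h : weight R * weight R -> R) :
  measurable_fun setT h -> (forall w, 0 <= h w) ->
  (\int[(entry_law \x entry_law)%E]_z
     ((z.1.1 || z.2.1)%:R * h (z.1.2, z.2.2))%:E =
   (p + (1 - p) * p)%:E * \int[(D \x D)%E]_w (h w)%:E)%E.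
Proof.
move=> mh h0.
have mb : measurable_fun setT (fun z : state * state => (z.1.1 || z.2.1)%:R : R).
  have mor : measurable_fun setT (fun z : bool * bool => z.1 || z.2).
    by apply: measurable_or; [exact: measurable_fst|exact: measurable_snd].
  have m1 : measurable_fun setT (fun z : state * state => (z.1.1, z.2.1)).
    apply: measurable_fun_pair.
      exact: (measurableT_comp measurable_fst measurable_fst).
    exact: (measurableT_comp measurable_fst measurable_snd).
  have mr : measurable_fun setT (fun b : bool => b%:R : R) by [].
  exact: (measurableT_comp mr (measurableT_comp mor m1)).
have mh2 : measurable_fun setT (fun z : state * state => h (z.1.2, z.2.2)).
  apply: (measurableT_comp mh); apply: measurable_fun_pair.
    exact: (measurableT_comp measurable_snd measurable_fst).
  exact: (measurableT_comp measurable_snd measurable_snd).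
have mG : measurable_fun setT (fun z : state * state => ((z.1.1 || z.2.1)%:R * h (z.1.2, z.2.2))%:E).
  by apply/measurable_EFinP; exact: measurable_funM.
have G0 z : (0 <= (((z : state * state).1.1 || z.2.1)%:R * h (z.1.2, z.2.2))%:E)%E.
  by rewrite lee_fin mulr_ge0.
rewrite fubini_tonelli1// /fubini_F /=.
have mh' : measurable_fun setT (fun w : weight R * weight R => (h w)%:E) by exact/measurable_EFinP.
pose K w1 := (\int[D]_w2 (h (w1, w2))%:E)%E.
have mK : measurable_fun setT K by apply: (@measurable_fun_fubini_tonelli_F _ _ _ _ _ D (fun w : weight R * weight R => (h w)%:E)) => // w; rewrite lee_fin.
have K0 w : (0 <= K w)%E by apply: integral_ge0 => w2 _; rewrite lee_fin.
have EK : (\int[D]_w K w = \int[(D \x D)%E]_w (h w)%:E)%E.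
  by rewrite fubini_tonelli1// => w; rewrite lee_fin.
have inner s : (\int[entry_law]_y (((s : state).1 || y.1)%:R * h (s.2, y.2))%:E)%E =
    ((if s.1 then 1 else p)%:E * K s.2)%E.
  rewrite entry_integral; last 2 first.
  - by have := measurable_fun_pair2 s mG.
  - by move=> y; exact: (G0 (s, y)).
  rewrite /= orbT orbF; under eq_integral do rewrite mul1r.
  case: (s.1).
    under [X in (_ + _ * X)%E]eq_integral do rewrite mul1r.
    rewrite -/(K _) mul1e -ge0_muleDl ?lee_fin ?(ltW (andP p01).1)//.
    by rewrite -EFinD addrC subrK mul1e.
  under [X in (_ + _ * X)%E]eq_integral do rewrite mul0r.
  by rewrite integral0 mule0 adde0.
under eq_integral do rewrite inner.
rewrite entry_integral; last 2 first.
- apply: emeasurable_funM; last exact: (measurableT_comp mK measurable_snd).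
  apply/measurable_EFinP; have mr : measurable_fun setT (fun b : bool => (if b then 1 else p) : R) by [].
  exact: (measurableT_comp mr measurable_fst).
- by move=> s; rewrite mule_ge0// lee_fin; case: (s.1) => //; exact: (ltW (andP p01).1).
rewrite /=; under eq_integral do rewrite mul1e.
rewrite ge0_integralZl//; last by rewrite lee_fin; exact: (ltW (andP p01).1).
rewrite EK muleA -EFinM EFinD ge0_muleDl ?lee_fin ?mulr_ge0 ?(ltW (andP p01).1)//.
Qed.

End Entries.

Lemma wval_ge0 (R : realType) (w : weight R) : 0 <= wval w.
Proof. by rewrite /wval. Qed.

(** * Increments of the functional *)

Section Model.
Variables (R : realType) (n d M : nat) (g : forall T : finType, wcomplex R T -> R).
Variables (H : weight R * weight R -> weight R) (p : R) (D : probability (weight R) R) (c : R).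
Local Notation I := (simplex n d).
Local Notation state := (bool * weight R)%type.
Local Notation J := ((bool * bool) * I)%type.
Hypotheses (mH : measurable_fun setT H) (mf : BW_measurable d (@local_sum R n d g M)).
Hypothesis lip : H_lipschitz d H (@local_sum R n d g M).
Hypotheses (p01 : 0 < p < 1) (c1 : 1 <= c).
Hypothesis Hc : (\int[(D \x D)%E]_z (wval (H z) ^+ 6)%:E <= (c ^+ 6)%:E)%E.
Variable Q : probability (field J state) R.
Hypothesis iQ : iid (entry_law p D) Q.
Implicit Types (i l t : I) (S : pred I) (x : J -> state) (e : bool).

Definition field_sum (y : I -> state) : R := @local_sum R n d g M (config_complex y).
Local Notation F := field_sum.

Lemma measurable_field_sum : measurable_fun setT (F : field I state -> R).
Proof.
pose h (y : field I state) : (field I bool * field I (weight R))%type :=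
  ((fun t => (y t).1), (fun t => (y t).2)).
have mg : measurable_fun setT h.
  apply: measurable_fun_pair; apply: measurable_to_field => t.
    exact: (measurableT_comp measurable_fst (measurable_coord t)).
  exact: (measurableT_comp measurable_snd (measurable_coord t)).
exact: (measurableT_comp mf mg).
Qed.

Lemma field_sum_lipschitz (y y' : I -> state) :
  `|F y - F y'| <= \sum_(t | ((y t).1 || (y' t).1) && (y t != y' t)) wval (H ((y t).2, (y' t).2)).
Proof.
have := lip (fun t => (y t).1) (fun t => (y' t).1) (fun t => (y t).2) (fun t => (y' t).2).
by under eq_bigl do rewrite -!surjective_pairing.
Qed.

Lemma field_sum_lipschitz1 (y y' : I -> state) i : (forall t, t != i -> y t = y' t) ->
  `|F y - F y'| <= ((y i).1 || (y' i).1)%:R * wval (H ((y i).2, (y' i).2)).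
Proof.
move=> yy; apply: (le_trans (field_sum_lipschitz y y')).
rewrite big_mkcond (bigD1 i)//= big1 ?addr0; last first.
  by move=> t ti; rewrite yy// eqxx andbF.
have w0 : 0 <= wval (H ((y i).2, (y' i).2)) by exact: wval_ge0.
by case: (_ || _) => /=; rewrite ?mul0r// mul1r; case: ifP.
Qed.

(* [S] and [S'] are the sets of simplices whose first, resp. second, copy bit is set. *)
Definition cfg S S' x : I -> state := fun t => x ((S t, S' t), t).
Definition resampled_sum S S' x : R := F (cfg S S' x).
Local Notation FF := resampled_sum.

Lemma measurable_resampled_sum S S' : measurable_fun setT (FF S S' : field J state -> R).
Proof.
exact: (measurableT_comp measurable_field_sum (measurable_reindex (fun t => ((S t, S' t), t) : J))).
Qed.

Definition pair_open i e x : R := ((x ((false, e), i)).1 || (x ((true, e), i)).1)%:R.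
Definition flip_bound i e x : R :=
  pair_open i e x * wval (H ((x ((false, e), i)).2, (x ((true, e), i)).2)).
Local Notation U := flip_bound.

Lemma flip_bound_ge0 i e x : 0 <= U i e x.
Proof. by rewrite mulr_ge0//; exact: wval_ge0. Qed.

Lemma resampled_sum_diff S S2 S' i x : ~~ S i -> S2 i -> (forall t, t != i -> S t = S2 t) ->
  `|FF S S' x - FF S2 S' x| <= U i (S' i) x.
Proof.
move=> Si S2i SS.
have := @field_sum_lipschitz1 (cfg S S' x) (cfg S2 S' x) i.
rewrite /cfg /= (negbTE Si) S2i; apply.
by move=> t ti; rewrite SS.
Qed.

Definition any_open l x : bool :=
  [|| (x ((false, false), l)).1, (x ((true, false), l)).1,
      (x ((false, true), l)).1 | (x ((true, true), l)).1].

Lemma resampled_sum_closed S S' S2 l x : ~~ any_open l x -> (forall t, t != l -> S' t = S2 t) ->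
  FF S S' x = FF S S2 x.
Proof.
move=> ol SS; apply/eqP; rewrite -subr_eq0 -normr_le0.
apply: le_trans (field_sum_lipschitz1 (i := l) _) _.
  by move=> t tl; rewrite /cfg SS.
rewrite /cfg (_ : _ || _ = false) ?mul0r//; move: ol; rewrite /any_open !negb_or => /and4P[/negbTE h1 /negbTE h2 /negbTE h3 /negbTE h4].
by case: (S l); case: (S' l); case: (S2 l); rewrite ?h1 ?h2 ?h3 ?h4.
Qed.

Definition increment_product i S' x : R :=
  (FF pred0 S' x - FF (pred1 i) S' x) *
  (FF (before (enum_rank i)) S' x - FF (before (enum_rank i).+1) S' x).
Local Notation Y := increment_product.

Lemma measurable_increment_product i S' : measurable_fun setT (Y i S' : field J state -> R).
Proof. by apply: measurable_funM; apply: measurable_funB; exact: measurable_resampled_sum. Qed.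

Lemma resampled_sum_diff_single S' i x : `|FF pred0 S' x - FF (pred1 i) S' x| <= U i (S' i) x.
Proof. by apply: resampled_sum_diff => /= [//||t /negbTE->]. Qed.

Lemma resampled_sum_diff_before S' i x :
  `|FF (before (enum_rank i)) S' x - FF (before (enum_rank i).+1) S' x| <= U i (S' i) x.
Proof.
apply: resampled_sum_diff => [||t ti].
- by rewrite /before ltnn.
- by rewrite before_succ /before ltnn eqxx.
- by rewrite before_succ (negbTE ti) addbF.
Qed.

Lemma increment_product_le i S' x : `|Y i S' x| <= U i (S' i) x ^+ 2.
Proof.
rewrite normrM expr2 ler_pM//; [exact: resampled_sum_diff_single|exact: resampled_sum_diff_before].
Qed.

Let p0 : 0 < p. Proof. by have /andP[] := p01. Qed.
Let c0 : 0 < c. Proof. exact: lt_le_trans c1. Qed.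

Lemma measurable_wvalH : measurable_fun setT (fun z => wval (H z) : R).
Proof.
apply: (@measurableT_comp _ _ _ _ _ _ (@wval R)) mH.
by move=> _ B mB; rewrite setTI; exists B => //; rewrite setTI.
Qed.

Let diffcopies i e : ((false, e), i) != ((true, e), i) :> J.
Proof. by []. Qed.

Let law_or i e (h : weight R * weight R -> R) : measurable_fun setT h ->
  (forall w, 0 <= h w) ->
  (\int[Q]_x (pair_open i e x * h ((x ((false, e), i)).2, (x ((true, e), i)).2))%:E =
   (p + (1 - p) * p)%:E * \int[(D \x D)%E]_w (h w)%:E)%E.
Proof.
move=> mh h0; rewrite -(entry_integral_or _ p01 mh h0).
pose G (z : state * state) := ((z.1.1 || z.2.1)%:R * h (z.1.2, z.2.2))%:E.
have mb : measurable_fun setT (fun z : state * state => (z.1.1 || z.2.1)%:R : R).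
  have mor : measurable_fun setT (fun z : bool * bool => z.1 || z.2).
    by apply: measurable_or; [exact: measurable_fst|exact: measurable_snd].
  have m1 : measurable_fun setT (fun z : state * state => (z.1.1, z.2.1)).
    apply: measurable_fun_pair.
      exact: (measurableT_comp measurable_fst measurable_fst).
    exact: (measurableT_comp measurable_fst measurable_snd).
  have mr : measurable_fun setT (fun b : bool => b%:R : R) by [].
  exact: (measurableT_comp mr (measurableT_comp mor m1)).
have mh2 : measurable_fun setT (fun z : state * state => h (z.1.2, z.2.2)).
  apply: (measurableT_comp mh); apply: measurable_fun_pair.
    exact: (measurableT_comp measurable_snd measurable_fst).
  exact: (measurableT_comp measurable_snd measurable_snd).
have mG : measurable_fun setT G by apply/measurable_EFinP; exact: measurable_funM.
have G0 z : (0 <= G z)%E by rewrite lee_fin mulr_ge0.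
have mX : measurable_fun setT (fun x : field J state => (x ((false, e), i), x ((true, e), i))).
  by apply: measurable_fun_pair; exact: measurable_coord.
exact: (@eq_law_ge0_integral R _ _ _ _ _ _ Q (entry_law p D \x entry_law p D)%E _ id
  mX (@measurable_id _ _ _) (iid_pair iQ (diffcopies i e)) G mG G0).
Qed.

Lemma measurable_ind i e : measurable_fun setT (pair_open i e : field J state -> R).
Proof.
have mor : measurable_fun setT (fun x : field J state =>
    (x ((false, e), i)).1 || (x ((true, e), i)).1).
  apply: measurable_or; [exact: (measurableT_comp measurable_fst (measurable_coord _))|].
  exact: (measurableT_comp measurable_fst (measurable_coord _)).
have mr : measurable_fun setT (fun b : bool => b%:R : R) by [].
exact: (measurableT_comp mr mor).
Qed.

Lemma measurable_flip_bound i e : measurable_fun setT (U i e : field J state -> R).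
Proof.
apply: measurable_funM; first exact: measurable_ind.
have mg : measurable_fun setT (fun x : field J state => ((x ((false, e), i)).2, (x ((true, e), i)).2)).
  by apply: measurable_fun_pair; exact: (measurableT_comp measurable_snd (measurable_coord _)).
exact: (measurableT_comp measurable_wvalH mg).
Qed.

Lemma ind01 i e x : 0 <= pair_open i e x <= 1.
Proof. by rewrite /pair_open; case: (_ || _); rewrite /= ?lexx ?ler01. Qed.

Lemma L1_ind i e : L1 Q (pair_open i e).
Proof.
apply: (L1_le (measurable_ind i e) (L1_cst Q 1)) => x.
by have /andP[a b] := ind01 i e x; rewrite ger0_norm.
Qed.

Let p2 : p + (1 - p) * p <= 2 * p.
Proof. by have := p0; nra. Qed.

Lemma Ex_ind i e : \int[Q]_x pair_open i e x <= 2 * p.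
Proof.
have := @law_or i e (fun=> 1) (measurable_cst _) (fun=> ler01).
have -> : (\int[(D \x D)%E]_w (1 : R)%:E = 1)%E.
  rewrite integral_cst//; apply: (etrans (mul1e _)); exact: (@probability_setT _ _ _ (D \x D)%E).
rewrite mule1 => E; rewrite /Rintegral; under eq_integral do rewrite -[pair_open _ _ _]mulr1.
by rewrite E.
Qed.

Let law6 i e : (\int[Q]_x (U i e x ^+ 6)%:E <= (2 * p * c ^+ 6)%:E)%E.
Proof.
have m6 : measurable_fun setT (fun z => wval (H z) ^+ 6 : R).
  by apply: measurable_funX; exact: measurable_wvalH.
have w6 z : 0 <= wval (H z) ^+ 6 by rewrite exprn_ge0//; exact: wval_ge0.
have := law_or i e m6 w6.
under eq_integral => x _.
  rewrite (_ : _ * _ = U i e x ^+ 6); first over.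
  by rewrite /U exprMn /pair_open; case: (_ || _); rewrite ?expr1n ?expr0n.
move=> ->; rewrite EFinM; apply: lee_pmul => //.
- by rewrite lee_fin; have /andP[a b] := p01; nra.
- by apply: integral_ge0 => z _; rewrite lee_fin.
Qed.

Lemma L1_flip_bound6 i e : L1 Q (fun x => U i e x ^+ 6).
Proof.
apply/integrableP; split.
  by apply/measurable_EFinP; apply: measurable_funX; exact: measurable_flip_bound.
under eq_integral do rewrite /= ger0_norm ?exprn_ge0 ?flip_bound_ge0//.
by apply: le_lt_trans (law6 i e) _; rewrite ltry.
Qed.

Lemma Ex_flip_bound6 i e : \int[Q]_x (U i e x ^+ 6) <= 2 * p * c ^+ 6.
Proof.
rewrite /Rintegral -[leRHS]/(fine (2 * p * c ^+ 6)%:E); apply: fine_le => //.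
exact: integrable_fin_num (L1_flip_bound6 i e).
Qed.

Let young r (al : R) : 0 <= al <= 1 ->
  (forall u : R, 0 <= u -> u ^+ r <= al * u ^+ 6 + (1 - al)) -> (0 < r)%N ->
  forall i e, L1 Q (fun x => U i e x ^+ r) /\ \int[Q]_x (U i e x ^+ r) <= 2 * p * c ^+ r.
Proof.
move=> al01 yg r0 i e.
have cr := exprn_gt0 r c0; have c6 := exprn_gt0 6 c0.
have Ur x : U i e x ^+ r <= c ^+ r * (al * (c ^- 6 * U i e x ^+ 6) + (1 - al) * pair_open i e x).
  rewrite /U; have w0 : 0 <= wval (H ((x ((false, e), i)).2, (x ((true, e), i)).2)) by exact: wval_ge0.
  rewrite /pair_open; case: (_ || _); rewrite ?mul1r ?mul0r.
    set w := wval _ in w0 *.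
    have := yg (w / c) (divr_ge0 w0 (ltW c0)).
    rewrite -(ler_pM2l cr) !expr_div_n mulrCA divff ?gt_eqF// mulr1.
    by rewrite mulr1 (mulrC (w ^+ 6)).
  by rewrite expr0n (gtn_eqF r0) expr0n !mulr0 addr0 mulr0.
have i1 : L1 Q (fun x => c ^+ r * (al * (c ^- 6 * U i e x ^+ 6) + (1 - al) * pair_open i e x)).
  apply: L1Z; apply: L1D; first by do 2 apply: L1Z; exact: L1_flip_bound6.
  by apply: L1Z; exact: L1_ind.
have i2 : L1 Q (fun x => U i e x ^+ r).
  apply: (L1_le _ i1); first by apply: measurable_funX; exact: measurable_flip_bound.
  by move=> x; rewrite ger0_norm ?exprn_ge0 ?flip_bound_ge0.
split => //; apply: (le_trans (Ex_le i2 i1 Ur)).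
have i3 := L1_flip_bound6 i e; have i4 := L1_ind i e.
rewrite ExZ; last by apply: L1D; apply: L1Z => //; exact: L1Z.
rewrite ExD; [|by do 2 apply: L1Z|exact: L1Z].
rewrite !ExZ//; last exact: L1Z.
rewrite mulrC ler_pM2r//.
have h6 : c ^- 6 * \int[Q]_x (U i e x ^+ 6) <= 2 * p.
  by rewrite ler_pdivrMl// mulrC; exact: Ex_flip_bound6.
have := Ex_ind i e; have /andP[a0 a1] := al01; nra.
Qed.

Lemma moment2 i e : L1 Q (fun x => U i e x ^+ 2) /\ \int[Q]_x (U i e x ^+ 2) <= 2 * p * c ^+ 2.
Proof.
apply: (@young 2 (3^-1)) => //; first by apply/andP; split; lra.
move=> u u0; rewrite (exprM u 2 3); have := sqr_ge0 u; set v := u ^+ 2 => v0.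
have : 0 <= (v - 1) ^+ 2 * (v + 2) by rewrite mulr_ge0 ?sqr_ge0//; lra.
rewrite !exprS expr0; lra.
Qed.

Lemma moment3 i e : L1 Q (fun x => U i e x ^+ 3) /\ \int[Q]_x (U i e x ^+ 3) <= 2 * p * c ^+ 3.
Proof.
apply: (@young 3 (2^-1)) => //; first by apply/andP; split; lra.
by move=> u u0; rewrite (exprM u 3 2); have := sqr_ge0 (u ^+ 3 - 1); nra.
Qed.

Lemma moment4 i e : L1 Q (fun x => U i e x ^+ 4) /\ \int[Q]_x (U i e x ^+ 4) <= 2 * p * c ^+ 4.
Proof.
apply: (@young 4 (2 / 3)) => //; first by apply/andP; split; lra.
move=> u u0; rewrite (exprM u 2 2) (exprM u 2 3); have := sqr_ge0 u; set v := u ^+ 2 => v0.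
have : 0 <= (v - 1) ^+ 2 * (2 * v + 1) by rewrite mulr_ge0 ?sqr_ge0//; lra.
rewrite !exprS expr0; lra.
Qed.

Lemma L2_flip_bound i e : L2 Q (U i e).
Proof. by split; [exact: measurable_flip_bound|have [] := moment2 i e]. Qed.

Lemma L2_flip_bound2 i e : L2 Q (fun x => U i e x ^+ 2).
Proof.
split; first by apply: measurable_funX; exact: measurable_flip_bound.
rewrite (_ : (fun x => _) = (fun x => U i e x ^+ 4)); first by have [] := moment4 i e.
by apply/funext => x; rewrite -exprM.
Qed.

Lemma L2_increment_product i S' : L2 Q (Y i S').
Proof.
apply: (L2_le _ (L2_flip_bound2 i (S' i))); first exact: measurable_increment_product.
by move=> x; rewrite (le_trans (increment_product_le _ _ _))// ler_norm.
Qed.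

Lemma L2_resampled_sum0 : L2 Q (FF pred0 pred0).
Proof.
pose k := F (fun=> (false, point)).
have D2 : L2 Q (fun x => FF pred0 pred0 x - k).
  have S2 : L2 Q (fun x => \sum_t U t false x) by apply: L2_sum => t; exact: L2_flip_bound.
  apply: (L2_le _ S2).
    by apply: measurable_funB => //; exact: measurable_resampled_sum.
  move=> x; rewrite [leRHS]ger0_norm; last by apply: sumr_ge0 => t _; exact: flip_bound_ge0.
  pose y0 (t : I) : state := (false, (x ((true, false), t)).2).
  have -> : k = F y0.
    apply/eqP; rewrite -subr_eq0 -normr_le0; apply: (le_trans (field_sum_lipschitz _ _)).
    by rewrite big1.
  apply: (le_trans (field_sum_lipschitz _ _)); rewrite big_mkcond.
  apply: ler_sum => t _; case: ifP => [/andP[bt _]|_]; last exact: flip_bound_ge0.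
  rewrite /U /pair_open; move: bt; rewrite /= orbF /cfg /= => ->.
  by rewrite mul1r.
rewrite (_ : FF _ _ = (fun x => (FF pred0 pred0 x - k) + k)).
  by apply: L2D => //; exact: L2_cst.
by apply/funext => x; rewrite subrK.
Qed.

Lemma field_sum_const : M = 0%N -> iso_invariant d g -> (0 < d)%N -> forall y y' : I -> state, F y = F y'.
Proof.
move=> M0 ginv d0 y y'; rewrite /F /local_sum; apply: eq_bigr => s _.
have nr (B : I -> bool) (W : I -> weight R) (t : {set 'I_n}) : ~ @reachable R d 'I_n (BW_complex B W) (val s) M t.
  by rewrite M0 => -[q [z [_]]]; rewrite size_rcons.
have fe : local_faces d (config_complex y) (val s) M = local_faces d (config_complex y') (val s) M.
  apply/setP => u; rewrite !inE; congr (_ || _).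
  by apply: eq_existsb => v; congr (_ && _); apply/asboolP/asboolP => /nr.
apply: (ginv _ _ _ _ id); split => //=.
  by rewrite fe; apply/setP => u; apply/idP/imsetP => [uf|[v vf ->]];
    [exists u => //|]; rewrite imset_id.
move=> t; rewrite inE /= => /andP[tf /eqP ct].
have /eqP fs : #|val s| == d.-1.+1 by exact: (valP s).
move: tf; rewrite inE => /orP[/subset_leq_card|/existsP[v /andP[/asboolP /nr]]] //.
by rewrite ct fs prednK// ltnn.
Qed.

End Model.

Section Covariance.
Variables (R : realType) (n d M : nat) (g : forall T : finType, wcomplex R T -> R).
Variables (H : weight R * weight R -> weight R) (p : R) (D : probability (weight R) R) (c : R).
Local Notation I := (simplex n d).
Local Notation state := (bool * weight R)%type.
Local Notation J := ((bool * bool) * I)%type.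
Hypotheses (mH : measurable_fun setT H) (mf : BW_measurable d (@local_sum R n d g M)).
Hypothesis lip : H_lipschitz d H (@local_sum R n d g M).
Hypotheses (p01 : 0 < p < 1) (c1 : 1 <= c).
Hypothesis Hc : (\int[(D \x D)%E]_z (wval (H z) ^+ 6)%:E <= (c ^+ 6)%:E)%E.
Variable Q : probability (field J state) R.
Hypothesis iQ : iid (entry_law p D) Q.
Hypotheses (d0 : (0 < d)%N) (M0 : (0 < M)%N) (ginv : iso_invariant d g).
Implicit Types (i j l t : I) (S : pred I) (x : J -> state) (e : bool).
Local Notation F := (field_sum M g).
Local Notation FF := (resampled_sum M g).
Local Notation Y := (increment_product M g).
Local Notation U := (flip_bound H).

Let p0 : 0 < p. Proof. by have /andP[] := p01. Qed.
Let c0 : 0 < c. Proof. exact: lt_le_trans c1. Qed.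

(* The two factors of [increment_product i] are increments at [base i false] and [base i true]. *)
Definition base i e : pred I := if e then before (enum_rank i) else pred0.

Definition open_in (A S : pred I) x : pred {set 'I_n} :=
  opened (fun t => (cfg A S x t).1).

Lemma exists_facet i : exists2 s : {set 'I_n}, s \subset val i & facet d s.
Proof.
have /card_gt0P[u ui] : (0 < #|val i|)%N by rewrite card_simplex.
exists (val i :\ u)%SET; first exact: subD1set.
by apply/eqP; have := cardsD1 u (val i); rewrite ui card_simplex add1n => -[E]; exact: esym E.
Qed.

Lemma increment_product_link i l (S S2 : pred I) x : (forall t, t != l -> S t = S2 t) ->
  Y i S x != Y i S2 x ->
  exists e s q, link d (open_in (base i e) S x) (val i) (val l) s q /\ (size q < 2 * M)%N.
Proof.
move=> SS nY; have [<-|il] := eqVneq i l.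
  have [s si fs] := exists_facet i; exists false, s, [::]; split; last by rewrite muln_gt0 M0.
  by rewrite /link si walk0 fs /= eqxx.
have key e (A' : pred I) : (forall t, A' t = base i e t (+) (t == i)) ->
    FF (base i e) S x - FF A' S x != FF (base i e) S2 x - FF A' S2 x ->
    exists s q, link d (open_in (base i e) S x) (val i) (val l) s q /\ (size q < 2 * M)%N.
  move=> AA' nF.
  apply: (@mixed_difference R n d M g d0 ginv (cfg (base i e) S x) i l
    (x ((A' i, S i), i)) (x ((base i e l, S2 l), l)) il).
  have e1 : update (cfg (base i e) S x) i (x ((A' i, S i), i)) = cfg A' S x.
    apply/funext => t; rewrite /update /cfg; case: eqP => [->//|/eqP ti].
    by rewrite AA' (negbTE ti) addbF.
  have e2 : update (cfg (base i e) S x) l (x ((base i e l, S2 l), l)) = cfg (base i e) S2 x.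
    apply/funext => t; rewrite /update /cfg; case: eqP => [->//|/eqP ti].
    by rewrite SS.
  have e3 : update (cfg (base i e) S2 x) i (x ((A' i, S i), i)) = cfg A' S2 x.
    apply/funext => t; rewrite /update /cfg; case: eqP => [->|/eqP ti].
      by rewrite SS.
    by rewrite AA' (negbTE ti) addbF.
  by rewrite e1 e2 e3.
have [E1|N1] := eqVneq (FF pred0 S x - FF (pred1 i) S x) (FF pred0 S2 x - FF (pred1 i) S2 x).
  have [|s [q h]] := key true (before (enum_rank i).+1) (before_succ i).
    by apply: contra nY => /eqP E2; rewrite /Y E1 [X in _ * X]E2.
  by exists true, s, q.
have [|s [q h]] := key false (pred1 i) _ N1; first by move=> t.
by exists false, s, q.
Qed.

Definition flip_bound_sq i x : R := U i false x ^+ 2 + U i true x ^+ 2.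
Local Notation V := flip_bound_sq.

Lemma flip_bound_sq_ge0 i x : 0 <= V i x.
Proof. by rewrite addr_ge0// exprn_ge0// flip_bound_ge0. Qed.

Lemma increment_product_le_sq i S x : `|Y i S x| <= V i x.
Proof.
apply: (le_trans (increment_product_le lip _ _ _)); rewrite /V.
by case: (S i); rewrite ?lerDl ?lerDr ?exprn_ge0 ?flip_bound_ge0.
Qed.

Lemma L1_flip_bound_sq i : L1 Q (V i).
Proof.
have [i1 _] := moment2 mH p01 c1 Hc iQ i false.
by have [i2 _] := moment2 mH p01 c1 Hc iQ i true; exact: L1D.
Qed.

Lemma Ex_flip_bound_sq i : \int[Q]_x V i x <= 4 * p * c ^+ 2.
Proof.
have [i1 h1] := moment2 mH p01 c1 Hc iQ i false.
have [i2 h2] := moment2 mH p01 c1 Hc iQ i true.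
by rewrite ExD//; lra.
Qed.

Lemma depends_flip_bound_sq i : depends_on (column i) (V i).
Proof.
by move=> x y xy; rewrite /V /U /pair_open !xy// /column /= eqxx.
Qed.

Definition bit (A S : pred I) t x : R := (cfg A S x t).1%:R.

Lemma measurable_bit_at (j : J) : measurable_fun setT (fun x : field J state => (x j).1%:R : R).
Proof.
have mr : measurable_fun setT (fun b : bool => b%:R : R) by [].
exact: (measurableT_comp mr (measurableT_comp measurable_fst (measurable_coord j))).
Qed.

Lemma L1_bit_at (j : J) : L1 Q (fun x => (x j).1%:R).
Proof.
apply: (L1_le (measurable_bit_at j) (L1_cst Q 1)) => x.
by case: (x j).1; rewrite ?normr1 ?normr0.
Qed.

Lemma Ex_bit_at (j : J) : \int[Q]_x ((x j).1%:R : R) = p.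
Proof.
have mr : measurable_fun setT (fun b : bool => b%:R : R) by [].
have mG : measurable_fun setT (fun s : state => (s.1%:R : R)%:E).
  by apply/measurable_EFinP; exact: (measurableT_comp mr measurable_fst).
have G0 (s : state) : (0 <= (s.1%:R : R)%:E)%E by rewrite lee_fin.
rewrite /Rintegral.
have -> : (\int[Q]_x ((x j).1%:R)%:E = \int[entry_law p D]_s (s.1%:R)%:E)%E.
  exact: (@eq_law_ge0_integral R _ _ _ _ _ _ Q (entry_law p D) _ id
    (measurable_coord j) (@measurable_id _ _ _) (iid_one iQ j) (fun s : state => (s.1%:R : R)%:E) mG G0).
rewrite entry_integral//= integral0 mule0 adde0.
have -> : (\int[D]_w (1 : R)%:E = 1)%E.
  by rewrite integral_cst//; apply: (etrans (mul1e _)); exact: probability_setT.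
by rewrite mule1.
Qed.

Definition any_open_ind l x : R := (any_open l x)%:R.

Lemma obr_le l x : any_open_ind l x <= (x ((false, false), l)).1%:R + (x ((true, false), l)).1%:R +
  ((x ((false, true), l)).1%:R + (x ((true, true), l)).1%:R).
Proof.
rewrite /any_open_ind /any_open; set b1 := (x _).1; set b2 := (x _).1; set b3 := (x _).1; set b4 := (x _).1.
by case: b1; case: b2; case: b3; case: b4; rewrite /=; lra.
Qed.

Lemma L1_any_open_ind l : L1 Q (any_open_ind l).
Proof.
have mr : measurable_fun setT (fun b : bool => b%:R : R) by [].
have mb (j : J) : measurable_fun setT (fun x : field J state => (x j).1).
  exact: (measurableT_comp measurable_fst (measurable_coord j)).
have mob : measurable_fun setT (any_open l : field J state -> bool).
  by rewrite /any_open; do 3 apply: measurable_or => //.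
apply: (L1_le (measurableT_comp mr mob) (L1_cst Q 1)) => x /=.
by case: (any_open l x); rewrite ?normr1 ?normr0.
Qed.

Lemma Ex_any_open_ind l : \int[Q]_x any_open_ind l x <= 4 * p.
Proof.
have b := L1_bit_at.
apply: (le_trans (Ex_le (L1_any_open_ind l) (L1D (L1D (b _) (b _)) (L1D (b _) (b _))) (@obr_le l))).
rewrite ExD; [|exact: L1D|exact: L1D].
by rewrite !ExD// !Ex_bit_at; lra.
Qed.

Lemma depends_any_open_ind l : depends_on (column l) (any_open_ind l).
Proof. by move=> x y xy; rewrite /any_open_ind /any_open !xy// /column /= eqxx. Qed.

Section Structure.
Variables (i j l : I) (A1 S1 A2 S2 : pred I) (L1s L2s : seq {set 'I_n}).
Hypotheses (uL : uniq [:: val i, val j & L1s ++ L2s])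
  (cL : all (fun t : {set 'I_n} => #|t| == d.+1) (L1s ++ L2s))
  (lL : [|| l == i, l == j | val l \in L1s ++ L2s]).

(* Only some copy of [l] is known to be open, hence the weaker factor [any_open_ind]. *)
Definition site_factor t : field J state -> R :=
  if t == i then V i else if t == j then V j else if t == l then any_open_ind l
  else if val t \in L1s then bit A1 S1 t
  else if val t \in L2s then bit A2 S2 t else fun=> 1.

Lemma site_factor_L1 t : L1 Q (site_factor t).
Proof.
rewrite /site_factor; do 2 (case: ifP => _; first exact: L1_flip_bound_sq).
case: ifP => _; first exact: L1_any_open_ind.
do 2 (case: ifP => _; first exact: L1_bit_at).
exact: L1_cst.
Qed.

Lemma site_factor_depends t : depends_on (column t) (site_factor t).
Proof.
rewrite /site_factor; case: eqP => [->|_]; first exact: depends_flip_bound_sq.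
case: eqP => [->|_]; first exact: depends_flip_bound_sq.
case: eqP => [->|_]; first exact: depends_any_open_ind.
do 2 (case: ifP => _; first by move=> x y xy; rewrite /bit /cfg xy// /column /=).
by [].
Qed.

Let h t : R := if val t \in L1s ++ L2s then p else 1.

Let prod_h : \prod_t h t = p ^+ size (L1s ++ L2s).
Proof.
rewrite /h -big_mkcond /= prodr_const; congr (_ ^+ _).
have u : uniq (L1s ++ L2s) by move: uL => /= /and3P[].
rewrite -(card_uniqP u) -(fintype.card_image val_inj); apply: eq_card => s.
apply/fintype.imageP/idP => [[t ts ->]//|sL].
have cs : is_simplex d s by exact: (allP cL).
by exists (Sub s cs); rewrite ?SubK.
Qed.

Lemma site_factor_bound : L1 Q (fun x => \prod_t site_factor t x) /\
  \int[Q]_x (\prod_t site_factor t x) <= 64 * p ^+ 2 * c ^+ 4 * p ^+ size (L1s ++ L2s).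
Proof.
have [] := @Ex_prod_columns R _ _ (entry_law p D) _ _ Q iQ site_factor (index_enum _) (index_enum_uniq _) site_factor_L1 site_factor_depends.
move=> i1 ->; split => //.
have ij : i != j by move: uL; rewrite /= inE negb_or (inj_eq val_inj) => /andP[/andP[]].
have iL : val i \notin L1s ++ L2s by move: uL; rewrite /= inE negb_or => /andP[/andP[]].
have jL : val j \notin L1s ++ L2s by move: uL => /= /and3P[].
have Eh : p ^+ size (L1s ++ L2s) = \prod_(t | (t != i) && (t != j)) h t.
  rewrite -prod_h (bigD1 i)//= (bigD1 j)/=; last by rewrite eq_sym.
  by rewrite {1 2}/h (negbTE iL) (negbTE jL) !mul1r.
rewrite Eh (bigD1 i)//= (bigD1 j)/=; last by rewrite eq_sym.
have -> : site_factor i = V i by rewrite /site_factor eqxx.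
have -> : site_factor j = V j by rewrite /site_factor eq_sym (negbTE ij) eqxx.
have E0 t : 0 <= \int[Q]_x site_factor t x.
  apply: Ex_ge0 => x; rewrite /site_factor; do 2 (case: ifP => _; first exact: flip_bound_sq_ge0).
  do 3 (case: ifP => _; first by rewrite /any_open_ind /bit).
  exact: ler01.
have h0 t : 0 <= h t by rewrite /h; case: ifP => // _; exact: ltW.
pose q t : R := if t == l then 4 else 1.
have step : \prod_(t | (t != i) && (t != j)) \int[Q]_x site_factor t x <=
    4 * \prod_(t | (t != i) && (t != j)) h t.
  apply: (@le_trans _ _ (\prod_(t | (t != i) && (t != j)) (q t * h t))).
    apply: ler_prod => t /andP[ti tj]; rewrite E0 /= /site_factor (negbTE ti) (negbTE tj) /q /h.
    case: eqP => [tl|_].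
      move: lL; rewrite -tl (negbTE ti) (negbTE tj) /= => ->.
      exact: Ex_any_open_ind.
    rewrite mul1r mem_cat; case: ifP => _; first by rewrite Ex_bit_at.
    by case: ifP => _ /=; rewrite ?Ex_bit_at ?Ex_cst.
  rewrite big_split /= ler_wpM2r ?prodr_ge0//.
  have [lij|lij] := boolP ((l != i) && (l != j)).
    rewrite (bigD1 l)//= big1 /q ?eqxx ?mulr1// => t /andP[_ /negbTE->] //.
  rewrite big1 /q ?ler1n// => t tij; case: eqP => // tl.
  by move: lij; rewrite -tl tij.
have EV0 t : 0 <= \int[Q]_x V t x by apply: Ex_ge0 => x; exact: flip_bound_sq_ge0.
have pr0 : 0 <= \prod_(t | (t != i) && (t != j)) \int[Q]_x site_factor t x by apply: prodr_ge0.
rewrite mulrA (_ : 64 * p ^+ 2 * c ^+ 4 = (4 * p * c ^+ 2) * (4 * p * c ^+ 2) * 4); last by ring.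
rewrite -[leRHS]mulrA; apply: ler_pM => //; first by rewrite mulr_ge0.
by apply: ler_pM => //; exact: Ex_flip_bound_sq.
Qed.

End Structure.

End Covariance.

Section CovarianceBound.
Variables (R : realType) (n d M : nat) (g : forall T : finType, wcomplex R T -> R).
Variables (H : weight R * weight R -> weight R) (p : R) (D : probability (weight R) R) (c : R).
Local Notation I := (simplex n d).
Local Notation state := (bool * weight R)%type.
Local Notation J := ((bool * bool) * I)%type.
Hypotheses (mH : measurable_fun setT H) (mf : BW_measurable d (@local_sum R n d g M)).
Hypothesis lip : H_lipschitz d H (@local_sum R n d g M).
Hypotheses (p01 : 0 < p < 1) (c1 : 1 <= c).
Hypothesis Hc : (\int[(D \x D)%E]_z (wval (H z) ^+ 6)%:E <= (c ^+ 6)%:E)%E.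
Variable Q : probability (field J state) R.
Hypothesis iQ : iid (entry_law p D) Q.
Hypotheses (d0 : (0 < d)%N) (M0 : (0 < M)%N) (ginv : iso_invariant d g).
Implicit Types (i j l t : I) (S : pred I) (x : J -> state).
Local Notation F := (field_sum M g).
Local Notation FF := (resampled_sum M g).
Local Notation Y := (increment_product M g).
Local Notation U := (flip_bound H).

Let p0 : 0 < p. Proof. by have /andP[] := p01. Qed.
Let c0 : 0 < c. Proof. exact: lt_le_trans c1. Qed.

Local Notation walkpair a b := (({set 'I_n} * a.-tuple {set 'I_n}) * ({set 'I_n} * b.-tuple {set 'I_n}))%type.

Definition steps1 a b (z : walkpair a b) : seq {set 'I_n} := steps z.1.1 (val z.1.2).
Definition steps2 a b (z : walkpair a b) : seq {set 'I_n} := steps z.2.1 (val z.2.2).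

Definition linking a b i j l (z : walkpair a b) : bool :=
  uniq [:: val i, val j & steps1 z ++ steps2 z] &&
  ((val l == last (val i) (steps1 z)) || (val l == last (val j) (steps2 z))).

(* The second walk may continue the first one past [j]; it is then open in the
   configuration of the first walk, which is what [e.2] records. *)
Definition weightprod a b i j l (e : bool * bool * bool) (z : walkpair a b) x : R :=
  \prod_t site_factor H i j l (base i e.1.1) pred0
    (if e.2 then base i e.1.1 else base j e.1.2)
    (if e.2 then (pred0 : pred I) else before (enum_rank l)) (steps1 z) (steps2 z) t x.

Definition majorant i j l x : R :=
  \sum_(e : bool * bool * bool) \sum_(a < 2 * M) \sum_(b < 2 * M)
    \sum_(z : walkpair a b | (z \in @meet 'I_n d a b (val i) (val j)) && linking i j l z)
      4 * weightprod i j l e z x.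

Lemma site_factor_ge0 i j l A1 S1 A2 S2 L1s L2s t x : 0 <= site_factor H i j l A1 S1 A2 S2 L1s L2s t x.
Proof.
rewrite /site_factor; do 2 (case: ifP => _; first exact: flip_bound_sq_ge0).
by do 3 (case: ifP => _; first by rewrite /any_open_ind /bit).
Qed.

Lemma weightprod_ge0 a b i j l e (z : walkpair a b) x : 0 <= weightprod i j l e z x.
Proof. by apply: prodr_ge0 => t _; exact: site_factor_ge0. Qed.

Lemma majorant_ge0 i j l x : 0 <= majorant i j l x.
Proof.
do 4 (apply: sumr_ge0 => ? _); rewrite mulr_ge0//; exact: weightprod_ge0.
Qed.

Lemma walk_steps_card (s : {set 'I_n}) q : walk d predT s q ->
  all (fun t : {set 'I_n} => #|t| == d.+1) (steps s q).
Proof. by case/andP => _; apply: sub_all => t /andP[]. Qed.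

Lemma le_bigsum (Z : finType) (P : pred Z) (f : Z -> R) z0 : P z0 ->
  (forall z, P z -> 0 <= f z) -> f z0 <= \sum_(z | P z) f z.
Proof.
move=> Pz0 f0; rewrite (bigD1 z0)//= lerDl; apply: sumr_ge0 => z /andP[Pz _].
exact: f0.
Qed.

Lemma Y_majorant i j l x : i != j ->
  `|(Y i pred0 x - Y i (pred1 l) x) *
    (Y j (before (enum_rank l)) x - Y j (before (enum_rank l).+1) x)| <= majorant i j l x.
Proof.
move=> ij.
have [E1|N1] := eqVneq (Y i pred0 x) (Y i (pred1 l) x).
  by rewrite E1 subrr mul0r normr0 majorant_ge0.
have [E2|N2] := eqVneq (Y j (before (enum_rank l)) x) (Y j (before (enum_rank l).+1) x).
  by rewrite E2 subrr mulr0 normr0 majorant_ge0.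
have agree1 t : t != l -> pred0 t = pred1 l t by move=> /negbTE /= ->.
have agree2 t : t != l -> before (enum_rank l) t = before (enum_rank l).+1 t.
  by move=> /negbTE tl; rewrite before_succ tl addbF.
have obl : any_open l x.
  apply: contraNT N1 => nob; apply/eqP.
  have E (A : pred I) : FF A pred0 x = FF A (pred1 l) x.
    exact: (@resampled_sum_closed R n d M g H lip A pred0 (pred1 l) l x nob agree1).
  by rewrite /increment_product !E.
have [e1 [s [q [lk1 sq]]]] := increment_product_link d0 M0 ginv agree1 N1.
have [e2 [s' [q' [lk2 sq']]]] := increment_product_link d0 M0 ginv agree2 N2.
have vij : val i != val j by rewrite (inj_eq val_inj).
have [s1 [p1 [s2 [p2 [b str]]]]] := disjoint_links d0 vij lk1 lk2.
case: str => -[si w1 sj w2] un [z1 z2] [h1 h2] [ll [v v1 v2]].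
have zM : (maxn (size q) (size q') < 2 * M)%N by rewrite gtn_max sq sq'.
have a1 := leq_ltn_trans z1 zM; have a2 := leq_ltn_trans z2 zM.
pose z : walkpair (Ordinal a1) (Ordinal a2) := ((s1, in_tuple p1), (s2, in_tuple p2)).
have zmeet : (z \in @meet 'I_n d (Ordinal a1) (Ordinal a2) (val i) (val j)) && linking i j l z.
  rewrite !inE /= si w1 sj w2 /=; apply/andP; split.
    by apply/existsP; exists v; rewrite /hits v1 v2.
  rewrite /linking; apply/andP; split; first exact: un.
  by case: ll => ->; rewrite /steps1 /steps2 /= eqxx ?orbT.
have wp : weightprod i j l ((e1, e2), b) z x = flip_bound_sq H i x * flip_bound_sq H j x.
  rewrite /weightprod (bigD1 i)//= (bigD1 j)/=; last by rewrite eq_sym.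
  rewrite {1 2}/site_factor eqxx (eq_sym j) (negbTE ij) eqxx big1 ?mulr1// => t /andP[/negbTE ti /negbTE tj].
  rewrite /site_factor ti tj; case: eqP => [_|/eqP tl]; first by rewrite /any_open_ind obl.
  have nl : val t <> val l by move=> /val_inj E; rewrite E eqxx in tl.
  case: ifP => [t1|_].
    by have [//|] := h1 _ t1; rewrite /open_in opened_val /bit => ->.
  case: ifP => [t2|//].
  by have [//|] := h2 _ t2; case: (b); rewrite /open_in opened_val /bit => ->.
apply: (@le_trans _ _ (4 * weightprod i j l ((e1, e2), b) z x)); last first.
  rewrite /majorant.
  pose f4 (a b' : 'I_(2 * M)) e (y : walkpair a b') := 4 * weightprod i j l e y x.
  have f40 a b' e y : 0 <= f4 a b' e y by rewrite mulr_ge0//; exact: weightprod_ge0.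
  pose fz (a b' : 'I_(2 * M)) e := \sum_(y : walkpair a b' | (y \in @meet 'I_n d a b' (val i) (val j)) && linking i j l y) f4 a b' e y.
  have fz0 a b' e : 0 <= fz a b' e by apply: sumr_ge0.
  have q1 : f4 _ _ ((e1, e2), b) z <= fz (Ordinal a1) (Ordinal a2) ((e1, e2), b).
    exact: (le_bigsum (f := f4 (Ordinal a1) (Ordinal a2) ((e1, e2), b)) zmeet (fun y _ => f40 _ _ _ y)).
  pose fb a e := \sum_(b' < 2 * M) fz a b' e.
  have fb0 a e : 0 <= fb a e by apply: sumr_ge0.
  have q2 : fz (Ordinal a1) (Ordinal a2) ((e1, e2), b) <= fb (Ordinal a1) ((e1, e2), b).
    by apply: (@le_bigsum _ predT (fun b' => fz (Ordinal a1) b' ((e1, e2), b)) (Ordinal a2)).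
  pose fa e := \sum_(a < 2 * M) fb a e.
  have q3 : fb (Ordinal a1) ((e1, e2), b) <= fa ((e1, e2), b).
    by apply: (@le_bigsum _ predT (fun a => fb a ((e1, e2), b)) (Ordinal a1)).
  have q4 : fa ((e1, e2), b) <= \sum_e fa e.
    by apply: (@le_bigsum _ predT fa ((e1, e2), b)) => // e _; apply: sumr_ge0.
  exact: le_trans q1 (le_trans q2 (le_trans q3 q4)).
rewrite wp normrM (_ : 4 * _ = (2 * flip_bound_sq H i x) * (2 * flip_bound_sq H j x)); last by ring.
have two t S S' : `|Y t S x - Y t S' x| <= 2 * flip_bound_sq H t x.
  rewrite (le_trans (ler_normB _ _))//; have := increment_product_le_sq lip t S x; have := increment_product_le_sq lip t S' x; lra.
by apply: ler_pM.
Qed.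

Lemma weightprod_bound a b i j l e (z : walkpair a b) :
  z \in @meet 'I_n d a b (val i) (val j) -> linking i j l z ->
  L1 Q (weightprod i j l e z) /\
  \int[Q]_x weightprod i j l e z x <= 64 * p ^+ 2 * c ^+ 4 * p ^+ (a + b).
Proof.
rewrite !inE => /and3P[/andP[_ w1] /andP[_ w2] _] /andP[un ll].
have sz : size (steps1 z ++ steps2 z) = (a + b)%N.
  by rewrite size_cat !size_steps !size_tuple.
rewrite -sz; apply: (site_factor_bound mH p01 c1 Hc iQ) => //.
  by rewrite all_cat !walk_steps_card.
rewrite mem_cat.
case/orP: ll => /eqP E.
  have := mem_last (val i) (steps1 z); rewrite -E inE (inj_eq val_inj) => /orP[->//|->].
  by rewrite !orbT.
have := mem_last (val j) (steps2 z); rewrite -E inE (inj_eq val_inj) => /orP[->//|->].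
  by rewrite orbT.
by rewrite !orbT.
Qed.

Lemma majorant_bound i j l : L1 Q (majorant i j l) /\
  \int[Q]_x majorant i j l x <= \sum_(e : bool * bool * bool) \sum_(a < 2 * M) \sum_(b < 2 * M)
    \sum_(z : walkpair a b | (z \in @meet 'I_n d a b (val i) (val j)) && linking i j l z)
      (256 * p ^+ 2 * c ^+ 4 * p ^+ (a + b)).
Proof.
have sumL (Z : finType) (P : pred Z) (f : Z -> field J state -> R) (k : Z -> R) :
    (forall z, P z -> L1 Q (f z) /\ \int[Q]_x f z x <= k z) ->
    L1 Q (fun x => \sum_(z | P z) f z x) /\ \int[Q]_x (\sum_(z | P z) f z x) <= \sum_(z | P z) k z.
  move=> h; pose f' z x := if P z then f z x else 0.
  have f'1 z : L1 Q (f' z).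
    by rewrite /f'; case: (boolP (P z)) => [/h[]//|_]; exact: L1_cst.
  have E x : \sum_(z | P z) f z x = \sum_z f' z x by rewrite big_mkcond.
  have S1 : L1 Q (fun x => \sum_z f' z x) by apply: L1_sum.
  split; first by apply: L1_eq S1 => x; rewrite E.
  have -> : \int[Q]_x (\sum_(z | P z) f z x) = \int[Q]_x (\sum_z f' z x).
    by apply: eq_Rintegral => x _; exact: E.
  rewrite Ex_sum// [leRHS]big_mkcond; apply: ler_sum => z _; rewrite /f'.
  by case: (boolP (P z)) => [/h[]//|_]; rewrite Ex_cst.
apply: (sumL _ _ _ _) => e _; apply: (sumL _ _ _ _) => a _; apply: (sumL _ _ _ _) => b _.
apply: (@sumL _ (fun z : walkpair a b => (z \in @meet 'I_n d a b (val i) (val j)) && linking i j l z)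
  (fun z x => 4 * weightprod i j l e z x) (fun=> 256 * p ^+ 2 * c ^+ 4 * p ^+ (a + b))) => z /andP[zm zl].
have [i1 h1] := weightprod_bound e zm zl.
split; first exact: L1Z.
by rewrite ExZ//; move: h1; lra.
Qed.

Lemma Y_swap i S x : Y i pred0 (x \o swap true S) = Y i S x.
Proof. by []. Qed.

Lemma Y_depends i : depends_on (fun j : J => ~~ copy_bit true j) (Y i pred0).
Proof.
move=> x y xy; have E A : FF A pred0 x = FF A pred0 y.
  by congr F; apply/funext => t; rewrite /cfg xy.
by rewrite /Y !E.
Qed.

Definition cov i j : R := \int[Q]_x (Y i pred0 x * Y j pred0 x) -
  \int[Q]_x Y i pred0 x * \int[Q]_x Y j pred0 x.

Let Y2 i S : L2 Q (Y i S). Proof. exact: (L2_increment_product mH mf lip p01 c1 Hc iQ). Qed.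

Lemma cov_le_sum i j : i != j -> `|cov i j| <= 2048 * p ^+ 2 * c ^+ 4 *
  \sum_(a < 2 * M) \sum_(b < 2 * M) #|@meet 'I_n d a b (val i) (val j)|%:R * p ^+ (a + b).
Proof.
move=> ij; rewrite /cov (cov_telescope iQ (h := true))//; try exact: Y_depends.
rewrite normrM ger0_norm; last by rewrite invr_ge0.
rewrite ler_pdivrMl//.
apply: (le_trans (ler_norm_sum _ _ _)).
apply: (@le_trans _ _ (\sum_l \sum_(e : bool * bool * bool) \sum_(a < 2 * M) \sum_(b < 2 * M)
    \sum_(z : walkpair a b | (z \in @meet 'I_n d a b (val i) (val j)) && linking i j l z)
      (256 * p ^+ 2 * c ^+ 4 * p ^+ (a + b)))).
  apply: ler_sum => l _; have [i1 h1] := majorant_bound i j l.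
  apply: le_trans h1; apply: Ex_abs_le => //.
    apply: L2_M; apply: L2B; [exact: (Y2 i pred0)|exact: (Y2 i (pred1 l))|
      exact: (Y2 j (before (enum_rank l)))|exact: (Y2 j (before (enum_rank l).+1))].
  by move=> x; rewrite !Y_swap; exact: Y_majorant.
pose X := \sum_(a < 2 * M) \sum_(b < 2 * M)
    \sum_(l : I) \sum_(z : walkpair a b | (z \in @meet 'I_n d a b (val i) (val j)) && linking i j l z)
      (256 * p ^+ 2 * c ^+ 4 * p ^+ (a + b)).
rewrite exchange_big /= (eq_bigr (fun=> X)); last first.
  by move=> e _; rewrite exchange_big; apply: eq_bigr => a _; rewrite exchange_big.
rewrite sumr_const (_ : #|_| = 8%N); last by rewrite !card_prod !card_bool.
rewrite /X => {X}.
rewrite -[leLHS]mulr_natl; have cp : 0 <= 256 * p ^+ 2 * c ^+ 4.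
  by rewrite !mulr_ge0 ?exprn_ge0 ?(ltW p0) ?(ltW c0).
apply: (@le_trans _ _ (8 * \sum_(a < 2 * M) \sum_(b < 2 * M)
    (2 * #|@meet 'I_n d a b (val i) (val j)|%:R * (256 * p ^+ 2 * c ^+ 4 * p ^+ (a + b))))).
  rewrite ler_pM2l//; apply: ler_sum => a _; apply: ler_sum => b _.
  rewrite (eq_bigr (fun l => \sum_(z : walkpair a b | z \in @meet 'I_n d a b (val i) (val j))
      (linking i j l z)%:R * (256 * p ^+ 2 * c ^+ 4 * p ^+ (a + b)))); last first.
    move=> l _; rewrite big_mkcondr; apply: eq_bigr => z _.
    by case: ifP => _; rewrite ?mul1r ?mul0r.
  rewrite exchange_big /=.
  apply: (@le_trans _ _ (\sum_(z : walkpair a b | z \in @meet 'I_n d a b (val i) (val j))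
      2 * (256 * p ^+ 2 * c ^+ 4 * p ^+ (a + b)))).
    apply: ler_sum => z _; rewrite -mulr_suml ler_wpM2r//.
      by rewrite mulr_ge0// exprn_ge0// ltW.
    apply: (@le_trans _ _ (\sum_l ((val l == last (val i) (steps1 z))%:R + (val l == last (val j) (steps2 z))%:R))).
      apply: ler_sum => l _; rewrite /linking.
      by case: (uniq _); case: (_ == _); case: (_ == _); rewrite /= ?mulr1n ?mulr0n; lra.
    have one (s : {set 'I_n}) : \sum_(l : I) (val l == s)%:R <= 1 :> R.
      rewrite -natr_sum -[leRHS]/(1%:R) ler_nat sum_bool_card.
      apply/card_le1_eqP => u v; rewrite !inE => /eqP us /eqP vs.
      by apply: val_inj; rewrite us vs.
    by rewrite big_split /= (_ : 2 = 1 + 1)// lerD.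
  by rewrite sumr_const -[leLHS]mulr_natr mulrAC.
rewrite le_eqVlt; apply/orP; left; apply/eqP.
rewrite !mulr_sumr; apply: eq_bigr => a _; rewrite !mulr_sumr; apply: eq_bigr => b _.
by ring.
Qed.

Lemma cov_disjoint i j (Lam : R) : 1 <= Lam -> n%:R * d%:R * p <= Lam ->
  fintype.disjoint (mem (val i)) (mem (val j)) -> i != j ->
  n%:R * `|cov i j| <= 2048 * p ^+ 2 * c ^+ 4 * (d.+1%:R ^+ 3 * (2 * M)%:R ^+ 4 * Lam ^+ (4 * M)).
Proof.
move=> L1' Lp dij ij.
have cp : 0 <= 2048 * p ^+ 2 * c ^+ 4.
  apply: mulr_ge0; last exact/exprn_ge0/ltW.
  by apply: mulr_ge0; [exact: ler0n|exact/exprn_ge0/ltW].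
have n0 : 0 <= n%:R :> R by exact: ler0n.
have h := cov_le_sum ij; move: cp h; move: (2048 * p ^+ 2 * c ^+ 4) => K K0 h.
apply: (le_trans (ler_wpM2l n0 h)).
rewrite mulrCA; apply: ler_wpM2l => //; rewrite mulr_sumr.
apply: (@le_trans _ _ (\sum_(a < 2 * M) \sum_(b < 2 * M) (d.+1%:R ^+ 3 * (2 * M)%:R ^+ 2 * Lam ^+ (4 * M)))).
  apply: ler_sum => a _; rewrite mulr_sumr; apply: ler_sum => b _.
  have mc := @meet_count 'I_n d a b (val i) (val j) (card_simplex i) (card_simplex j) dij.
  rewrite card_ord -(ler_nat R) !natrM !natrX natrM in mc.
  apply: (@le_trans _ _ (d.+1%:R ^+ 3 * (a.+1%:R * b.+1%:R) * (n%:R * d%:R) ^+ (a + b) * p ^+ (a + b))).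
    by rewrite [leLHS]mulrA; apply: ler_wpM2r; [exact/exprn_ge0/ltW|exact: mc].
  rewrite -mulrA -exprMn; apply: ler_pM.
  - by rewrite !mulr_ge0// exprn_ge0.
  - by rewrite exprn_ge0// !mulr_ge0// ltW.
  - apply: ler_wpM2l; first exact/exprn_ge0/ler0n.
    by rewrite expr2; apply: ler_pM; rewrite ?ler0n ?ler_nat ?ltn_ord.
  apply: (@le_trans _ _ (Lam ^+ (a + b))).
    have x0 : 0 <= n%:R * d%:R * p.
      by apply: mulr_ge0; [apply: mulr_ge0; exact: ler0n|exact: ltW].
    by apply: lerXn2r; rewrite ?nnegrE//; exact: le_trans ler01 L1'.
  rewrite ler_weXn2l//; have := ltn_ord a; have := ltn_ord b; clear; lia.
rewrite !sumr_const !card_ord -mulrnA -[leLHS]mulr_natr natrM.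
move: ((2 * M)%:R : R) (d.+1%:R : R) (Lam ^+ (4 * M)) => m D' L.
rewrite le_eqVlt; apply/orP; left; apply/eqP; ring.
Qed.

Lemma moment_flip_bounds i j : i != j ->
  L1 Q (fun x => U i false x ^+ 2 * U j false x ^+ 2) /\
  \int[Q]_x (U i false x ^+ 2 * U j false x ^+ 2) <= (2 * p * c ^+ 2) ^+ 2.
Proof.
move=> ij.
have [i1 h1] := moment2 mH p01 c1 Hc iQ i false.
have [i2 h2] := moment2 mH p01 c1 Hc iQ j false.
have D1 : depends_on (column i) (fun x => U i false x ^+ 2).
  by move=> x y xy; rewrite /flip_bound /pair_open !xy// /column /= eqxx.
have D2 : depends_on (predC (column i)) (fun x => U j false x ^+ 2).
  by move=> x y xy; rewrite /flip_bound /pair_open !xy// /column /= eq_sym.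
split; first exact: (indep_integrable iQ i1 i2 D1 D2).
rewrite (indep_Rintegral iQ i1 i2 D1 D2) expr2.
by apply: ler_pM => //; apply: Ex_ge0 => x; rewrite exprn_ge0// flip_bound_ge0.
Qed.

Lemma cov_any i j : i != j -> `|cov i j| <= 8 * p ^+ 2 * c ^+ 4.
Proof.
move=> ij; rewrite /cov (le_trans (ler_normB _ _))//.
have [i0 h0] := moment_flip_bounds ij.
have [i1 h1] := moment2 mH p01 c1 Hc iQ i false.
have [i2 h2] := moment2 mH p01 c1 Hc iQ j false.
have Y1 t := L2_L1 (Y2 t pred0).
have e0 : `|\int[Q]_x (Y i pred0 x * Y j pred0 x)| <= (2 * p * c ^+ 2) ^+ 2.
  apply: le_trans h0; apply: Ex_abs_le => //; first exact: L2_M.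
  by move=> x; rewrite normrM ler_pM//; exact: (increment_product_le lip).
have eY t : `|\int[Q]_x Y t pred0 x| <= \int[Q]_x (U t false x ^+ 2).
  have [] := moment2 mH p01 c1 Hc iQ t false => it _.
  by apply: Ex_abs_le => // x; exact: (increment_product_le lip).
have e1 : `|\int[Q]_x Y i pred0 x * \int[Q]_x Y j pred0 x| <= (2 * p * c ^+ 2) ^+ 2.
  by rewrite normrM expr2 ler_pM//; [apply: le_trans (eY i) h1|apply: le_trans (eY j) h2].
apply: (le_trans (lerD e0 e1)); rewrite le_eqVlt; apply/orP; left; apply/eqP; ring.
Qed.

Lemma cov_diag i : `|cov i i| <= 2 * p * c ^+ 4.
Proof.
rewrite /cov; have Y1 := L2_L1 (Y2 i pred0).
set m := \int[Q]_x Y i pred0 x; set v := \int[Q]_x _.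
have v0 : m ^+ 2 <= v.
  have : 0 <= \int[Q]_x ((Y i pred0 x * Y i pred0 x - 2 * m * Y i pred0 x) + m ^+ 2).
    by apply: Ex_ge0 => x; have := sqr_ge0 (Y i pred0 x - m); nra.
  rewrite ExD; [|by apply: L1B; [exact: L2_M|exact: L1Z]|exact: L1_cst].
  by rewrite ExB; [|exact: L2_M|exact: L1Z]; rewrite ExZ// Ex_cst -/m -/v; nra.
rewrite ger0_norm; last by rewrite subr_ge0 -expr2.
have [i4 h4] := moment4 mH p01 c1 Hc iQ i false.
apply: (@le_trans _ _ v); first by rewrite gerBl -expr2 sqr_ge0.
apply: le_trans h4; apply: Ex_le => //; first exact: L2_M.
move=> x; apply: (le_trans (ler_norm _)); rewrite normrM (exprM _ 2 2) expr2.
by apply: ler_pM => //; exact: (increment_product_le lip).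
Qed.

End CovarianceBound.

Section VarianceBound.
Variables (R : realType) (n d M : nat) (g : forall T : finType, wcomplex R T -> R).
Variables (H : weight R * weight R -> weight R) (p : R) (D : probability (weight R) R) (c : R).
Local Notation I := (simplex n d).
Local Notation state := (bool * weight R)%type.
Local Notation J := ((bool * bool) * I)%type.
Hypotheses (mH : measurable_fun setT H) (mf : BW_measurable d (@local_sum R n d g M)).
Hypothesis lip : H_lipschitz d H (@local_sum R n d g M).
Hypotheses (p01 : 0 < p < 1) (c1 : 1 <= c).
Hypothesis Hc : (\int[(D \x D)%E]_z (wval (H z) ^+ 6)%:E <= (c ^+ 6)%:E)%E.
Variable Q : probability (field J state) R.
Hypothesis iQ : iid (entry_law p D) Q.
Hypotheses (d0 : (0 < d)%N) (M0 : (0 < M)%N) (ginv : iso_invariant d g).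
Implicit Types (i j l t : I) (S : pred I) (x : J -> state).
Local Notation F := (field_sum M g).
Local Notation FF := (resampled_sum M g).
Local Notation Y := (increment_product M g).
Local Notation U := (flip_bound H).

Let p0 : 0 < p. Proof. by have /andP[] := p01. Qed.
Let c0 : 0 < c. Proof. exact: lt_le_trans c1. Qed.

Lemma bin_le_exp m k : ('C(m, k) <= m ^ k)%N.
Proof.
have h : ('C(m, k) * k`! <= m ^ k)%N.
  rewrite bin_ffact; elim: k m => [|k IH] m; first by rewrite ffactn0.
  rewrite ffactnS expnS leq_mul2l; apply/orP; right.
  by apply: leq_trans (IH _) _; case: k {IH} => [//|k]; rewrite leq_exp2r ?leq_pred.
by apply: leq_trans h; rewrite leq_pmulr ?fact_gt0.
Qed.

Lemma card_draws_le k : (#|[set s : {set 'I_n} | #|s| == k]%SET| <= n ^ k)%N.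
Proof.
by have := @card_draws 'I_n k; rewrite card_ord => ->; exact: bin_le_exp.
Qed.

Lemma card_simplex_le : (#|{: I}| <= n ^ d.+1)%N.
Proof.
apply: leq_trans (card_draws_le d.+1); rewrite -(card_imset predT val_inj).
apply: subset_leq_card; apply/fintype.subsetP => _ /imsetP[t _ ->].
by rewrite inE card_simplex.
Qed.

Lemma card_meeting_le i :
  (#|[set j : I | ~~ fintype.disjoint (mem (val i)) (mem (val j))]%SET| <= d.+1 * n ^ d)%N.
Proof.
apply: (@leq_trans (\sum_(v in val i) #|[set j : I | v \in val j]%SET|)).
  rewrite -sum_bool_card; under [X in (_ <= X)%N]eq_bigr do rewrite -sum_bool_card.
  rewrite exchange_big /=; apply: leq_sum => j _.
  case: (boolP (fintype.disjoint _ _)) => //= /pred0Pn[v /andP[vi vj]].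
  have {}vj : v \in val j by [].
  by rewrite (bigD1 v)//= vj.
rewrite -[X in (_ <= X * _)%N](card_simplex i) -sum_nat_const; apply: leq_sum => v _.
apply: leq_trans (card_draws_le d).
rewrite -(@card_in_imset _ _ (fun j : I => (val j :\ v)%SET)).
  apply: subset_leq_card; apply/fintype.subsetP => s /imsetP[j]; rewrite inE => vj ->.
  by have := cardsD1 v (val j); rewrite vj card_simplex inE add1n => -[<-].
move=> j1 j2; rewrite !inE => h1 h2 E; apply: val_inj.
by rewrite /= -(finset.setD1K h1) -(finset.setD1K h2) E.
Qed.

Definition stein_kernel x : R := 2^-1 * \sum_i Y i pred0 x.
Local Notation T := stein_kernel.

Let Y2 i S : L2 Q (Y i S). Proof. exact: (L2_increment_product mH mf lip p01 c1 Hc iQ). Qed.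

Lemma L2_stein_kernel : L2 Q T.
Proof. by apply: L2Z; apply: L2_sum => i; exact: Y2. Qed.

Lemma Ex_stein_kernel : \int[Q]_x T x = 2^-1 * \sum_i \int[Q]_x Y i pred0 x.
Proof.
rewrite ExZ; last by apply: L1_sum => i; exact: L2_L1.
by rewrite Ex_sum// => i; exact: L2_L1.
Qed.

Lemma var_stein_kernel : \int[Q]_x ((T x - \int[Q]_y T y) ^+ 2) = 4^-1 * \sum_i \sum_j cov M g Q i j.
Proof.
pose e i := \int[Q]_x Y i pred0 x.
have Z2 i : L2 Q (fun x => Y i pred0 x - e i).
  by apply: L2B; [exact: Y2|exact: L2_cst].
have covE i j : cov M g Q i j = \int[Q]_x ((Y i pred0 x - e i) * (Y j pred0 x - e j)).
  have E x : (Y i pred0 x - e i) * (Y j pred0 x - e j) =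
     Y i pred0 x * Y j pred0 x - e j * Y i pred0 x - (e i * Y j pred0 x - e i * e j) by ring.
  under eq_Rintegral do rewrite E.
  have a1 := L2_M (Y2 i pred0) (Y2 j pred0); have a2 := L2_L1 (Y2 i pred0); have a3 := L2_L1 (Y2 j pred0).
  rewrite ExB; [|by apply: L1B => //; exact: L1Z|by apply: L1B; [exact: L1Z|exact: L1_cst]].
  rewrite ExB//; last exact: L1Z.
  rewrite ExB//; [|exact: L1Z|exact: L1_cst].
  by rewrite Ex_cst !ExZ// -/(e i) -/(e j) subrr subr0 mulrC.
have sq x : (T x - \int[Q]_y T y) ^+ 2 = 4^-1 * \sum_i \sum_j (Y i pred0 x - e i) * (Y j pred0 x - e j).
  rewrite Ex_stein_kernel /T -mulrBr -sumrB exprMn; congr (_ * _); first by rewrite exprVn; congr (_^-1); ring.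
  by rewrite expr2 mulr_suml; apply: eq_bigr => i _; rewrite mulr_sumr.
under eq_Rintegral do rewrite sq.
have s1 i : L1 Q (fun x => \sum_j (Y i pred0 x - e i) * (Y j pred0 x - e j)).
  by apply: L1_sum => j; exact: L2_M.
rewrite ExZ; last by apply: L1_sum.
congr (_ * _); rewrite Ex_sum//; apply: eq_bigr => i _.
by rewrite Ex_sum => [|j]; [apply: eq_bigr => j _; rewrite covE|exact: L2_M].
Qed.

Let total_bound (N a u k m B q s : R) : 0 <= N -> 0 <= a -> 0 <= u -> 0 <= k -> 0 <= q -> 0 <= s ->
  N * a <= a ^+ 2 -> u <= m -> 1 <= m -> 1 <= B -> s <= B ->
  a ^+ 2 * (u ^+ 2 * k) * (q * B) + a ^+ 2 * (u ^+ 2 * k) * (s * 8) + N * a * (2 * (u * k)) <=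
  (q + 8 + 2) * (a ^+ 2 * k * m ^+ 2 * B).
Proof.
move=> N0 a0 u0 k0 q0 s0 Na um m1 B1 sB.
have B0 : 0 <= B by exact: le_trans B1.
have u2 : u ^+ 2 <= m ^+ 2 by rewrite lerXn2r// nnegrE (le_trans u0).
have m2 : u <= m ^+ 2 by apply: (le_trans um); rewrite expr2 ler_peMl// (le_trans u0).
have a2 : 0 <= a ^+ 2 by exact: sqr_ge0.
have h : a ^+ 2 * (u ^+ 2 * k) <= a ^+ 2 * k * m ^+ 2.
  by rewrite -mulrA (mulrC k); apply: ler_wpM2l => //; exact: ler_wpM2r.
have w0 : 0 <= a ^+ 2 * k * m ^+ 2 by apply: mulr_ge0; [exact: mulr_ge0|exact: sqr_ge0].
rewrite [leRHS]mulrDl [X in _ <= X + _]mulrDl; apply: lerD; first apply: lerD.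
- rewrite [leLHS]mulrCA; apply: ler_wpM2l => //; exact: ler_wpM2r.
- rewrite [leLHS]mulrA [leLHS]mulrC; apply: ler_wpM2l => //; apply: ler_pM => //.
  by apply: mulr_ge0 => //; apply: mulr_ge0 => //; exact: sqr_ge0.
- rewrite [leLHS]mulrCA; apply: ler_wpM2l => //; rewrite mulrA.
  apply: (@le_trans _ _ (a ^+ 2 * k * m ^+ 2)); last by rewrite ler_peMr.
  rewrite -[leLHS]mulrA -[leRHS]mulrA; apply: ler_pM => //; [exact: mulr_ge0|exact: mulr_ge0|].
  by rewrite mulrC; apply: ler_wpM2l.
Qed.

Lemma var_stein_kernel_le (Lam : R) (m : R) : 1 <= Lam -> n%:R * d%:R * p <= Lam ->
  1 <= m -> n%:R * p <= m ->
  n%:R * \int[Q]_x ((T x - \int[Q]_y T y) ^+ 2) <=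
  515 * (n%:R ^+ (2 * d) * c ^+ 4 * m ^+ 2 * (d.+1%:R ^+ 3 * (2 * M)%:R ^+ 4 * Lam ^+ (4 * M))).
Proof.
move=> L1' Lp m1 mp; set B := d.+1%:R ^+ 3 * _ * _.
have n0 : 0 <= n%:R :> R by exact: ler0n.
have D1 : 1 <= d.+1%:R :> R by rewrite -[leLHS]/(1%:R) ler_nat.
have DB : d.+1%:R <= B.
  have M1 : 1 <= (2 * M)%:R ^+ 4 * Lam ^+ (4 * M).
    apply: mulr_ege1; apply: exprn_ege1 => //.
    by rewrite -[leLHS]/(1%:R) ler_nat muln_gt0 M0.
  rewrite /B -mulrA; apply: (@le_trans _ _ (d.+1%:R ^+ 3)).
    by rewrite exprS ler_peMr// exprn_ege1.
  by apply: ler_peMr => //; exact/exprn_ge0/ler0n.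
have B0 : 0 <= B by apply: le_trans DB; exact: ler0n.
have B1 : 1 <= B by exact: le_trans DB.
pose K := p ^+ 2 * c ^+ 4.
have K0 : 0 <= K by apply: mulr_ge0; exact/exprn_ge0/ltW.
have [q q0 qE] : exists2 q : R, 0 <= q & q = 2048 by exists 2048; [exact: ler0n|reflexivity].
have dis i j : [disjoint val i & val j]%bool -> i != j -> n%:R * `|cov M g Q i j| <= q * K * B.
  move=> dij ij; rewrite /K mulrA qE.
  exact: (cov_disjoint mH mf lip p01 c1 Hc iQ d0 M0 ginv L1' Lp dij ij).
pose mt i j := (~~ [disjoint val i & val j]%bool) : nat.
have pt i j : n%:R * `|cov M g Q i j| <=
    q * K * B + (mt i j)%:R * (n%:R * (8 * K)) + (i == j)%:R * (n%:R * (2 * p * c ^+ 4)).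
  have a0 : 0 <= q * K * B by apply: mulr_ge0 => //; apply: mulr_ge0.
  have b0 : 0 <= n%:R * (8 * K) by apply: mulr_ge0 => //; apply: mulr_ge0.
  have e0 : 0 <= n%:R * (2 * p * c ^+ 4).
    by apply: mulr_ge0 => //; apply: mulr_ge0; [apply: mulr_ge0 => //; exact: ltW|exact/exprn_ge0/ltW].
  have [<-|ij] := eqVneq i j.
    rewrite mul1r; apply: ler_wpDl; first by apply: addr_ge0 => //; apply: mulr_ge0.
    by apply: ler_wpM2l => //; exact: (cov_diag mH mf lip p01 c1 Hc iQ).
  rewrite mul0r addr0; have [dij|mij] := boolP [disjoint val i & val j]%bool.
    by rewrite /mt dij mul0r addr0; exact: dis.
  rewrite /mt mij mul1r; apply: ler_wpDl => //.
  apply: ler_wpM2l => //; rewrite /K mulrA; exact: (cov_any mH mf lip p01 c1 Hc iQ ij).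
have sumj i : \sum_j n%:R * `|cov M g Q i j| <=
    #|{: I}|%:R * (q * K * B) + (d.+1 * n ^ d)%:R * (n%:R * (8 * K)) + n%:R * (2 * p * c ^+ 4).
  apply: (le_trans (ler_sum _ (fun j _ => pt i j))); rewrite !big_split/=.
  rewrite sumr_const -[X in X + _ + _]mulr_natl -!mulr_suml -natr_sum.
  apply: lerD; first apply: lerD; first exact: lexx.
    apply: ler_wpM2r; first by apply: mulr_ge0 => //; apply: mulr_ge0.
    rewrite ler_nat; apply: leq_trans (card_meeting_le i).
    by rewrite -sum_bool_card; apply: eq_leq; apply: eq_bigr.
  rewrite (bigD1 i)//= eqxx big1 ?addr0 ?mul1r// => j ji.
  by rewrite eq_sym (negbTE ji).
have N1 : #|{: I}|%:R <= n%:R ^+ d.+1 :> R by rewrite -natrX ler_nat; exact: card_simplex_le.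
have nd : n%:R ^+ d.+1 <= n%:R ^+ (2 * d) :> R.
  rewrite -!natrX ler_nat; have [->|n_gt0] := posnP n; first by rewrite exp0n.
  by rewrite leq_pexp2l// mul2n -addnn -add1n leq_add2r.
have k0 : 0 <= q * K * B by apply: mulr_ge0 => //; apply: mulr_ge0.
have e0 : 0 <= n%:R * (2 * p * c ^+ 4).
  by apply: mulr_ge0 => //; apply: mulr_ge0; [apply: mulr_ge0 => //; exact: ltW|exact/exprn_ge0/ltW].
have sums : n%:R * \sum_i \sum_j `|cov M g Q i j| <= n%:R ^+ d.+1 * (n%:R ^+ d.+1 * (q * K * B) +
   d.+1%:R * n%:R ^+ d.+1 * (8 * K) + n%:R * (2 * p * c ^+ 4)).
  set tt := _ + n%:R * (2 * _ * _).
  have t0 : 0 <= tt.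
    apply: addr_ge0 => //; apply: addr_ge0; apply: mulr_ge0 => //; rewrite ?exprn_ge0//.
    exact: mulr_ge0.
  apply: (@le_trans _ _ (#|{: I}|%:R * tt)); last exact: ler_wpM2r.
  rewrite mulr_sumr mulr_natl -sumr_const; apply: ler_sum => i _.
  rewrite mulr_sumr; apply: (le_trans (sumj i)); rewrite /tt.
  apply: lerD => //; apply: lerD; first exact: ler_wpM2r.
  by rewrite natrM natrX exprSr !mulrA.
have S1 : \sum_i \sum_j cov M g Q i j <= \sum_i \sum_j `|cov M g Q i j|.
  by apply: ler_sum => i _; apply: ler_sum => j _; exact: ler_norm.
rewrite var_stein_kernel mulrCA ler_pdivrMl; last exact: ltr0n.
apply: (le_trans (ler_wpM2l n0 S1)); apply: (le_trans sums).
have np0 : 0 <= n%:R * p by apply: mulr_ge0 => //; exact: ltW.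
have nd' : n%:R * n%:R ^+ d <= (n%:R ^+ d) ^+ 2 :> R by rewrite -exprS -exprM mulnC.
have := total_bound n0 (exprn_ge0 d n0) np0 (exprn_ge0 4 (ltW c0)) q0 (ler0n R d.+1) nd' mp m1 B1 DB.
have -> : n%:R ^+ (2 * d) = (n%:R ^+ d) ^+ 2 :> R by rewrite -exprM mulnC.
rewrite (exprS _ d) /K; set a := n%:R ^+ d; set N := n%:R; set k := c ^+ 4; set s := d.+1%:R.
have W0 : 0 <= a ^+ 2 * k * m ^+ 2 * B.
  apply: mulr_ge0 => //; apply: mulr_ge0; last exact: sqr_ge0.
  by apply: mulr_ge0; [exact: sqr_ge0|exact/exprn_ge0/ltW].
move: W0; set W := _ * B; move=> W0 h.
apply: (@le_trans _ _ ((q + 8 + 2) * W)); last first.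
  rewrite [leRHS]mulrA qE. by apply: ler_wpM2r => //; rewrite -!natrD -natrM ler_nat.
by apply: le_trans h; rewrite le_eqVlt; apply/orP; left; apply/eqP; ring.
Qed.

End VarianceBound.

(** * Stein's method for the functional *)

Lemma taylor_lipschitz (R : realType) (phi dphi : R -> R) (L : R) :
  (forall x : R, is_derive x 1 phi (dphi x)) ->
  (forall x y, `|dphi x - dphi y| <= L * `|x - y|) ->
  forall a b, `|phi a - phi b - dphi a * (a - b)| <= L * (a - b) ^+ 2.
Proof.
move=> dp Ld a b.
have L0 : 0 <= L by have := le_trans (normr_ge0 _) (Ld 1 0); rewrite subr0 normr1 mulr1.
have mvt u v : u < v -> exists2 w, u <= w <= v & phi v - phi u = dphi w * (v - u).
  move=> uv; have [|w] := MVT uv (fun x _ => dp x).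
    apply: continuous_subspaceT => x.
    by have [dx _] := dp x; exact/differentiable_continuous/derivable1_diffP.
  by rewrite in_itv/= => /andP[uw wv] E; exists w => //; rewrite !ltW.
have [->|ab] := eqVneq a b; first by rewrite !subrr mulr0 subr0 normr0 expr0n mulr0.
have key w : `|w - a| <= `|a - b| -> phi a - phi b = dphi w * (a - b) ->
    `|phi a - phi b - dphi a * (a - b)| <= L * (a - b) ^+ 2.
  move=> wa ->; rewrite -mulrBl normrM -(real_normK (num_real (a - b))) expr2 mulrA ler_wpM2r//.
  by apply: (le_trans (Ld _ _)); exact: ler_wpM2l.
have [lab|lba|/eqP] := ltgtP a b; last by rewrite (negbTE ab).
  have [w /andP[w1 w2] E] := mvt _ _ lab; apply: (key w).
    by rewrite ger0_norm ?subr_ge0// ltr0_norm ?subr_lt0//; lra.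
  by rewrite -[LHS]opprB E; ring.
have [w /andP[w1 w2] E] := mvt _ _ lba; apply: (key w) E.
by rewrite distrC ger0_norm ?subr_ge0// gtr0_norm ?subr_gt0//; lra.
Qed.

Section SteinError.
Variables (R : realType) (n d M : nat) (g : forall T : finType, wcomplex R T -> R).
Variables (H : weight R * weight R -> weight R) (p : R) (D : probability (weight R) R) (c : R).
Local Notation I := (simplex n d).
Local Notation state := (bool * weight R)%type.
Local Notation J := ((bool * bool) * I)%type.
Hypotheses (mH : measurable_fun setT H) (mf : BW_measurable d (@local_sum R n d g M)).
Hypothesis lip : H_lipschitz d H (@local_sum R n d g M).
Hypotheses (p01 : 0 < p < 1) (c1 : 1 <= c).
Hypothesis Hc : (\int[(D \x D)%E]_z (wval (H z) ^+ 6)%:E <= (c ^+ 6)%:E)%E.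
Variable Q : probability (field J state) R.
Hypothesis iQ : iid (entry_law p D) Q.
Hypotheses (d0 : (0 < d)%N) (M0 : (0 < M)%N) (ginv : iso_invariant d g).
Implicit Types (i j l t : I) (S : pred I) (x : J -> state).
Local Notation F := (field_sum M g).
Local Notation FF := (resampled_sum M g).
Local Notation Y := (increment_product M g).
Local Notation U := (flip_bound H).

Let p0 : 0 < p. Proof. by have /andP[] := p01. Qed.
Let c0 : 0 < c. Proof. exact: lt_le_trans c1. Qed.
Local Notation T := (stein_kernel M g).
Local Notation f := (FF pred0 pred0).
Local Notation mu := (\int[Q]_x f x).

Let f2 : L2 Q f. Proof. exact: (L2_resampled_sum0 mH mf lip p01 c1 Hc iQ). Qed.
Let Y2 i S : L2 Q (Y i S). Proof. exact: (L2_increment_product mH mf lip p01 c1 Hc iQ). Qed.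
Let T2 : L2 Q T. Proof. exact: (L2_stein_kernel mH mf lip p01 c1 Hc iQ). Qed.

Lemma depends_resampled_sum0 : depends_on (fun j : J => ~~ copy_bit false j) (f : field J state -> R).
Proof. by move=> x y xy; congr (field_sum _ _ _); apply/funext => t; apply: xy. Qed.

Lemma variance_stein_kernel : \int[Q]_x ((f x - mu) ^+ 2) = \int[Q]_x T x.
Proof.
rewrite (Ex_stein_kernel mH mf lip p01 c1 Hc iQ) -(cov_telescope iQ f2 f2 depends_resampled_sum0 depends_resampled_sum0).
have E x : (f x - mu) ^+ 2 = f x * f x - 2 * mu * f x + mu * mu by ring.
transitivity (\int[Q]_x (f x * f x - 2 * mu * f x + mu * mu)).
  by apply: eq_Rintegral => x _; rewrite E.
have a1 := L2_M f2 f2; have a2 := L2_L1 f2.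
rewrite ExD; [|by apply: L1B => //; exact: L1Z|exact: L1_cst].
rewrite ExB//; last exact: L1Z.
by rewrite Ex_cst ExZ//; ring.
Qed.

Lemma variance_le : \int[Q]_x ((f x - mu) ^+ 2) <= #|{: I}|%:R * (p * c ^+ 2).
Proof.
rewrite variance_stein_kernel (Ex_stein_kernel mH mf lip p01 c1 Hc iQ) mulr_natl -sumr_const mulr_sumr.
apply: ler_sum => i _; rewrite ler_pdivrMl// mulrA.
have [U1 U2] := moment2 mH p01 c1 Hc iQ i false.
apply: le_trans U2; apply: Ex_le => // [|x]; first exact: L2_L1.
exact: le_trans (ler_norm _) (increment_product_le lip i pred0 x).
Qed.

Variable s : R.
Hypotheses (s0 : 0 < s) (sE : s ^+ 2 = \int[Q]_x ((f x - mu) ^+ 2)).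

Let Z x : R := (f x - mu) / s.

Let Z2 : L2 Q Z.
Proof.
rewrite (_ : Z = fun x => s^-1 * (f x - mu)); last by apply/funext => x; rewrite mulrC.
by apply: L2Z; apply: L2B => //; exact: L2_cst.
Qed.

Let EZ : \int[Q]_x Z x = 0.
Proof.
transitivity (\int[Q]_x (s^-1 * (f x - mu))); first by apply: eq_Rintegral => x _; rewrite mulrC.
have a2 := L2_L1 f2; have a3 := L1_cst Q mu.
by rewrite ExZ ?ExB ?Ex_cst ?subrr ?mulr0//; exact: L1B.
Qed.

Lemma stein_error (phi dphi : R -> R) (L : R) :
  (forall x : R, is_derive x 1 phi (dphi x)) ->
  (forall x : R, `|phi x| <= 3) -> (forall x : R, `|dphi x| <= 2) ->
  (forall x y : R, `|dphi x - dphi y| <= L * `|x - y|) ->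
  `|\int[Q]_x (dphi (Z x) - Z x * phi (Z x))| <=
  2 * Num.sqrt (\int[Q]_x ((T x - \int[Q]_y T y) ^+ 2)) / s ^+ 2 +
  #|{: I}|%:R * (L * (p * c ^+ 3)) / s ^+ 3.
Proof.
move=> dp phi3 dphi2 Ld.
have L0 : 0 <= L by have := le_trans (normr_ge0 _) (Ld 1 0); rewrite subr0 normr1 mulr1.
have mZ : measurable_fun setT (Z : field J state -> R) by case: Z2.
have mphi : measurable_fun setT phi.
  apply: continuous_measurable_fun => x.
  by have [dx _] := dp x; exact/differentiable_continuous/derivable1_diffP.
have mdphi : measurable_fun setT dphi.
  by apply: continuous_measurable_fun; exact: (@lipschitz_continuous _ _ L).
have P2 : L2 Q (fun x => phi (Z x)).
  apply: (L2_le _ (L2_cst Q 3)); first exact: (measurableT_comp mphi mZ).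
  by move=> x; rewrite [leRHS]ger0_norm.
have dP2 : L2 Q (fun x => dphi (Z x)).
  apply: (L2_le _ (L2_cst Q 2)); first exact: (measurableT_comp mdphi mZ).
  by move=> x; rewrite [leRHS]ger0_norm.
pose ZS S x := (FF S pred0 x - mu) / s.
pose del l x := ZS (before (enum_rank l)) x - ZS (before (enum_rank l).+1) x.
have DZ : depends_on (fun j : J => ~~ copy_bit false j) Z.
  by move=> x y xy; rewrite /Z (depends_resampled_sum0 xy).
have DP : depends_on (fun j : J => ~~ copy_bit false j) (fun x => phi (Z x)).
  by move=> x y xy; rewrite (DZ _ _ xy).
have := cov_telescope iQ P2 Z2 DP DZ; rewrite EZ mulr0 subr0.
have -> : \sum_l \int[Q]_x ((phi (Z x) - phi (Z (x \o swap false (pred1 l)))) *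
    (Z (x \o swap false (before (enum_rank l))) - Z (x \o swap false (before (enum_rank l).+1)))) =
  \sum_l \int[Q]_x ((phi (Z x) - phi (ZS (pred1 l) x)) * del l x) by [].
move=> tel.
have ZS2 S : L2 Q (ZS S) by exact: (L2_perm iQ (@swap_inj _ false S) Z2).
have del2 l : L2 Q (del l) by exact: L2B.
have PS2 l : L2 Q (fun x => phi (ZS (pred1 l) x)).
  exact: (L2_perm iQ (@swap_inj _ false (pred1 l)) P2).
pose r l x := phi (Z x) - phi (ZS (pred1 l) x) - dphi (Z x) * (Z x - ZS (pred1 l) x).
have ZSd l x : Z x - ZS (pred1 l) x = (FF pred0 pred0 x - FF (pred1 l) pred0 x) / s.
  by rewrite /Z /ZS; field; rewrite gt_eqF.
have deld l x : del l x = (FF (before (enum_rank l)) pred0 x - FF (before (enum_rank l).+1) pred0 x) / s.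
  by rewrite /del /ZS; field; rewrite gt_eqF.
have split l x : (phi (Z x) - phi (ZS (pred1 l) x)) * del l x =
    s ^- 2 * (dphi (Z x) * Y l pred0 x) + r l x * del l x.
  have -> : s ^- 2 * (dphi (Z x) * Y l pred0 x) = dphi (Z x) * (Z x - ZS (pred1 l) x) * del l x.
    by rewrite ZSd deld /Y; field; rewrite gt_eqF.
  by rewrite /r; ring.
have i1 l : L1 Q (fun x => (phi (Z x) - phi (ZS (pred1 l) x)) * del l x).
  by apply: L2_M => //; exact: L2B.
have i2 l : L1 Q (fun x => dphi (Z x) * Y l pred0 x) by exact: L2_M.
have i3 l : L1 Q (fun x => r l x * del l x).
  rewrite (_ : (fun x => _) = (fun x => (phi (Z x) - phi (ZS (pred1 l) x)) * del l x -
    s ^- 2 * (dphi (Z x) * Y l pred0 x))); first by apply: L1B => //; exact: L1Z.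
  by apply/funext => x; rewrite split; ring.
have rb l : `|\int[Q]_x (r l x * del l x)| <= L * s ^- 3 * (2 * p * c ^+ 3).
  have [U1 U2] := moment3 mH p01 c1 Hc iQ l false.
  have k0 : 0 <= L * s ^- 3 by apply: mulr_ge0 => //; rewrite invr_ge0 exprn_ge0// ltW.
  apply: (@le_trans _ _ (\int[Q]_x (L * s ^- 3 * U l false x ^+ 3))); last first.
    by rewrite ExZ//; exact: ler_wpM2l.
  apply: Ex_abs_le => // [|x]; first exact: L1Z.
  have h1 : `|r l x| <= L * (U l false x / s) ^+ 2.
    apply: (le_trans (taylor_lipschitz dp Ld _ _)); apply: ler_wpM2l => //.
    rewrite ZSd !expr_div_n; apply: ler_wpM2r; first by rewrite invr_ge0 exprn_ge0// ltW.
    rewrite -(real_normK (num_real (_ - _))) lerXn2r// ?nnegrE ?flip_bound_ge0//.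
    exact: (resampled_sum_diff_single lip pred0 l x).
  have h2 : `|del l x| <= U l false x / s.
    rewrite deld normrM (ger0_norm (_ : 0 <= s^-1)); last by rewrite invr_ge0 ltW.
    apply: ler_wpM2r; first by rewrite invr_ge0 ltW.
    exact: (resampled_sum_diff_before lip pred0 l x).
  rewrite normrM; apply: (le_trans (ler_pM _ _ h1 h2)) => //.
  by rewrite le_eqVlt; apply/orP; left; apply/eqP; field; rewrite gt_eqF.
pose e := 2^-1 * \sum_l \int[Q]_x (r l x * del l x).
have eb : `|e| <= #|{: I}|%:R * (L * (p * c ^+ 3)) / s ^+ 3.
  rewrite normrM ger0_norm ?invr_ge0// ler_pdivrMl//.
  apply: (le_trans (ler_norm_sum _ _ _)); apply: (le_trans (ler_sum _ (fun l _ => rb l))).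
  rewrite sumr_const -mulr_natl le_eqVlt; apply/orP; left; apply/eqP.
  by field; rewrite gt_eqF.
have i4 : L1 Q (fun x => dphi (Z x) * T x) by exact: L2_M.
have tel' : \int[Q]_x (phi (Z x) * Z x) = s ^- 2 * \int[Q]_x (dphi (Z x) * T x) + e.
  have -> : \int[Q]_x (dphi (Z x) * T x) = 2^-1 * \sum_l \int[Q]_x (dphi (Z x) * Y l pred0 x).
    rewrite -Ex_sum// -ExZ; last exact: L1_sum.
    by apply: eq_Rintegral => x _; rewrite /stein_kernel mulrCA mulr_sumr.
  rewrite tel /e mulrCA -mulrDr; congr (_ * _); rewrite mulr_sumr -big_split/=.
  apply: eq_bigr => l _; rewrite -ExZ// -ExD//; last exact: L1Z.
  by apply: eq_Rintegral => x _; rewrite -split.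
have ET : \int[Q]_y T y = s ^+ 2 by rewrite sE variance_stein_kernel.
have TB2 : L2 Q (fun x => T x - s ^+ 2) by apply: L2B => //; exact: L2_cst.
have main : \int[Q]_x (dphi (Z x) - Z x * phi (Z x)) =
    - (s ^- 2 * \int[Q]_x (dphi (Z x) * (T x - s ^+ 2))) - e.
  have i5 := L2_L1 dP2.
  have -> : \int[Q]_x (dphi (Z x) - Z x * phi (Z x)) = \int[Q]_x dphi (Z x) - \int[Q]_x (phi (Z x) * Z x).
    rewrite -ExB//; last exact: L2_M.
    by apply: eq_Rintegral => x _; rewrite (mulrC (Z x)).
  have -> : \int[Q]_x (dphi (Z x) * (T x - s ^+ 2)) =
      \int[Q]_x (dphi (Z x) * T x) - s ^+ 2 * \int[Q]_x dphi (Z x).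
    rewrite -ExZ// -ExB//; last exact: L1Z.
    by apply: eq_Rintegral => x _; ring.
  by rewrite tel'; field; rewrite gt_eqF.
rewrite main ET -opprD normrN; apply: (le_trans (ler_normD _ _)); apply: lerD => //.
have s2 : 0 <= s ^- 2 by rewrite invr_ge0 exprn_ge0// ltW.
rewrite normrM (ger0_norm s2) [leLHS]mulrC.
apply: ler_wpM2r => //.
apply: (@le_trans _ _ (\int[Q]_x (2 * `|T x - s ^+ 2|))).
  have i6 := L1_abs (L2_L1 TB2).
  apply: Ex_abs_le; [exact: L2_M|exact: L1Z|move=> x].
  by rewrite normrM; apply: ler_wpM2r.
rewrite ExZ; last exact: L1_abs (L2_L1 TB2).
by apply: ler_wpM2l => //; exact: Ex_abs_L2.
Qed.

End SteinError.

Section Transfer.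
Variables (R : realType) (I : finType) (p : R) (D : probability (weight R) R).
Hypothesis p01 : 0 < p < 1.
Context (dO : measure_display) (Omega : measurableType dO) (P : probability Omega R).
Variables (b : I -> {RV P >-> bool}) (w : I -> {RV P >-> weight R}).
Hypothesis bw : random_BW p D b w.
Local Notation state := (bool * weight R)%type.

Definition entries (omega : Omega) : field I state := fun t => (b t omega, w t omega).

Lemma measurable_entries : measurable_fun setT entries.
Proof. by apply: measurable_to_field => t; apply: measurable_fun_pair. Qed.

Lemma iid_entries (Q : probability (field I state) R) : iid (entry_law p D) Q ->
  forall B, measurable B -> P (entries @^-1` B) = Q B.
Proof.
move=> iQ; pose fmix := isMeasurableFun.Build _ _ _ _ _ measurable_entries.
pose fm : {mfun _ >-> _} := HB.pack entries fmix.
apply: (@field_measure_unique R _ _ _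
  [set A `*` B | A in (measurable : set (set bool)) & B in (measurable : set (set (weight R)))]
  (distribution P fm) Q).
- exact: measurable_prod_measurableType.
- move=> _ _ [A1 mA1 [B1 mB1 <-]] [A2 mA2 [B2 mB2 <-]].
  by rewrite -setXI; exists (A1 `&` A2); [exact: measurableI|exists (B1 `&` B2) => //; exact: measurableI].
- by exists setT => //; exists setT => //; rewrite setXTT.
move=> A /= hA.
have /choice[A1 /choice[A2 hA12]] : forall t, exists A1, exists A2,
    [/\ measurable A1, measurable A2 & A t = A1 `*` A2].
  by move=> t; have [A1 m1 [A2 m2 E]] := hA t; exists A1, A2.
have m1 t : measurable (A1 t) by have [] := hA12 t.
have m2 t : measurable (A2 t) by have [] := hA12 t.
have [lb lw indep] := bw.
pose E (i : I + I) : set Omega :=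
  match i with inl t => b t @^-1` A1 t | inr t => w t @^-1` A2 t end.
transitivity (P (entries @^-1` box A)) => //.
have -> : entries @^-1` box A = \bigcap_(i in [set` [set: I + I]%SET]) E i.
  apply/seteqP; split => o /= h.
    by move=> [t|t] _; have [_ _ At] := hA12 t; have := h t; rewrite At => -[].
  by move=> t; have [_ _ ->] := hA12 t; split;
    [apply: (h (inl t))|apply: (h (inr t))]; rewrite /= inE.
rewrite indep; last first.
  move=> [t|t] _ /=.
    by exists (A1 t) => //; rewrite setTI.
  by exists (A2 t) => //; rewrite setTI.
rewrite (eq_bigl predT) => [|i]; last by rewrite inE.
rewrite big_sumType/= -big_split/= iQ => [|t]; last first.
  by have [? ? ->] := hA12 t; exact: measurableX.
apply: eq_bigr => t _; have [_ _ ->] := hA12 t.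
transitivity (bernoulli_prob p (A1 t) * D (A2 t))%E; last first.
  by apply/esym; apply: product_measure1E.
by have := lb t _ (m1 t); have := lw t _ (m2 t); rewrite /distribution /pushforward /= => -> ->.
Qed.

Lemma iid_entries_copy (Q : probability (field ((bool * bool) * I) state) R) : iid (entry_law p D) Q ->
  forall B, measurable B -> P (entries @^-1` B) =
    Q ((fun x : field ((bool * bool) * I) state => (fun t => x ((false, false), t)) : field I state) @^-1` B).
Proof.
move=> iQ B mB; have [Q' iQ'] := iid_exists (entry_law p D) I.
rewrite (iid_entries iQ' mB) -(iid_reindex (c := fun t => ((false, false), t)) _ iQ iQ')//.
by move=> t t' [].
Qed.

End Transfer.

Lemma kolmogorov_dist_le1 (R : realType) d (T : measurableType d) (P : probability T R) (Z : T -> R)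
    (m s : R) : measurable_fun setT Z ->
  (kolmogorov_dist (pushforward P Z) (normal_prob m s) <= 1)%E.
Proof.
move=> mZ; pose nu : probability _ R := normal_prob m s.
apply: ge_ereal_sup => _ [t _ <-].
have mI : measurable (`]-oo, t]%classic : set R) by exact: measurable_itv.
have mA : measurable (Z @^-1` `]-oo, t]%classic) by rewrite -[X in measurable X]setTI; exact: mZ.
rewrite /pushforward -[normal_prob m s _]/(nu _).
rewrite -(fineK (fin_num_measure P _ mA)) -(fineK (fin_num_measure nu _ mI)).
have /andP[a0 a1] : 0 <= fine (P (Z @^-1` `]-oo, t]%classic)) <= 1.
  by rewrite -!lee_fin fineK ?fin_num_measure// measure_ge0 probability_le1.
have /andP[b0 b1] : 0 <= fine (nu `]-oo, t]%classic) <= 1.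
  by rewrite -!lee_fin fineK ?fin_num_measure// measure_ge0 probability_le1.
by rewrite -EFinB abse_EFin lee_fin ler_norml; apply/andP; split; lra.
Qed.

Lemma powR_root (R : realType) (x : R) k : 0 <= x -> (0 < k)%N -> (x `^ (1 / k%:R)) ^+ k = x.
Proof.
move=> x0 k0; rewrite -powR_mulrn ?powR_ge0// -powRrM div1r mulVf ?powRr1//.
by rewrite pnatr_eq0 -lt0n.
Qed.

Section Reduction.
Variables (R : realType) (n d M : nat) (g : forall T : finType, wcomplex R T -> R).
Variables (H : weight R * weight R -> weight R) (p : R) (D : probability (weight R) R) (c : R).
Local Notation I := (simplex n d).
Local Notation state := (bool * weight R)%type.
Local Notation J := ((bool * bool) * I)%type.
Hypotheses (mH : measurable_fun setT H) (mf : BW_measurable d (@local_sum R n d g M)).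
Hypothesis lip : H_lipschitz d H (@local_sum R n d g M).
Hypotheses (p01 : 0 < p < 1) (c1 : 1 <= c).
Hypothesis Hc : (\int[(D \x D)%E]_z (wval (H z) ^+ 6)%:E <= (c ^+ 6)%:E)%E.
Variable Q : probability (field J state) R.
Hypothesis iQ : iid (entry_law p D) Q.
Context (dO : measure_display) (Omega : measurableType dO) (P : probability Omega R).
Variables (b : I -> {RV P >-> bool}) (w : I -> {RV P >-> weight R}).
Hypothesis bw : random_BW p D b w.
Local Notation f := (resampled_sum M g pred0 pred0).
Local Notation mu := (\int[Q]_x f x).

Let fX (omega : Omega) : R :=
  local_sum d g M (BW_complex (fun t => b t omega) (fun t => w t omega)).

Let copy (x : field J state) : field I state := fun t => x ((false, false), t).

Let mcopy : measurable_fun setT copy.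
Proof. exact: measurable_reindex. Qed.

Let f2 : L2 Q f. Proof. exact: (L2_resampled_sum0 mH mf lip p01 c1 Hc iQ). Qed.

Let law B : measurable B -> Q (copy @^-1` B) = P (entries b w @^-1` B).
Proof. by move=> mB; apply/esym; exact: (iid_entries_copy bw iQ mB). Qed.

Let transfer (h : R -> R) : measurable_fun setT h -> L1 Q (fun x => h (f x)) ->
  \int[P]_o h (fX o) = \int[Q]_x h (f x).
Proof.
move=> mh h1.
have mG : measurable_fun setT (fun y : field I state => h (field_sum M g y)).
  exact: (measurableT_comp mh (measurable_field_sum mf)).
by apply/esym; exact: (eq_law_Rintegral mcopy (measurable_entries b w) law mG h1).
Qed.

Lemma expectation_entries : fine ('E_P[fX])%E = mu.
Proof.
rewrite unlock; exact: (@transfer id (@measurable_id _ _ _) (L2_L1 f2)).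
Qed.

Lemma variance_entries : fine ('V_P[fX])%E = \int[Q]_x ((f x - mu) ^+ 2).
Proof.
rewrite /variance unlock unlock -/(Rintegral _ _ _).
transitivity (\int[P]_o ((fX o - mu) ^+ 2)).
  by apply: eq_Rintegral => o _; rewrite expr2 -expectation_entries unlock.
apply: (@transfer (fun y : R => (y - mu) ^+ 2)).
  by apply: measurable_funX; exact: measurable_funB.
have B2 : L2 Q (fun x => f x - mu) by apply: L2B => //; exact: L2_cst.
by have [] := B2.
Qed.

Lemma kolmogorov_entries (s : R) (nu : set R -> \bar R) :
  kolmogorov_dist (pushforward P (fun o => (fX o - mu) / s)) nu =
  kolmogorov_dist (pushforward Q (fun x => (f x - mu) / s)) nu.
Proof.
rewrite /kolmogorov_dist.
have mG : measurable_fun setT (fun y : field I state => (field_sum M g y - mu) / s).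
  by apply: measurable_funM => //; apply: measurable_funB => //; exact: measurable_field_sum.
have E t : pushforward P (fun o => (fX o - mu) / s) `]-oo, t]%classic =
    pushforward Q (fun x => (f x - mu) / s) `]-oo, t]%classic.
  have := law (mG measurableT `]-oo, t]%classic (measurable_itv _)).
  by rewrite !setTI => /esym.
by congr ereal_sup; apply: eq_imagel => t _; rewrite E.
Qed.

Lemma variance_M0 : M = 0%N -> iso_invariant d g -> (0 < d)%N ->
  \int[Q]_x ((f x - mu) ^+ 2) = 0.
Proof.
move=> M0 ginv d0; pose k := f (fun _ : J => point).
have fk (x : J -> state) : f x = k by exact: field_sum_const.
have -> : mu = k.
  transitivity (\int[Q]_x k); last exact: Ex_cst.
  by apply: eq_Rintegral => x _; rewrite fk.
transitivity (\int[Q]_x (0 : R)); last exact: Ex_cst.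
by apply: eq_Rintegral => x _; rewrite fk subrr expr0n.
Qed.

Lemma kolmogorov_Q_le (s e : R) : 0 < s -> s ^+ 2 = \int[Q]_x ((f x - mu) ^+ 2) -> 0 < e ->
  (kolmogorov_dist (pushforward Q (fun x => (f x - mu) / s)%R) (normal_prob 0 1) <=
   (e + (2 * Num.sqrt (\int[Q]_x ((stein_kernel M g x - \int[Q]_y stein_kernel M g y) ^+ 2)) / s ^+ 2 +
     #|{: I}|%:R * (2 * (3 + e^-1) * (p * c ^+ 3)) / s ^+ 3))%:E)%E.
Proof.
move=> s0 sE e0; apply: kolmogorov_le => //.
  by apply: measurable_funM => //; apply: measurable_funB => //; exact: measurable_resampled_sum.
move=> phi dphi dp b1 b2 b3.
exact: (stein_error mH mf lip p01 c1 Hc iQ s0 sE dp b1 b2 b3).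
Qed.

End Reduction.

Lemma smoothing_bound (R : realType) (nu h c mh r s t K V N p : R) :
  1 <= nu -> nu <= h -> 1 <= c -> 1 <= mh -> r * s = h -> 0 < s -> 0 < t -> 0 <= K -> 0 <= p -> 0 <= N ->
  V <= K ^+ 2 * (h ^+ 2 * c ^+ 2 * mh ^+ 2 * t ^+ 6) ^+ 2 ->
  N * p <= h ^+ 2 * mh ^+ 2 -> s ^+ 2 <= N * (p * c ^+ 2) -> nu^-1 <= t ^+ 12 ->
  c * mh * r * t < 1 ->
  c * mh * r * t + (2 * Num.sqrt V / s ^+ 2 +
    N * (2 * (3 + (c * mh * r * t)^-1) * (p * c ^+ 3)) / s ^+ 3) <=
  (9 + 2 * K) * (c * mh * r * t).
Proof.
move=> nu1 nuh c1 mh1 rs s0 t0 K0 p0 N0 Vle Np s2 nut eta1.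
have c0 : 0 < c by exact: lt_le_trans c1.
have mh0 : 0 < mh by exact: lt_le_trans mh1.
have nu0 : 0 < nu by exact: lt_le_trans nu1.
have h0 : 0 < h by exact: lt_le_trans nuh.
have rE : r = h / s by rewrite -rs mulfK ?gt_eqF.
have r0 : 0 < r by rewrite rE divr_gt0.
set q := c * mh * r; have q0 : 0 < q by rewrite !mulr_gt0.
set y := q * t in eta1 *; have y0 : 0 < y by rewrite mulr_gt0.
have q1 : 1 <= q.
  rewrite -(@expr_ge1 _ 2 q isT (ltW q0)) /q rE.
  have -> : (c * mh * (h / s)) ^+ 2 = (h ^+ 2 * mh ^+ 2) * c ^+ 2 / s ^+ 2 by field; rewrite gt_eqF.
  rewrite ler_pdivlMr ?exprn_gt0// mul1r; apply: (le_trans s2); rewrite mulrA.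
  by apply: ler_wpM2r Np; rewrite exprn_ge0// ltW.
have ty : t <= y := ler_peMl (ltW t0) q1.
have t1 : t <= 1 by rewrite (le_trans ty)// ltW.
have tX m : t ^+ m <= 1 by rewrite exprn_ile1// ltW.
have y2 : y ^+ 2 <= y by rewrite expr2 ler_piMl// ltW.
have y3 : y ^+ 3 <= y ^+ 2 by rewrite exprS ler_piMl ?exprn_ge0// ltW.
have A : Num.sqrt V / s ^+ 2 <= K * y.
  have W0 : 0 <= h ^+ 2 * c ^+ 2 * mh ^+ 2 * t ^+ 6.
    by apply: mulr_ge0; [apply: mulr_ge0; [apply: mulr_ge0|]|]; exact/exprn_ge0/ltW.
  have sV : Num.sqrt V <= K * (h ^+ 2 * c ^+ 2 * mh ^+ 2 * t ^+ 6).
    rewrite -[leRHS]ger0_norm; last exact: mulr_ge0.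
    by rewrite -sqrtr_sqr ler_sqrt ?sqr_ge0// exprMn.
  rewrite ler_pdivrMr ?exprn_gt0//; apply: (le_trans sV).
  rewrite -[leRHS]mulrA; apply: ler_wpM2l => //.
  have -> : h ^+ 2 * c ^+ 2 * mh ^+ 2 * t ^+ 6 = y ^+ 2 * t ^+ 4 * s ^+ 2.
    by rewrite /y /q rE; field; rewrite gt_eqF.
  apply: ler_wpM2r; first by rewrite exprn_ge0// ltW.
  by rewrite (le_trans _ y2)// ler_piMr// exprn_ge0// ltW.
have B : N * (p * c ^+ 3) / s ^+ 3 <= y ^+ 3.
  apply: (@le_trans _ _ (h ^+ 2 * mh ^+ 2 * c ^+ 3 / s ^+ 3)).
    rewrite mulrA; apply: ler_wpM2r; first by rewrite invr_ge0 exprn_ge0// ltW.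
    by apply: ler_wpM2r => //; rewrite exprn_ge0// ltW.
  have -> : h ^+ 2 * mh ^+ 2 * c ^+ 3 / s ^+ 3 = q ^+ 3 / (mh * h).
    by rewrite /q rE; field; rewrite !gt_eqF.
  have -> : y ^+ 3 = q ^+ 3 * t ^+ 3 by rewrite /y exprMn.
  apply: ler_wpM2l; first by rewrite exprn_ge0// ltW.
  apply: (@le_trans _ _ (t ^+ 12)).
    apply: le_trans nut; rewrite lef_pV2 ?posrE ?mulr_gt0//.
    by apply: (le_trans nuh); rewrite ler_peMl// ltW.
  by rewrite (_ : 12 = 3 + 9)%N// exprD ler_piMr// exprn_ge0// ltW.
have -> : N * (2 * (3 + y^-1) * (p * c ^+ 3)) / s ^+ 3 =
   2 * (3 + y^-1) * (N * (p * c ^+ 3) / s ^+ 3) by field; rewrite !gt_eqF.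
have C : 2 * (3 + y^-1) * (N * (p * c ^+ 3) / s ^+ 3) <= 8 * y.
  apply: (@le_trans _ _ (2 * (3 + y^-1) * y ^+ 3)).
    apply: ler_wpM2l => //; rewrite mulr_ge0// addr_ge0// invr_ge0 ltW//.
  have -> : 2 * (3 + y^-1) * y ^+ 3 = 6 * y ^+ 3 + 2 * y ^+ 2 by field; rewrite gt_eqF.
  lra.
by rewrite -[2 * _ / _]mulrA; lra.
Qed.

Theorem theorem3p6 (R : realType) (d : nat) (hd : (2 <= d)%N) :
  exists C : R, 0 <= C /\
  forall (M n : nat) (g : forall T : finType, wcomplex R T -> R)
    (H : weight R * weight R -> weight R) (p : R)
    (D : probability (weight R) R)
    (dO : measure_display) (Omega : measurableType dO) (P : probability Omega R)
    (b : simplex n d -> {RV P >-> bool}) (w : simplex n d -> {RV P >-> weight R}),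
  let f := local_sum d g M in
  let fX := fun omega : Omega =>
    f (BW_complex (fun t => b t omega) (fun t => w t omega)) in
  let J := J_const D H in
  let lambda := n%:R * p in
  let sigma := Num.sqrt (fine 'V_P[fX]) in
  let Z := fun omega : Omega => (fX omega - fine 'E_P[fX]) / sigma in
  (2 * d + 2 <= n)%N ->
  iso_invariant d g ->
  measurable_fun [set: weight R * weight R] H ->
  BW_measurable d f ->
  H_lipschitz d H f ->
  (J < +oo)%E ->
  0 < p < 1 ->
  random_BW p D b w ->
  0 < sigma ->
  forall k : nat, (2 * M <= k)%N -> (k <= n)%N ->
  (kolmogorov_dist (pushforward P Z) (normal_prob 0 1) <= (C * fine J `^ (1 / 6) * (Num.max 1 lambda) `^ (1 / 2)
         * (n%:R ^+ d / sigma ^+ 2) `^ (1 / 2)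
         * ((k%:R ^+ 5 * (Num.max 1 (d%:R * lambda)) ^+ (2 * k)) / n%:R) `^ (1 / 12)
       + (n%:R ^+ d / sigma ^+ 2) `^ (3 / 4)
         * ((fine J `^ (1 / 4) * lambda `^ (1 / 2)) / n%:R `^ (d%:R / 4)))%:E)%E.
Proof.
pose K : R := Num.sqrt (515 * d.+1%:R ^+ 3).
have K2 : K ^+ 2 = 515 * d.+1%:R ^+ 3.
  by apply: sqr_sqrtr; apply: mulr_ge0; [exact: ler0n|exact/exprn_ge0/ler0n].
have K0 : 0 <= K by exact: sqrtr_ge0.
have K9 : 1 <= 9 + 2 * K by move: K0; clear; lra.
exists (9 + 2 * K); split; first by apply: addr_ge0 => //; exact: mulr_ge0.
move=> M n g H p D dO Omega P b w f fX J lambda sigma Z nd ginv mH mf lip Jfin p01 bw s0 k Mk kn.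
have d0 : (0 < d)%N by exact: leq_trans hd.
have n0 : (0 < n)%N by apply: leq_trans nd; rewrite addn2.
have [p0 p1] := andP p01.
have J1 : (1%E <= J)%E by rewrite /J /J_const le_max lexx.
have Jf : (fine J)%:E = J.
  by rewrite fineK// fin_real// Jfin (lt_le_trans _ J1)// ltNyr.
have fJ1 : 1 <= fine J by rewrite -lee_fin Jf.
have fJ0 : 0 <= fine J by exact: le_trans fJ1.
set c := fine J `^ (1 / 6).
have c0 : 0 <= c by exact: powR_ge0.
have c6 : c ^+ 6 = fine J by exact: (@powR_root R _ 6 fJ0 isT).
have c1 : 1 <= c by rewrite -(@expr_ge1 _ 6 c isT c0) c6.
have Hc : (\int[(D \x D)%E]_z (wval (H z) ^+ 6)%:E <= (c ^+ 6)%:E)%E.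
  by rewrite c6 Jf /J /J_const le_max lexx orbT.
have [Q iQ] := iid_exists (entry_law p D) ((bool * bool) * simplex n d)%type.
have Ef := expectation_entries mH mf lip p01 c1 Hc iQ bw.
have Vf := variance_entries mH mf lip p01 c1 Hc iQ bw.
set mu := (X in _ = X) in Ef; set V := (X in _ = X) in Vf.
have sE : sigma ^+ 2 = V.
  have V0 : 0 <= V by apply: Ex_ge0 => x; exact: sqr_ge0.
  by rewrite /sigma Vf sqr_sqrtr.
have M0 : (0 < M)%N.
  rewrite lt0n; apply/eqP => M0; have := exprn_gt0 2 s0.
  by rewrite sE /V (variance_M0 Q M0 ginv d0) ltxx.
have VE := variance_le mH mf lip p01 c1 Hc iQ.
pose m := Num.max 1 lambda; pose Lam := Num.max 1 (d%:R * lambda).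
have m1 : 1 <= m by rewrite le_max lexx.
have L1 : 1 <= Lam by rewrite le_max lexx.
have lm : n%:R * p <= m by rewrite le_max lexx orbT.
have lL : n%:R * d%:R * p <= Lam.
  by rewrite le_max /lambda mulrA (mulrC d%:R) lexx orbT.
have VT := var_stein_kernel_le mH mf lip p01 c1 Hc iQ d0 M0 ginv L1 lL m1 lm.
set VarT := (X in n%:R * X) in VT.
set eps := (k%:R ^+ 5 * _) / n%:R.
set mh := Num.max 1 lambda `^ (1 / 2); set r := (_ / sigma ^+ 2) `^ (1 / 2); set t := eps `^ (1 / 12).
set second := (X in (_ + X)%R).
have second0 : 0 <= second.
  apply: mulr_ge0; first exact: powR_ge0.
  by apply: divr_ge0; [apply: mulr_ge0|]; exact: powR_ge0.
have nR0 : 0 < n%:R :> R by rewrite ltr0n.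
have n1 : 1 <= n%:R :> R by rewrite -[leLHS]/(1%:R) ler_nat.
have k1 : (1 <= k)%N by apply: leq_trans Mk; rewrite muln_gt0.
have kR1 : 1 <= k%:R :> R by rewrite -[leLHS]/(1%:R) ler_nat.
have eps1 : n%:R^-1 <= eps.
  rewrite /eps -[leLHS]mul1r; apply: ler_wpM2r; first by rewrite invr_ge0 ltW.
  by apply: mulr_ege1; exact: exprn_ege1.
have eps0 : 0 < eps by apply: lt_le_trans eps1; rewrite invr_gt0.
have t0 : 0 < t by exact: powR_gt0.
have t12 : t ^+ 12 = eps by exact: (@powR_root R _ 12 (ltW eps0) isT).
have mh2 : mh ^+ 2 = m by exact: (@powR_root R _ 2 (le_trans ler01 m1) isT).
have mh1 : 1 <= mh by rewrite -(@expr_ge1 _ 2 mh isT (powR_ge0 _ _)) mh2.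
have as0 : 0 <= n%:R ^+ d / sigma ^+ 2 by apply: divr_ge0; [exact/exprn_ge0/ltW|exact: sqr_ge0].
have r2 : r ^+ 2 = n%:R ^+ d / sigma ^+ 2 by exact: (@powR_root R _ 2 as0 isT).
pose h := r * sigma.
have h0 : 0 <= h by apply: mulr_ge0; [exact: powR_ge0|exact: ltW].
have h2 : h ^+ 2 = n%:R ^+ d by rewrite exprMn r2 divfK// expf_neq0// gt_eqF.
have nh : n%:R <= h.
  have : n%:R ^+ 2 <= h ^+ 2 by rewrite h2; exact: ler_weXn2l.
  by rewrite ler_pXn2r ?nnegrE ?ler0n.
have mZ : measurable_fun setT Z.
  rewrite /Z; apply: measurable_funM => //; apply: measurable_funB => //.
  exact: (measurableT_comp (measurable_field_sum mf) (measurable_entries b w)).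
have y0 : 0 <= c * mh * r * t.
  by apply: mulr_ge0; [apply: mulr_ge0; [apply: mulr_ge0|]|]; exact: powR_ge0.
apply: (@le_trans _ _ ((9 + 2 * K) * (c * mh * r * t))%:E); last first.
  by rewrite lee_fin !mulrA lerDl.
have [eta1|eta1] := ltP (c * mh * r * t) 1; last first.
  apply: (le_trans (kolmogorov_dist_le1 P 0 1 mZ)); rewrite lee_fin.
  exact: mulr_ege1.
have eta0 : 0 < c * mh * r * t.
  have r0 : 0 < r by rewrite -(pmulr_lgt0 _ s0); exact: lt_le_trans nh.
  by rewrite !mulr_gt0// (lt_le_trans ltr01).
have N1 : #|{: simplex n d}|%:R * p <= h ^+ 2 * mh ^+ 2.
  rewrite h2 mh2; apply: (@le_trans _ _ (n%:R ^+ d.+1 * p)).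
    by apply: ler_wpM2r; [exact: ltW|rewrite -natrX ler_nat; exact: card_simplex_le].
  by rewrite exprSr -mulrA; apply: ler_wpM2l => //; exact/exprn_ge0/ltW.
have VarT_le : VarT <= K ^+ 2 * (h ^+ 2 * c ^+ 2 * mh ^+ 2 * t ^+ 6) ^+ 2.
  rewrite -(ler_pM2l nR0); apply: (le_trans VT).
  have -> : n%:R * (K ^+ 2 * (h ^+ 2 * c ^+ 2 * mh ^+ 2 * t ^+ 6) ^+ 2) =
     515 * (n%:R ^+ (2 * d) * c ^+ 4 * m ^+ 2 * (d.+1%:R ^+ 3 * (k%:R ^+ 5 * Lam ^+ (2 * k)))).
    have -> : k%:R ^+ 5 * Lam ^+ (2 * k) = t ^+ 12 * n%:R by rewrite t12 /eps divfK// gt_eqF.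
    by rewrite K2 h2 mh2 (mulnC 2) exprM; ring.
  apply: ler_wpM2l; first exact: ler0n.
  apply: ler_wpM2l.
    by apply: mulr_ge0; [apply: mulr_ge0; apply: exprn_ge0 => //; exact: ltW|exact: sqr_ge0].
  rewrite -mulrA; apply: ler_wpM2l; first exact/exprn_ge0/ler0n.
  apply: ler_pM; [exact/exprn_ge0/ler0n|exact/exprn_ge0/(le_trans ler01)| |].
    apply: (@le_trans _ _ (k%:R ^+ 4)); last exact: ler_weXn2l.
    by apply: lerXn2r; rewrite ?nnegrE ?ler0n// ler_nat.
  apply: ler_weXn2l => //; rewrite -[4%N]/(2 * 2)%N -mulnA leq_mul2l; exact: Mk.
have KQ : kolmogorov_dist (pushforward P Z) (normal_prob 0 1) =
    kolmogorov_dist (pushforward Q (fun x => (resampled_sum M g pred0 pred0 x - mu) / sigma)%R) (normal_prob 0 1).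
  rewrite -(kolmogorov_entries mf iQ bw sigma) /Z Ef; reflexivity.
rewrite KQ; apply: (le_trans (kolmogorov_Q_le mH mf lip p01 c1 Hc iQ s0 sE eta0)).
rewrite lee_fin; apply: (@smoothing_bound _ n%:R h) => //; first exact: ltW.
- by rewrite sE.
- by rewrite t12.
Qed.
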